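(* The following symmetric pairs are represented by the following double Vogan diagrams $(p,c,d)$. (a) $L=C_n$ with $n=2m$, on $D^1=C_n^{(1)}$, a chain $\alpha_0,\dots,\alpha_n$: $p$ has $\alpha_m$ as its only black vertex and $d:\alpha_i\mapsto\alpha_{n-i}$. If $\alpha_m$ is not circled, the diagram represents $(\mathfrak{sp}(m,m),\mathfrak{sp}(m,\mathbb{C}))$; if $\alpha_m$ is circled, it represents $(\mathfrak{sp}(m,m),\mathfrak{gl}(m,\mathbb{H}))$. (b) $L=D_n$ with $n$ even, on $D^1=D_n^{(1)}$ with vertices $\alpha_0,\dots,\alpha_n$ ($\alpha_0,\alpha_1$ joined to $\alpha_2$; chain $\alpha_2,\dots,\alpha_{n-2}$; $\alpha_{n-1},\alpha_n$ joined to $\alpha_{n-2}$): $p$ has $\alpha_{n/2}$ as its only black vertex and $d:\alpha_i\mapsto\alpha_{n-i}$. If $\alpha_{n/2}$ is not circled, the diagram represents $(\mathfrak{so}(n,n),\mathfrak{gl}(n,\mathbb{R}))$; if $\alpha_{n/2}$ is circled, it represents $(\mathfrak{so}(n,n),\mathfrak{so}(n,\mathbb{C}))$. (c) $L=D_n$ with $n$ odd, on $D^2=D_n^{(2)}$, a chain of $n$ vertices $x_0,\dots,x_{n-1}$ with double edges at both ends: $p$ has the middle vertex $x_{(n-1)/2}$ as its only black vertex and $d:x_i\mapsto x_{n-1-i}$. If the middle vertex is not circled, the diagram represents $(\mathfrak{so}(n,n),\mathfrak{gl}(n,\mathbb{R}))$; if the middle vertex is circled, it represents $(\mathfrak{s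o}(n,n),\mathfrak{so}(n,\mathbb{C}))$.
   Context: $L$ is a complex simple Lie algebra with Dynkin diagram $D$. A symmetric pair of $L$ is $(\mathfrak{g},\mathfrak{g}^\sigma)$ with $\mathfrak{g}$ a real form of $L$, $\sigma$ an involution of $\mathfrak{g}$ and $\mathfrak{g}^\sigma$ its fixed subalgebra. There is a Cartan involution $\theta$ of $\mathfrak{g}$ commuting with $\sigma$; extending both $\mathbb{C}$-linearly to $L$ identifies symmetric pairs with pairs of commuting involutions $(\theta,\sigma)$ of $L$ (up to conjugation). $L^{\pm\theta}$ denotes the $\pm1$-eigenspace of $\theta$ (so $L^\theta$ is the fixed subalgebra). Affine diagrams: $D^1=D\cup\{\varphi\}$ is the extended Dynkin diagram ($\varphi$ the lowest root). $D^2$ is the twisted affine diagram: if $\Theta$ is an order-2 diagram automorphism of $D$, the vertices of $D^2$ are the $\Theta$-orbits of vertices of $D$ (simple roots restricted to the $\Theta$-fixed part of the Cartan subalgebra) together with an extra vertex $\varphi$ for the lowest weight of the $(-1)$-eigenspace of $\Theta$. The marks $m_\alpha$ are the positive integers without common factor with $\sum_{D^r}m_\alpha\alpha=0$. A Kac diagram is a painting of the vertices of $D^r$ white or black with $r\sum_{\rm black}m_\alpha=2$. It represents the (unique up to conjugation) involution $\theta$ of $L$ such that the white vertices form the Dynkin diagram of $[L^\theta,L^\theta]$, the number of black vertices is $1+\dim\mathfrak{z}(L^\theta)$ ($\mathfrak z$ = center), and the black vertices are the lowest weights of the $L^\theta$-action on $L^{-\theta}$. Here a Cartan subalgebra $H$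 is chosen so that $\theta$ stabilizes $H$ and a simple system; roots are restricted to $H^\theta$, the vertices $x$ of $D^r$ are such restrictions, and $L_x$ denotes the corresponding weight space of $H^\theta$ in $L$ ($\dim L_x\in\{1,2\}$; always $1$ when $r=1$). An affine Vogan diagram on $D^r$ is a pair $(c,d)$, where $d$ is a diagram automorphism of $D^r$ with $d^2=1$ and $c$ declares each vertex fixed by $d$ circled or not circled. A double Vogan diagram on $D^r$ is a triple $(p,c,d)$ with $p$ a Kac diagram, $(c,d)$ an affine Vogan diagram, and $d$ preserving $p$ (i.e. $\alpha$ and $d\alpha$ always have the same color). It represents commuting involutions $(\theta,\sigma)$ (hence the corresponding symmetric pair) if $p$ represents $\theta$ (i.e. the white vertices of $p$ form the Dynkin diagram of $[L^\theta,L^\theta]$, the number of black vertices of $p$ is $1+\dim\mathfrak{z}(L^\theta)$, and the black vertices of $p$ are the lowest weights of the $L^\theta$-action on $L^{-\theta}$), $\sigma(L_x\cap L^{\pm\theta})=L_{dx}\cap L^{\pm\theta}$ for all $x\in D^r$, and whenever $dx=x$: if $x$ is white, $\sigma=1$ (uncircled) or $\sigma=-1$ (circled) on $L_x\cap L^\theta$; if $x$ is black, $\sigma=1$ (uncircled) or $\sigma=-1$ (circled) on $L_x\cap L^{-\theta}$. *)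

(* Defs.v *)
From HB Require Import structures.
From mathcomp Require Import all_boot all_order all_fingroup all_algebra.
From mathcomp Require Import boolp classical_sets reals complex.

Set Implicit Arguments.
Unset Strict Implicit.
Unset Printing Implicit Defensive.

Import Order.TTheory GRing.Theory Num.Theory.
Local Open Scope ring_scope.

(* Lie algebras are linear Lie algebras: complex ones are subspaces
   L : {vspace 'M[C]_N}, real ones are sets of complex matrices, both with the
   commutator as bracket.  Automorphisms of L are endomorphisms of the ambient
   space 'M[C]_N of which only the action on L matters.  A linear functional on
   a subspace T (a weight) is a function 'M[C]_N -> C of which only the values
   on T matter; equality of functionals on T is {in T, x =1 y}. *)

Section LieAlgebra.
Variables (C : numClosedFieldType) (N : nat).
Local Notation M := 'M[C]_N.
Implicit Types (L H T U V : {vspace M}) (g : set M) (x y : M -> C).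

Definition lie (X Y : M) : M := X *m Y - Y *m X.

Definition ad (X : M) : 'End(M) := linfun (mulmx X \- mulmxr X).

Lemma adE X Y : ad X Y = lie X Y.
Proof. by rewrite lfunE. Qed.

Definition lie_closed L := forall X Y, X \in L -> Y \in L -> lie X Y \in L.

(* The span of all brackets [X, Y] with X in U and Y in V. *)
Definition lie_prod U V : {vspace M} :=
  (<<[seq lie X Y | X <- vbasis U, Y <- vbasis V]>>)%VS.

Definition derived L := lie_prod L L.

Definition center L : {vspace M} :=
  (L :&: \bigcap_(Y <- vbasis L) lker (ad Y))%VS.

Definition nilpotent_alg L := exists k, iter k (lie_prod L) L = 0%VS.

Definition cartan_subalgebra L H :=
  [/\ (H <= L)%VS, lie_closed H, nilpotent_alg H &
      forall X, X \in L -> (forall Y, Y \in H -> lie X Y \in H) -> X \in H].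

Definition killing L (X Y : M) : C :=
  \sum_(i < \dim L) coord (vbasis L) i (ad X (ad Y (vbasis L)`_i)).

Definition lie_aut L (f : 'End(M)) :=
  (f @: L)%VS = L /\ {in L &, forall X Y, f (lie X Y) = lie (f X) (f Y)}.

Definition lie_involution L (f : 'End(M)) :=
  [/\ lie_aut L f, {in L, forall X, f (f X) = X} &
      exists2 X, X \in L & f X != X].

Definition eigsub L (f : 'End(M)) (a : C) : {vspace M} :=
  (L :&: lker (f - a *: \1%VF))%VS.

Definition real_lie_algebra g :=
  [/\ g 0,
      forall a X Y, a \is Num.real -> g X -> g Y -> g (a *: X + Y) &
      forall X Y, g X -> g Y -> g (lie X Y)].

(* L is the direct sum of g and i g. *)
Definition real_form L g :=
  [/\ real_lie_algebra g, (forall X, g X -> X \in L),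
      (forall X, X \in L -> exists A B, [/\ g A, g B & X = A + 'i *: B]) &
      (forall X, g X -> g ('i *: X) -> X = 0)].

(* An involution of a real form g, extended C-linearly to L.  *)
Definition real_involution L g (f : 'End(M)) :=
  lie_involution L f /\ (forall X, g X -> g (f X)).

Definition real_fixed g (f : 'End(M)) : set M := [set X | g X /\ f X = X]%classic.

(* The Killing form of the real form g is the restriction to g of the one of L;
   0 < z in C says that z is real and positive. *)
Definition cartan_involution L g (f : 'End(M)) :=
  real_involution L g f /\
  (forall X, g X -> X != 0 -> 0 < - killing L X (f X)).

Definition weight_space L T x : set M :=
  [set X | X \in L /\ forall h, h \in T -> lie h X = x h *: X]%classic.

Definition is_weight L T x := exists2 X, weight_space L T x X & X != 0.

Definition is_root L T x := is_weight L T x /\ ~ {in T, forall h, x h = 0}.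

Section Systems.
Variables (I : finType) (L T : {vspace M}) (S : {set I}) (x : I -> M -> C).

Definition nat_comb_of (k : I -> nat) (h : M) : C :=
  \sum_(i in S) (k i)%:R * x i h.

Definition simple_system :=
  [/\ forall i, i \in S -> is_root L T (x i),
      forall a : I -> C,
        {in T, forall h, \sum_(i in S) a i * x i h = 0} ->
        forall i, i \in S -> a i = 0 &
      forall y, is_root L T y -> exists k : I -> nat,
        {in T, forall h, y h = nat_comb_of k h} \/
        {in T, forall h, y h = - nat_comb_of k h}].

Definition is_coroot y (h : M) :=
  [/\ h \in T, y h = 2%:R &
      exists e f, [/\ weight_space L T y e,
                      weight_space L T (fun t => - y t) f & h = lie e f]].

(* A i j = <x_j, x_i^vee>. *)
Definition has_cartan_matrix (A : I -> I -> int) :=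
  forall i, i \in S -> exists2 h, is_coroot (x i) h &
    forall j, j \in S -> x j h = (A i j)%:~R.

(* The x i (i in S) are the vertices of the Dynkin diagram of L with respect to
   the Cartan subalgebra T, and its edges are given by A. *)
Definition dynkin_diagram_of (A : I -> I -> int) :=
  [/\ cartan_subalgebra L T, simple_system & has_cartan_matrix A].

(* y is a lowest weight of the action of L on V, for the positive system whose
   simple roots are the x i (i in S). *)
Definition lowest_weight V y :=
  exists v, [/\ weight_space V T y v, v != 0 &
    forall i Y, i \in S -> weight_space L T (fun t => - x i t) Y ->
      lie Y v = 0].

End Systems.
End LieAlgebra.

Definition real_lie_iso (C : numClosedFieldType) (N K : nat)
    (g : set 'M[C]_N) (g' : set 'M[C]_K) :=
  exists f : 'M[C]_N -> 'M[C]_K,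
  [/\ forall a X Y, a \is Num.real -> g X -> g Y ->
        f (a *: X + Y) = a *: f X + f Y,
      forall X Y, g X -> g Y -> f (lie X Y) = lie (f X) (f Y),
      forall X Y, g X -> g Y -> f X = f Y -> X = Y &
      (f @` g)%classic = g'].

(* An affine diagram D^r, encoded by its generalized Cartan matrix
   A i j = 2 (x_i, x_j) / (x_i, x_i).  The vertex of index 0 is the extra
   vertex phi. *)
Record affine_diagram := AffineDiagram {
  twist : nat;
  nvert : nat;
  cartan : 'I_nvert -> 'I_nvert -> int }.

Section DoubleVogan.
Variable D : affine_diagram.
Local Notation vertex := 'I_(nvert D).
Implicit Types (m : vertex -> nat) (p c : {set vertex}) (d : vertex -> vertex).

(* The relation \sum_j m_j x_j = 0, expressed by pairing with the coroots. *)
Definition marks m :=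
  [/\ forall i, (0 < m i)%N, \big[gcdn/0%N]_i m i = 1%N &
      forall i, \sum_j cartan i j * (m j)%:Z = 0].

(* p is the set of black vertices. *)
Definition kac_diagram p :=
  exists2 m, marks m & (twist D * \sum_(i in p) m i)%N = 2%N.

(* c is the set of circled vertices. *)
Definition affine_vogan_diagram c d :=
  [/\ involutive d, forall i j, cartan (d i) (d j) = cartan i j &
      forall i, i \in c -> d i = i].

Definition double_vogan_diagram p c d :=
  [/\ kac_diagram p, affine_vogan_diagram c d &
      forall i, (d i \in p) = (i \in p)].

Section Representation.
Variables (C : numClosedFieldType) (N : nat) (L : {vspace 'M[C]_N}).
Local Notation M := 'M[C]_N.
Implicit Types (theta sigma : 'End(M)) (H : {vspace M}) (x : vertex -> M -> C).

(* H is a theta-stable Cartan subalgebra and b a theta-stable simple system; pi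
   is the automorphism of the Dynkin diagram of L given by theta, and Theta the
   corresponding diagram automorphism of L, which permutes root vectors e of
   the simple roots (so Theta = 1 if pi = 1).  The vertices of D^r other than
   phi are the restrictions of the b i to H^theta, where r is the order of pi.
   phi is the lowest root if r = 1, and the lowest weight of the
   (-1)-eigenspace of Theta if r = 2: in both cases the lowest weight of
   L^Theta on the eigenspace of Theta in L for (-1)^(r-1). *)
Definition affine_realization theta H x :=
  exists (l : nat) (b : 'I_l -> M -> C) (pi : {perm 'I_l})
         (Theta : 'End(M)) (e : 'I_l -> M),
  let T := eigsub H theta 1 in
  [/\ [/\ cartan_subalgebra L H, (theta @: H)%VS = H,
          simple_system L H [set: _]%SET b,
          forall i, {in H, forall h, b i (theta h) = b (pi i) h} &
          #[pi]%g = twist D],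
      [/\ lie_aut L Theta, {in H, Theta =1 theta} &
          forall i, [/\ weight_space L H (b i) (e i), e i != 0 &
                        Theta (e i) = e (pi i)]],
      forall i : vertex, val i <> 0%N -> exists j, {in T, x i =1 b j},
      forall j, exists2 i : vertex, val i <> 0%N & {in T, x i =1 b j} &
      (forall i : vertex, val i = 0%N ->
         lowest_weight (eigsub L Theta 1) T [set: _]%SET b
           (eigsub L Theta ((-1) ^+ (twist D).-1)) (x i)) /\
      has_cartan_matrix L T [set: _]%SET x (@cartan D)].

Definition kac_represents p theta H x :=
  let T := eigsub H theta 1 in
  let K := eigsub L theta 1 in
  let P := eigsub L theta (-1) in
  [/\ dynkin_diagram_of (derived K) (T :&: derived K)%VS (~: p) x (@cartan D),
      #|p| = (1 + \dim (center K))%N &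
      forall y, lowest_weight K T (~: p) x P y <->
        exists2 i, i \in p & {in T, y =1 x i}].

Definition vogan_represents p c d theta sigma H x :=
  let W a i := weight_space (eigsub L theta a) (eigsub H theta 1) (x i) in
  [/\ forall i, (sigma @` W 1 i)%classic = W 1 (d i),
      forall i, (sigma @` W (-1) i)%classic = W (-1) (d i) &
      forall i, d i = i ->
        forall X, W (if i \in p then -1 else 1) i X ->
          sigma X = (if i \in c then - X else X)].

(* (p, c, d) represents the commuting involutions (theta, sigma). *)
Definition represents_involutions p c d theta sigma :=
  exists H x,
    [/\ affine_realization theta H x, kac_represents p theta H x &
        vogan_represents p c d theta sigma H x].

(* (p, c, d) is a double Vogan diagram which represents a symmetric pair
   (g, g^sigma) of L with g isomorphic to g0 and g^sigma isomorphic to h0. *)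
Definition represents_pair p c d (K0 K1 : nat)
    (g0 : set 'M[C]_K0) (h0 : set 'M[C]_K1) :=
  double_vogan_diagram p c d /\
  exists (g : set M) theta sigma,
    [/\ [/\ real_form L g, real_lie_iso g g0 &
            real_lie_iso (real_fixed g sigma) h0],
        cartan_involution L g theta, real_involution L g sigma,
        {in L, forall X, theta (sigma X) = sigma (theta X)} &
        represents_involutions p c d theta sigma].

End Representation.
End DoubleVogan.

Section Classical.
Variable C : numClosedFieldType.

(* The matrices X with X^T F + F X = 0. *)
Definition form_alg (N : nat) (F : 'M[C]_N) : {vspace 'M[C]_N} :=
  lker (linfun (mulmxr F \o trmx) + linfun (mulmx F)).

Lemma mem_form_alg N (F X : 'M[C]_N) :
  (X \in form_alg F) = (X^T *m F + F *m X == 0).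
Proof. by rewrite memv_ker add_lfunE !lfunE. Qed.

Definition Jmx n : 'M[C]_(n + n) := block_mx 0 1%:M (- 1%:M) 0.
Definition Smx n : 'M[C]_(n + n) := block_mx 0 1%:M 1%:M 0.
Definition Ipq p q : 'M[C]_(p + q) := block_mx 1%:M 0 0 (- 1%:M).

(* The simple Lie algebras C_n = sp(n, C) and D_n = so(2n, C), the latter in its
   split realization. *)
Definition type_C n : {vspace 'M[C]_(n + n)} := form_alg (Jmx n).
Definition type_D n : {vspace 'M[C]_(n + n)} := form_alg (Smx n).

(* sp(n, C), of rank n. *)
Definition spC n : set 'M[C]_(n + n) := [set X | X \in form_alg (Jmx n)]%classic.

Definition soC n : set 'M[C]_n := [set X | X \in form_alg (1%:M : 'M[C]_n)]%classic.

Definition so_pq p q : set 'M[C]_(p + q) :=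
  [set X | X \in form_alg (Ipq p q) /\ X \is a mxOver Num.real]%classic.

Definition sp_pq p q : set 'M[C]_((p + q) + (p + q)) :=
  [set X | X \in form_alg (Jmx (p + q)) /\
     let K := block_mx (Ipq p q) 0 0 (Ipq p q) in
     map_mx Num.conj X^T *m K + K *m X = 0]%classic.

Definition glR n : set 'M[C]_n := [set X | X \is a mxOver Num.real]%classic.

(* The quaternionic matrix A + B j, with A and B complex, acts on C^(2n) by
   the block matrix (A, B; - B^*, A^* ), ^* being entrywise conjugation. *)
Definition glH n : set 'M[C]_(n + n) :=
  [set X | exists A B : 'M[C]_n,
     X = block_mx A B (- map_mx Num.conj B) (map_mx Num.conj A)]%classic.

End Classical.

Arguments spC C n : clear implicits.
Arguments soC C n : clear implicits.
Arguments so_pq C p q : clear implicits.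
Arguments sp_pq C p q : clear implicits.
Arguments glR C n : clear implicits.
Arguments glH C n : clear implicits.

(* C_n^(1): chain 0, ..., n, with long end vertices. *)
Definition affC n : affine_diagram := @AffineDiagram 1 n.+1 (fun i j =>
  if i == j then 2
  else if (j == i.+1 :> nat) || (i == j.+1 :> nat) then
    (if ((i == 1%N :> nat) && (j == 0%N :> nat)) ||
        ((i == n.-1 :> nat) && (j == n :> nat)) then -2 else -1)
  else 0).

(* The edges i < j of D_n^(1), n >= 4. *)
Definition edgeD (n i j : nat) : bool :=
  [|| (i == 0%N) && (j == 2%N),
      [&& 0 < i, j == i.+1 & j < n]%N
    | (i == n - 2)%N && (j == n)].

Definition affD1 n : affine_diagram := @AffineDiagram 1 n.+1 (fun i j =>
  if i == j then 2 else if edgeD n i j || edgeD n j i then -1 else 0).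

(* D_n^(2): chain 0, ..., n-1, with short end vertices. *)
Definition affD2 n : affine_diagram := @AffineDiagram 2 n (fun i j =>
  if i == j then 2
  else if (j == i.+1 :> nat) || (i == j.+1 :> nat) then
    (if (i == 0%N :> nat) || (i == n.-1 :> nat) then -2 else -1)
  else 0).

(* Main.v *)
Require Import Defs.
From mathcomp Require Import all_boot all_order all_fingroup all_algebra.
From mathcomp Require Import boolp classical_sets reals complex.
From mathcomp Require Import cyclic ring zify.

Set Implicit Arguments.
Unset Strict Implicit.
Unset Printing Implicit Defensive.

Import Order.TTheory GRing.Theory Num.Theory.
Local Open Scope ring_scope.

(** L is the Lie algebra of a bilinear form F on C^N, and theta and sigma are the
    conjugations by two anticommuting Hermitian involutory matrices Q and W, where
    Q preserves F and W multiplies it by a sign d.  The real form consists of the elements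
    of L which are skew for the Hermitian form of Q.  There theta is X |-> - X^*, X^*
    being the conjugate transpose, so theta is a Cartan involution because the Killing form
    is a positive multiple of the trace form (killing_form, hform_cartan).  One
    family of matrices covers everything: F alternating for (a), symmetric for (b), and
    symmetric with an additional hyperbolic plane for (c).

    The diagrams.  In a suitable basis of C^N all these matrices are monomial and the
    diagonal part T of L is the common torus.  The root vectors join two basis
    vectors, and their weights are differences of the weights of these.  So the affine
    diagram is a chain of basis vectors P_0, ..., P_(n+1), the vertex x_i being
    the weight of P_i minus that of P_(i+1); at both ends the chain turns back to the
    opposite of P_1 (long end), to the opposite of P_2 (fork) or to a vector of weight zero
    (short end).  Q is 1 on the first half of the chain and -1 on the second half.  Hence
    the root space of x_i lies in L^theta, except for the middle vertex.  Removing it leaves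
    two classical Dynkin diagrams, one for each eigenspace of Q (kac_simple), while
    x_m is the least weight of L^(-theta) for a coweight that is positive on the white
    vertices (kac_lowest).  W permutes the basis vectors, reversing the chain, which gives
    the flip of the diagram; on the root space of x_m sigma is a sign which depends on d
    and on the symmetry of F (vogan_main).  In (c) theta induces the reflection in the last
    coordinate of the Cartan subalgebra of D_n, which exchanges the branches of the fork of
    the Dynkin diagram; restriction to T turns this fork into a short end
    (outer_realization).

    The fixed algebras.  Q exchanges the eigenspaces of W, so an element of g^sigma is
    determined by its block on the (+1)-eigenspace V+ of W.  If d = 1, then V+ is
    nondegenerate for F and the block is any element of the Lie algebra of F on V+,
    which is sp(m,C) or so(n,C) (fixed_form_iso).  If d = -1, then V+ is isotropic and the
    block is any matrix which commutes with the antilinear map v |-> Q F (conj v) of V+,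
    a quaternionic or a real structure; this gives gl(m,H) or gl(n,R)
    (fixed_gl_iso). *)

(** * Conjugation by an involutory matrix *)

Section Adjoint.
Variable C : numClosedFieldType.

Definition adj m n (X : 'M[C]_(m, n)) : 'M[C]_(n, m) := map_mx Num.conj X^T.

Lemma adjE m n (X : 'M[C]_(m, n)) i j : adj X i j = Num.conj (X j i).
Proof. by rewrite !mxE. Qed.

Lemma adjK m n (X : 'M[C]_(m, n)) : adj (adj X) = X.
Proof. by apply/matrixP=> i j; rewrite !adjE conjCK. Qed.

Lemma adjM m n p (X : 'M[C]_(m, n)) (Y : 'M[C]_(n, p)) :
  adj (X *m Y) = adj Y *m adj X.
Proof. by rewrite /adj trmx_mul map_mxM. Qed.

Lemma adjD m n (X Y : 'M[C]_(m, n)) : adj (X + Y) = adj X + adj Y.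
Proof. by rewrite /adj linearD map_mxD. Qed.

Lemma adjN m n (X : 'M[C]_(m, n)) : adj (- X) = - adj X.
Proof. by rewrite /adj linearN map_mxN. Qed.

Lemma adjZ m n a (X : 'M[C]_(m, n)) : adj (a *: X) = Num.conj a *: adj X.
Proof. by rewrite /adj linearZ map_mxZ. Qed.

Lemma adj1 n : adj (1%:M : 'M[C]_n) = 1%:M.
Proof. by rewrite /adj trmx1 map_mx1. Qed.

Lemma adj_tr m n (X : 'M[C]_(m, n)) : adj X^T = (adj X)^T.
Proof. by apply/matrixP=> i j; rewrite !mxE. Qed.

Lemma conjmx_adj m n (X : 'M[C]_(m, n)) : map_mx Num.conj X = (adj X)^T.
Proof. by apply/matrixP=> i j; rewrite !mxE. Qed.

Lemma adj_block m1 m2 n1 n2 (A : 'M[C]_(m1, n1)) (B : 'M[C]_(m1, n2))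
    (D : 'M[C]_(m2, n1)) (E : 'M[C]_(m2, n2)) :
  adj (block_mx A B D E) = block_mx (adj A) (adj D) (adj B) (adj E).
Proof. by rewrite /adj tr_block_mx map_block_mx. Qed.

Lemma tr_adj_gt0 n (X : 'M[C]_n) : X != 0 -> 0 < \tr (X *m adj X).
Proof.
move=> X0.
have e : \tr (X *m adj X) = \sum_i \sum_j X i j * Num.conj (X i j).
  by apply: eq_bigr => i _; rewrite mxE; apply: eq_bigr => j _; rewrite adjE.
have ge0 : forall i j, 0 <= X i j * Num.conj (X i j) by move=> i j; rewrite mul_conjC_ge0.
have [i [j Xij]] : exists i j, X i j != 0.
  case: (pickP (fun ij : 'I_n * 'I_n => X ij.1 ij.2 != 0)) => [[i j] /=|h].
    by exists i, j.
  case/eqP: X0; apply/matrixP=> i j; rewrite mxE.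
  by have := h (i, j) => /= /negbFE/eqP.
rewrite e (bigD1 i) //= (bigD1 j) //= -addrA ltr_wpDr ?mul_conjC_gt0 //.
by rewrite addr_ge0 ?sumr_ge0 // => k _; rewrite sumr_ge0.
Qed.

End Adjoint.

Section Conjugation.
Variables (C : numClosedFieldType) (N : nat).
Local Notation M := 'M[C]_N.

(** Meant for A *m A = 1: then A X A is the conjugate of X by A, and cj A is an
    involution of the associative algebra. *)
Definition cj (A : M) : 'End(M) := linfun (mulmx A \o mulmxr A).

Lemma cjE A X : cj A X = A *m X *m A.
Proof. by rewrite lfunE /= mulmxA. Qed.

Lemma lieZl a (X Y : M) : lie (a *: X) Y = a *: lie X Y.
Proof. by rewrite /lie -scalemxAl -scalemxAr scalerBr. Qed.
Lemma lieZr a (X Y : M) : lie X (a *: Y) = a *: lie X Y.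
Proof. by rewrite /lie -scalemxAl -scalemxAr scalerBr. Qed.
Lemma lieC (X Y : M) : lie X Y = - lie Y X.
Proof. by rewrite /lie opprB. Qed.

Section Inv.
Variable A : M.
Hypothesis AA : A *m A = 1%:M.

Lemma cjK X : cj A (cj A X) = X.
Proof. by rewrite !cjE !mulmxA AA mul1mx -mulmxA AA mulmx1. Qed.

Lemma cj_lie X Y : cj A (lie X Y) = lie (cj A X) (cj A Y).
Proof.
rewrite /lie linearB /= !cjE; congr (_ - _);
by rewrite -!mulmxA !(mulmxA A A) AA !mul1mx.
Qed.

(** A matrix that multiplies the form F by a sign still normalises its Lie
    algebra; the case d = -1 is what yields the subalgebras gl. *)
Lemma mem_cj (F : M) d X : A^T *m F *m A = d *: F -> d * d = 1 ->
  X \in form_alg F -> cj A X \in form_alg F.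
Proof.
move=> AFA dd; rewrite !mem_form_alg cjE => /eqP XF; apply/eqP.
have AF : A^T *m F = d *: (F *m A).
  by rewrite -[LHS]mulmx1 -AA mulmxA AFA -scalemxAl.
have FA : F *m A = d *: (A^T *m F) by rewrite AF scalerA dd scale1r.
have -> : (A *m X *m A)^T *m F + F *m (A *m X *m A) =
          d *: (A^T *m (X^T *m F + F *m X) *m A).
  rewrite mulmxDr mulmxDl scalerDr !trmx_mul; congr (_ + _).
    by rewrite -!mulmxA AF -!scalemxAr.
  by rewrite !mulmxA FA -!scalemxAl.
by rewrite XF mulmx0 mul0mx scaler0.
Qed.

Lemma cj_aut (F : M) d : A^T *m F *m A = d *: F -> d * d = 1 ->
  lie_aut (form_alg F) (cj A).
Proof.
move=> AFA dd; split=> [|X Y _ _]; last exact: cj_lie.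
apply/vspaceP=> X; apply/memv_imgP/idP=> [[Y LY ->]|LX].
  exact: mem_cj AFA dd LY.
by exists (cj A X); [exact: mem_cj AFA dd LX | rewrite cjK].
Qed.

End Inv.
End Conjugation.

(** * The Killing form of the Lie algebra of a bilinear form *)

Section Killing.
Variables (C : numClosedFieldType) (N : nat).
Local Notation M := 'M[C]_N.

(** The trace of ad X ad Y on L is its trace on all matrices after composition
    with a projector onto L, and the latter trace is a sum over matrix units. *)
Lemma killing_proj (L : {vspace M}) (P : 'End(M)) X Y :
  (forall Z, P Z \in L) -> {in L, P =1 id} ->
  (forall Z, Z \in L -> ad X (ad Y Z) \in L) ->
  killing L X Y = \sum_a \sum_b ad X (ad Y (P (delta_mx a b))) a b.
Proof.
move=> PL Pid XYL; set v := vbasis L.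
have vL (i : 'I_(\dim L)) : v`_i \in L by apply: vbasis_mem; rewrite mem_nth ?size_tuple.
pose g k l := coord v l (ad X (ad Y v`_k)).
have step a b : ad X (ad Y (P (delta_mx a b))) a b =
    \sum_(k < \dim L) \sum_(l < \dim L)
      g k l * (coord v k (P (delta_mx a b)) * v`_l a b).
  rewrite {1}(coord_vbasis (PL (delta_mx a b))) !linear_sum /= summxE.
  apply: eq_bigr => k _; rewrite !linearZ /= mxE.
  rewrite {1}(coord_vbasis (XYL _ (vL k))) summxE mulr_sumr.
  by apply: eq_bigr => l _; rewrite mxE mulrCA.
under eq_bigr do under eq_bigr do rewrite step.
under eq_bigr do rewrite exchange_big /=.
rewrite exchange_big; apply: eq_bigr => k _ /=.
under eq_bigr do rewrite exchange_big /=.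
rewrite exchange_big /=.
under eq_bigr => l _.
  under eq_bigr do rewrite -mulr_sumr.
  rewrite -mulr_sumr.
  have -> : \sum_a \sum_b coord v k (P (delta_mx a b)) * v`_l a b = (k == l)%:R.
    transitivity (coord v k (P v`_l)).
      rewrite [in RHS](matrix_sum_delta v`_l) !linear_sum /=.
      apply: eq_bigr => a _; rewrite !linear_sum /=.
      by apply: eq_bigr => b _; rewrite !linearZ /= mulrC.
    by rewrite Pid ?vL // coord_free ?(basis_free (vbasisP L)) // eq_sym.
  over.
by rewrite (bigD1 k) //= eqxx mulr1 big1 ?addr0 // => l /negPf; rewrite eq_sym => ->; rewrite mulr0.
Qed.

Lemma sum_delta_tr (A B : M) :
  \sum_a \sum_b (A *m delta_mx a b *m B) a b = \tr A * \tr B.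
Proof.
rewrite mulr_suml; apply: eq_bigr => a _; rewrite mulr_sumr.
apply: eq_bigr => b _; rewrite mxE (bigD1 b) //= big1 => [|c /negPf cb].
  rewrite addr0 mxE (bigD1 a) //= big1 => [|c /negPf ca].
    by rewrite mxE !eqxx mulr1 addr0.
  by rewrite mxE ca mulr0.
rewrite mxE big1 ?mul0r // => d _.
by rewrite mxE cb andbF mulr0.
Qed.

Lemma sum_delta_trT (A B : M) :
  \sum_a \sum_b (A *m (delta_mx a b)^T *m B) a b = \tr (A *m B^T).
Proof.
apply: eq_bigr => a _; rewrite mxE; apply: eq_bigr => b _.
rewrite trmx_delta mxE (bigD1 a) //= big1 => [|c /negPf ca].
  rewrite addr0 !mxE (bigD1 b) //= big1 => [|c /negPf cb].
    by rewrite mxE !eqxx mulr1 addr0.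
  by rewrite mxE cb mulr0.
rewrite mxE big1 ?mul0r // => d _.
by rewrite mxE ca andbF mulr0.
Qed.

Section Form.
Variables (F : M) (e : C).
Hypotheses (Fe : F^T = e *: F) (FF : F^T *m F = 1%:M) (ee : e * e = 1).
Let L := form_alg F.

Lemma FFt : F *m F^T = 1%:M. Proof. exact: mulmx1C. Qed.
Lemma FtFt : F^T *m F^T = e%:M.
Proof. by rewrite {2}Fe -scalemxAr FF scalemx1. Qed.

(** L is the fixed space of the involutory map X |-> - F^T X^T F. *)
Lemma form_algP X : reflect (X = - (F^T *m X^T *m F)) (X \in L).
Proof.
rewrite mem_form_alg addr_eq0; apply: (iffP eqP) => h.
  by rewrite -mulmxA h mulmxN opprK mulmxA FF mul1mx.
by rewrite [X in _ = - (_ *m X)]h mulmxN opprK !mulmxA FFt mul1mx.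
Qed.

Lemma form_alg_lie : lie_closed L.
Proof.
move=> X Y /form_algP hX /form_algP hY; apply/form_algP.
have prod A B : A = - (F^T *m A^T *m F) -> B = - (F^T *m B^T *m F) ->
    A *m B = F^T *m (B *m A)^T *m F.
  move=> hA hB; rewrite {1}hA {1}hB mulmxN mulNmx opprK trmx_mul.
  by rewrite -!mulmxA (mulmxA F) FFt mul1mx.
by rewrite /lie linearB /= mulmxBr mulmxBl opprB -(prod X Y) // -(prod Y X).
Qed.

Lemma form_alg_tr0 X : X \in L -> \tr X = 0.
Proof.
move=> /form_algP h.
have : \tr X = - \tr X.
  by rewrite {1}h linearN /= mxtrace_mulC mulmxA FFt mul1mx mxtrace_tr.
move/eqP; rewrite -subr_eq0 opprK -mulr2n mulrn_eq0 /=. by move/eqP.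
Qed.

(** The projector onto L given by that involutory map. *)
Definition fproj : 'End(M) :=
  linfun (2^-1 \*: (idfun \- (mulmx F^T \o mulmxr F \o trmx))).

Lemma fprojE X : fproj X = 2^-1 *: (X - F^T *m X^T *m F).
Proof. by rewrite lfunE /= mulmxA. Qed.

Lemma fproj_mem Z : fproj Z \in L.
Proof.
apply/form_algP; rewrite fprojE linearZ /= -scalemxAr -scalemxAl -scalerN.
congr (_ *: _); rewrite linearB /= mulmxBr mulmxBl opprB; congr (_ - _).
have FFe : F *m F = e%:M.
  have FFt' : F = e *: F^T by rewrite Fe scalerA ee scale1r.
  by rewrite {1}FFt' -scalemxAl FF scalemx1.
rewrite !trmx_mul !trmxK !mulmxA FtFt -!mulmxA FFe.
by rewrite mul_mx_scalar mul_scalar_mx scalerA ee scale1r.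
Qed.

Lemma fproj_id : {in L, fproj =1 id}.
Proof.
move=> X /form_algP h; rewrite fprojE -h -mulr2n -scaler_nat scalerA.
by rewrite mulVf ?scale1r // pnatr_eq0.
Qed.

(** Expanding the trace over matrix units, the four terms of ad X ad Y give
    N tr (XY) twice and products of traces, which vanish on L; the transposed half
    of the projector gives multiples of e tr (XY).  For so(N) and sp(N) this is the
    classical factor N - 2 and N + 2. *)
Lemma killing_form X Y : X \in L -> Y \in L ->
  killing L X Y = (N%:R - 2 * e) * \tr (X *m Y).
Proof.
move=> LX LY; rewrite (killing_proj fproj_mem fproj_id); last first.
  by move=> Z LZ; rewrite !adE; do 2 apply: form_alg_lie => //.
have adad Z : ad X (ad Y Z) = X *m Y *m Z - X *m Z *m Y - Y *m Z *m X + Z *m (Y *m X).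
  by rewrite !adE /lie mulmxBr mulmxBl opprB !mulmxA addrA addrAC.
have adB U U' : ad X (ad Y (U - U')) = ad X (ad Y U) - ad X (ad Y U') by rewrite !linearB.
have adZ c U : ad X (ad Y (c *: U)) = c *: ad X (ad Y U) by rewrite !linearZ.
pose G := F^T.
have e1 a b : ad X (ad Y (fproj (delta_mx a b))) a b = 2^-1 * (
   ((X *m Y) *m delta_mx a b *m 1%:M) a b - (X *m delta_mx a b *m Y) a b
   - (Y *m delta_mx a b *m X) a b + (1%:M *m delta_mx a b *m (Y *m X)) a b
   - (((X *m Y *m G) *m (delta_mx a b)^T *m F) a b
   - ((X *m G) *m (delta_mx a b)^T *m (F *m Y)) a b
   - ((Y *m G) *m (delta_mx a b)^T *m (F *m X)) a b
   + (G *m (delta_mx a b)^T *m (F *m (Y *m X))) a b)).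
  rewrite fprojE adZ adB !adad mxE.
  by rewrite !mulmx1 !mul1mx !mulmxA !mxE.
under eq_bigr do under eq_bigr do rewrite e1.
under eq_bigr do rewrite -mulr_sumr !(big_split, sumrN) /=.
rewrite -mulr_sumr !(big_split, sumrN) /=.
rewrite !sum_delta_tr !sum_delta_trT (form_alg_tr0 LX) (form_alg_tr0 LY) mxtrace1.
rewrite !mul0r !subr0 (mxtrace_mulC Y X).
have hY : F *m Y = - (Y^T *m F).
  by move: LY; rewrite mem_form_alg addrC addr_eq0 => /eqP.
have hX : F *m X = - (X^T *m F).
  by move: LX; rewrite mem_form_alg addrC addr_eq0 => /eqP.
have t1 : \tr (X *m Y *m G *m F^T) = e * \tr (X *m Y).
  by rewrite -mulmxA FtFt mul_mx_scalar linearZ.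
have t2 A B : F *m B = - (B^T *m F) -> \tr (A *m G *m (F *m B)^T) = - e * \tr (A *m B).
  move=> h; rewrite h linearN /= trmx_mul trmxK mulmxN linearN /=.
  by rewrite -!mulmxA (mulmxA G) FtFt mul_scalar_mx -scalemxAr linearZ /= mulNr.
have t3 : \tr (G *m (F *m (Y *m X))^T) = e * \tr (X *m Y).
  by rewrite mxtrace_mulC trmx_mul -mulmxA FtFt mul_mx_scalar linearZ /= mxtrace_tr mxtrace_mulC.
rewrite t1 t3 (t2 _ _ hX) (t2 _ _ hY) (mxtrace_mulC Y X).
by field.
Qed.

End Form.
End Killing.

(** * Real forms given by a Hermitian form *)

Section RealForms.
Variables (C : numClosedFieldType) (N : nat).
Local Notation M := 'M[C]_N.
Variables (F Q : M) (e : C).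
Hypotheses (Fe : F^T = e *: F) (FF : F^T *m F = 1%:M) (ee : e * e = 1).
Hypothesis Freal : adj F = F^T.
Hypotheses (Qh : adj Q = Q) (QQ : Q *m Q = 1%:M) (QF : Q^T *m F *m Q = F).
Let L := form_alg F.

(** The elements of L which are skew for the Hermitian form of Q.  For the
    matrices used below this is sp(m,m) or so(n,n). *)
Definition hform : set M := [set X | X \in L /\ adj X *m Q + Q *m X = 0]%classic.

Lemma adj_form X : X \in L -> adj X \in L.
Proof.
move=> /(form_algP FF) h; apply/(form_algP FF).
by rewrite {1}h adjN !adjM !adj_tr Freal trmxK mulmxA.
Qed.

Lemma hformP X : hform X <-> X \in L /\ X = - (Q *m adj X *m Q).
Proof.
split=> -[LX h]; split=> //.
  have /(congr1 (mulmx Q)) := h.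
  by rewrite mulmxDr mulmx0 !mulmxA QQ mul1mx addrC => /eqP; rewrite addr_eq0 => /eqP.
by rewrite [X in _ + _ *m X]h mulmxN !mulmxA QQ mul1mx subrr.
Qed.

(** The conjugation of L with respect to hform. *)
Definition hconj X := - (Q *m adj X *m Q).

Lemma hconjK X : hconj (hconj X) = X.
Proof.
rewrite /hconj adjN !adjM adjK Qh mulmxN mulNmx opprK.
by rewrite !mulmxA QQ mul1mx -mulmxA QQ mulmx1.
Qed.

Lemma hconj_form X : X \in L -> hconj X \in L.
Proof.
move=> LX; rewrite memvN -cjE; apply: (mem_cj (d := 1) QQ).
- by rewrite QF scale1r.
- by rewrite mulr1.
- exact: adj_form.
Qed.

Lemma hconjD a X Y : hconj (a *: X + Y) = Num.conj a *: hconj X + hconj Y.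
Proof.
by rewrite /hconj adjD adjZ mulmxDr mulmxDl -scalemxAr -scalemxAl opprD scalerN.
Qed.

Lemma hform_real_form : real_form L hform.
Proof.
split.
- split.
  + by split; rewrite ?mem0v // mulmx0 addr0 /adj trmx0 map_mx0 mul0mx.
  + move=> a X Y /CrealP ar /hformP[LX hX] /hformP[LY hY]; apply/hformP.
    rewrite memvD ?memvZ //; split=> //.
    by rewrite -/(hconj _) hconjD ar {1}hX {1}hY.
  + move=> X Y [LX hX] [LY hY]; split; first exact: (form_alg_lie FF).
    have tr Z : adj Z *m Q + Q *m Z = 0 -> adj Z *m Q = - (Q *m Z).
      by move/eqP; rewrite addr_eq0 => /eqP.
    rewrite /lie adjD adjN !adjM mulmxDl mulNmx -!mulmxA (tr _ hX) (tr _ hY).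
    rewrite !mulmxN !mulmxA (tr _ hX) (tr _ hY) !mulNmx !opprK mulmxBr !mulmxA.
    by rewrite addrC addrA subrK subrr.
- by move=> X [].
- move=> X LX; exists (2^-1 *: (X + hconj X)), ((2^-1 / 'i) *: (X - hconj X)).
  have two : (2 : C) != 0 by rewrite pnatr_eq0.
  have c2 : Num.conj (2^-1 : C) = 2^-1 by rewrite fmorphV rmorph_nat.
  have ci : Num.conj (2^-1 / 'i : C) = - (2^-1 / 'i).
    by rewrite rmorphM !fmorphV rmorph_nat /= conjCi invrN mulrN.
  have lin a Y : hconj (a *: Y) = Num.conj a *: hconj Y.
    have := hconjD a Y 0; rewrite !addr0 => ->.
    by rewrite {2}/hconj /adj trmx0 map_mx0 mulmx0 mul0mx oppr0 addr0.
  have add Y Z : hconj (Y + Z) = hconj Y + hconj Z.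
    by have := hconjD 1 Y Z; rewrite rmorph1 !scale1r.
  have sub Y Z : hconj (Y - Z) = hconj Y - hconj Z.
    by rewrite add -scaleN1r lin rmorphN rmorph1 scaleN1r.
  split.
  + apply/hformP; rewrite -/(hconj _) memvZ ?memvD ?hconj_form //; split=> //.
    by rewrite lin add hconjK c2 [_ + X]addrC.
  + apply/hformP; rewrite -/(hconj _) memvZ ?memvB ?hconj_form //; split=> //.
    by rewrite lin sub hconjK ci scaleNr -scalerN opprB.
  + rewrite scalerA mulrCA divff ?neq0Ci // mulr1 -scalerDr addrACA subrr addr0.
    by rewrite -mulr2n -scaler_nat scalerA mulVf // scale1r.
- move=> X /hformP[_ /esym h1] /hformP[_ /esym h2].
  rewrite -/(hconj _) in h1; rewrite -/(hconj _) in h2.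
  have : hconj ('i *: X) = - ('i *: X).
    have := hconjD 'i X 0; rewrite !addr0 => ->.
    by rewrite {2}/hconj /adj trmx0 map_mx0 mulmx0 mul0mx oppr0 addr0 h1 conjCi scaleNr.
  rewrite h2 => /eqP; rewrite -subr_eq0 opprK -mulr2n -scaler_nat scaler_eq0.
  rewrite pnatr_eq0 /= scaler_eq0 (negPf (neq0Ci _)) /=.
  by move/eqP.
Qed.

Lemma cj_involution A d X : A *m A = 1%:M -> A^T *m F *m A = d *: F -> d * d = 1 ->
  X \in L -> cj A X != X -> lie_involution L (cj A).
Proof.
move=> AA AF dd LX AX; split; [exact: cj_aut AF dd | by move=> Y _; exact: cjK |].
by exists X.
Qed.

(** The skewness condition only involves Q up to sign, hence the sign in A Q A = - Q is
    harmless. *)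
Lemma hform_involution A d X : A *m A = 1%:M -> A^T *m F *m A = d *: F -> d * d = 1 ->
  adj A = A -> A *m Q *m A = Q \/ A *m Q *m A = - Q ->
  X \in L -> cj A X != X -> real_involution L hform (cj A).
Proof.
move=> AA AF dd Ah AQ LX AX; split; first exact: cj_involution AF dd LX AX.
have [c cc AQc] : exists2 c : C, c * c = 1 & A *m Q = c *: (Q *m A).
  have AQ1 : A *m Q = A *m Q *m A *m A by rewrite -mulmxA AA mulmx1.
  case: AQ => AQ; [exists 1|exists (-1)]; rewrite ?mulrNN ?mulr1 //.
    by rewrite AQ1 AQ scale1r.
  by rewrite AQ1 AQ scaleN1r mulNmx.
have QAc : Q *m A = c *: (A *m Q) by rewrite AQc scalerA cc scale1r.
move=> Y [LY hY]; split; first exact: mem_cj AF dd LY.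
rewrite cjE !adjM Ah.
have -> : A *m (adj Y *m A) *m Q + Q *m (A *m Y *m A) =
          c *: (A *m (adj Y *m Q + Q *m Y) *m A).
  rewrite mulmxDr mulmxDl scalerDr -!mulmxA AQc (mulmxA Q) QAc.
  by rewrite -!scalemxAl -!scalemxAr -!mulmxA.
by rewrite hY mulmx0 mul0mx scaler0.
Qed.

(** On the real form, conjugation by Q is X |-> - adj X, so - killing X (theta X)
    is a positive multiple of tr (X adj X). *)
Lemma hform_cartan X : 0 < N%:R - 2 * e -> X \in L -> cj Q X != X ->
  cartan_involution L hform (cj Q).
Proof.
move=> Ne LX QX; split.
  apply: (hform_involution (d := 1)) LX QX => //; rewrite ?QF ?scale1r ?mulr1 //.
  by left; rewrite QQ mul1mx.
move=> Y /hformP[LY hY] Y0.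
have cY : cj Q Y = - adj Y.
  by rewrite cjE {1}hY mulmxN mulNmx !mulmxA QQ mul1mx -mulmxA QQ mulmx1.
rewrite cY (killing_form Fe FF ee) //; last by rewrite memvN adj_form.
by rewrite mulmxN linearN /= mulrN opprK mulr_gt0 // tr_adj_gt0.
Qed.

(** ** The fixed algebra of an involution anticommuting with Q *)

(** Q exchanges the two eigenspaces V+ and V- of W, the first of which is the image
    of the isometry i.  An element of the real form fixed by sigma preserves V+ and
    V-, and its block on V- is minus the adjoint of its block on V+, transported by
    Q.  So g^sigma is described by compression to V+. *)
Section EigenIso.
Variables (W : M) (k : nat) (i : 'M[C]_(N, k)).
Hypotheses (Wh : adj W = W) (WW : W *m W = 1%:M) (WQ : W *m Q *m W = - Q).
Hypotheses (ii : adj i *m i = 1%:M) (iW : i *m adj i = 2^-1 *: (1%:M + W)).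

Lemma Wi : W *m i = i.
Proof.
have /(congr1 (fun A => A *m i)) := iW.
rewrite -mulmxA ii mulmx1 -scalemxAl mulmxDl mul1mx => /(congr1 (fun A => 2 *: A)).
rewrite scalerA mulfV ?pnatr_eq0 // scale1r scaler_nat mulr2n => /addrI.
by move=> <-.
Qed.

Lemma iWadj : adj i *m W = adj i.
Proof. by rewrite -{1}Wh -adjM Wi. Qed.

Lemma commP X : W *m X *m W = X <-> W *m X = X *m W.
Proof.
split=> [h|->]; first by rewrite -{2}h -!mulmxA WW mulmx1.
by rewrite -mulmxA WW mulmx1.
Qed.

Lemma WQc : W *m Q = - (Q *m W).
Proof. by rewrite -mulNmx -WQ -!mulmxA WW mulmx1. Qed.

Lemma split_comm X : W *m X = X *m W ->
  X = i *m (adj i *m X *m i) *m adj i + Q *m (i *m (adj i *m (Q *m X *m Q) *m i) *m adj i) *m Q.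
Proof.
move=> WX; have [P defP] : {P | P = i *m adj i} by exists (i *m adj i).
have two : (2 : C) != 0 by rewrite pnatr_eq0.
have e1 Y : i *m (adj i *m Y *m i) *m adj i = P *m Y *m P by rewrite defP !mulmxA.
rewrite !e1.
have PX Y : W *m Y = Y *m W -> P *m Y = Y *m P.
  by move=> h; rewrite defP iW -scalemxAl -scalemxAr mulmxDl mulmxDr mul1mx mulmx1 h.
have PP : P *m P = P by rewrite defP mulmxA -(mulmxA i) ii mulmx1.
have QX : W *m (Q *m X *m Q) = (Q *m X *m Q) *m W.
  rewrite !mulmxA WQc !mulNmx -(mulmxA Q W) WX -!mulmxA WQc !mulmxN opprK.
  by rewrite !mulmxA.
rewrite (PX _ WX) -mulmxA PP (PX _ QX) -(mulmxA _ P) PP.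
rewrite !mulmxA QQ mul1mx -!mulmxA -mulmxDr.
have -> : P + Q *m (P *m Q) = 1%:M.
  rewrite defP iW -!scalemxAl -!scalemxAr -scalerDr mulmxDl mul1mx WQc mulmxDr mulmxN.
  rewrite (mulmxA Q) QQ mul1mx addrACA subrr addr0 -mulr2n -scaler_nat scalerA.
  by rewrite mulVf // scale1r.
by rewrite mulmx1.
Qed.

Lemma compress_lie X Y : W *m X = X *m W ->
  W *m Y = Y *m W -> adj i *m lie X Y *m i = lie (adj i *m X *m i) (adj i *m Y *m i).
Proof.
move=> WX WY.
have cm A B : W *m A = A *m W -> adj i *m A *m i *m (adj i *m B *m i) = adj i *m (A *m B) *m i.
  move=> WA; rewrite !mulmxA -(mulmxA (adj i *m A)) iW -scalemxAr -!scalemxAl.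
  have e1 : adj i *m A *m W = adj i *m A by rewrite -mulmxA -WA mulmxA iWadj.
  rewrite mulmxDr mulmx1 e1 !mulmxDl.
  by rewrite -mulr2n -scaler_nat scalerA mulVf ?pnatr_eq0 // scale1r.
by rewrite /lie mulmxBr mulmxBl !cm.
Qed.

Lemma fixedP X : real_fixed hform (cj W) X <->
  [/\ X \in L, X = hconj X & W *m X = X *m W].
Proof.
split=> [[/hformP[LX hX]]|[LX hX] /commP h]; last by split; [exact/hformP|rewrite cjE].
by rewrite cjE => /commP h; split.
Qed.

Lemma compress_inj X Y : real_fixed hform (cj W) X -> real_fixed hform (cj W) Y ->
  adj i *m X *m i = adj i *m Y *m i -> X = Y.
Proof.
move=> /fixedP[LX hX WX] /fixedP[LY hY WY] h.
have q Z : Z = hconj Z -> adj i *m (Q *m Z *m Q) *m i = - adj (adj i *m Z *m i).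
  move=> {1}->; rewrite /hconj mulmxN mulNmx !mulmxA QQ mul1mx -!(mulmxA _ Q) QQ mulmx1.
  by rewrite !adjM adjK mulmxN mulNmx !mulmxA.
by rewrite (split_comm WX) (split_comm WY) (q X hX) (q Y hY) h.
Qed.

Lemma compress_iso (S : set 'M[C]_k) :
  (forall Y, S Y -> exists2 X, real_fixed hform (cj W) X & adj i *m X *m i = Y) ->
  (forall X, real_fixed hform (cj W) X -> S (adj i *m X *m i)) ->
  real_lie_iso (real_fixed hform (cj W)) S.
Proof.
move=> surj im; exists (fun X => adj i *m X *m i); split.
- move=> a X Y _ _ _; by rewrite mulmxDr mulmxDl -scalemxAr -scalemxAl.
- by move=> X Y /fixedP[_ _ WX] /fixedP[_ _ WY]; exact: compress_lie.
- exact: compress_inj.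
- apply/seteqP; split=> [_ [X fX <-]|Y /surj[X fX <-]]; first exact: im.
  by exists X.
Qed.

(** The two blocks of X live on V+ and on V-, so the second one does not change the
    compression. *)
Lemma lift_fixed Y (X := i *m Y *m adj i + hconj (i *m Y *m adj i)) : X \in L ->
  real_fixed hform (cj W) X /\ adj i *m X *m i = Y.
Proof.
move=> LX.
have iQi : adj i *m Q *m i = 0.
  have : adj i *m Q *m i = - (adj i *m Q *m i).
    have {1}-> : adj i *m Q *m i = adj i *m (W *m Q) *m i by rewrite mulmxA iWadj.
    by rewrite WQc mulmxN mulNmx -!mulmxA Wi.
  move/eqP; rewrite -subr_eq0 opprK -mulr2n -scaler_nat scaler_eq0 pnatr_eq0 /=.
  by move/eqP.
have WP : W *m (i *m Y *m adj i) = (i *m Y *m adj i) *m W.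
  by rewrite !mulmxA Wi -(mulmxA _ (adj i) W) iWadj.
split.
  apply/fixedP; split=> //.
    have := hconjD 1 (i *m Y *m adj i) (hconj (i *m Y *m adj i)).
    by rewrite rmorph1 !scale1r hconjK /X => ->; rewrite addrC.
  rewrite /X mulmxDr mulmxDl; congr (_ + _); first exact: WP.
  rewrite /hconj mulmxN mulNmx; congr (- _); rewrite !adjM adjK !mulmxA WQc.
  rewrite !mulNmx -(mulmxA Q W i) Wi -!(mulmxA _ Q W).
  have -> : Q *m W = - (W *m Q) by rewrite WQc opprK.
  by rewrite !mulmxN !mulmxA -!(mulmxA _ (adj i) W) iWadj.
rewrite /X mulmxDr mulmxDl /hconj !mulmxN mulNmx !adjM adjK !mulmxA ii mul1mx.
by rewrite -!(mulmxA _ (adj i) i) ii mulmx1 iQi !mul0mx subr0.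
Qed.

(** If W preserves F, then V+ and V- are orthogonal for F, so F is nondegenerate on
    V+ and every element of the Lie algebra of its restriction F0 extends. *)
Lemma fixed_form_iso (F0 : 'M[C]_k) : W^T *m F *m W = F -> i^T *m F *m i = F0 ->
  real_lie_iso (real_fixed hform (cj W)) [set Y | Y \in form_alg F0]%classic.
Proof.
move=> WF iF; have W1 : W^T *m F = F *m W by rewrite -{2}WF -!mulmxA WW mulmx1.
have iFi : i^T *m F = F0 *m adj i.
  have iWt : i^T *m W^T = i^T by rewrite -trmx_mul Wi.
  have e1 : i^T *m F *m W = i^T *m F by rewrite -mulmxA -W1 mulmxA iWt.
  rewrite -iF -mulmxA iW -scalemxAr mulmxDr mulmx1 e1.
  by rewrite -mulr2n -scaler_nat scalerA mulVf ?pnatr_eq0 // scale1r.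
have F1i : F *m i = (adj i)^T *m F0.
  have F1 : F = e *: F^T by rewrite Fe scalerA ee scale1r.
  have F0e : F0^T = e *: F0.
    by rewrite -iF !trmx_mul trmxK Fe mulmxA -scalemxAr -scalemxAl.
  have -> : F *m i = e *: (i^T *m F)^T by rewrite trmx_mul trmxK {1}F1 -scalemxAl.
  by rewrite iFi trmx_mul F0e -scalemxAr scalerA ee scale1r.
apply: compress_iso => [Y hY|X /fixedP[LX hX WX]].
  have := @lift_fixed Y; set X := _ + _ => lift.
  case: lift => [|fX XY]; last by exists X.
  have LP : i *m Y *m adj i \in L.
    move: hY; rewrite /= !mem_form_alg => /eqP hY; apply/eqP.
    rewrite !trmx_mul !mulmxA -(mulmxA _ (i^T)) iFi F1i !mulmxA -!mulmxDl.
    by rewrite -!(mulmxA (adj i)^T) -mulmxDr hY mulmx0 mul0mx.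
  by rewrite memvD ?hconj_form.
rewrite /= mem_form_alg; move: LX; rewrite mem_form_alg => /eqP LX.
have -> : (adj i *m X *m i)^T *m F0 + F0 *m (adj i *m X *m i) =
          i^T *m (X^T *m F + F *m X) *m i.
  rewrite mulmxDr mulmxDl !trmx_mul !mulmxA iFi; congr (_ + _).
  by rewrite -!mulmxA F1i.
by rewrite LX mulmx0 mul0mx.
Qed.

(** If W changes the sign of F, then V+ and V- are isotropic and L puts no condition
    on the block on V+.  The condition comes from reality: the antilinear map
    v |-> Q F (conj v) commutes with the real form and preserves V+, where it is
    given by G. *)
Lemma fixed_gl_iso (G : 'M[C]_k) : W^T *m F *m W = - F ->
  Q *m F *m map_mx Num.conj i = i *m G ->
  real_lie_iso (real_fixed hform (cj W))
    [set Y | Y *m G = G *m map_mx Num.conj Y]%classic.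
Proof.
move=> WF iG; set ib := map_mx Num.conj i in iG.
have ibE : ib = (adj i)^T by rewrite /ib conjmx_adj.
have FFT := FFt FF.
have F1 : F = e *: F^T by rewrite Fe scalerA ee scale1r.
have FFe : F *m F = e%:M by rewrite {1}F1 -scalemxAl FF scalemx1.
have key X : X \in L -> hconj X *m (Q *m F) = Q *m F *m map_mx Num.conj X.
  rewrite conjmx_adj => /adj_form/(form_algP FF) h; rewrite /hconj {1}h mulmxN !mulNmx opprK.
  rewrite -(mulmxA _ Q) (mulmxA Q Q) QQ mul1mx.
  rewrite !mulmxA -(mulmxA _ F F) FFe mul_mx_scalar {2}F1.
  by rewrite -!scalemxAr -!scalemxAl.
apply: compress_iso => [Y hY|X /fixedP[LX hX WX]]; last first.
  have Xi : i *m (adj i *m X *m i) = X *m i.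
    rewrite !mulmxA iW -!scalemxAl mulmxDl mul1mx WX mulmxDl -(mulmxA X W) Wi.
    by rewrite -mulr2n -scaler_nat scalerA mulVf ?pnatr_eq0 // scale1r.
  have cXi : map_mx Num.conj X *m ib = ib *m map_mx Num.conj (adj i *m X *m i).
    by rewrite /ib -!map_mxM Xi.
  have step : X *m (Q *m F) = Q *m F *m map_mx Num.conj X by rewrite {1}hX key.
  rewrite /= -(mulmxA _ i G) -iG -(mulmxA (adj i)) (mulmxA X (Q *m F)) step.
  by rewrite -(mulmxA (Q *m F)) cXi (mulmxA (Q *m F)) iG !mulmxA ii mul1mx.
have GG : G *m adj G = 1%:M.
  apply: mulmx1C; rewrite -[adj G]mulmx1 -ii mulmxA -adjM -mulmxA -iG !adjM.
  rewrite Qh Freal -!mulmxA (mulmxA Q Q) QQ mul1mx (mulmxA F^T) FF mul1mx.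
  by rewrite ibE adj_tr adjK -trmx_mul ii trmx1.
have Ft2 : F^T *m F^T = e%:M by exact: FtFt Fe FF.
have ibG : F^T *m ib = e *: (Q *m i *m G).
  rewrite -mulmxA -iG !mulmxA QQ mul1mx.
  by rewrite Fe -scalemxAl.
have := @lift_fixed Y; set X := _ + _ => lift.
case: lift => [|fX XY]; last by exists X.
(* the block on V- is also the one forced by F, since Y commutes with v |-> G (conj v) *)
have -> : X = 2 *: fproj F (i *m Y *m adj i).
  rewrite fprojE scalerA mulfV ?pnatr_eq0 // scale1r /X /hconj; congr (_ - _).
  have er : Num.conj e = e.
    have : (e - 1) * (e + 1) == 0 by rewrite -subr_sqr expr1n expr2 ee subrr.
    rewrite mulf_eq0 subr_eq0 addr_eq0 => /orP[] /eqP ->; last rewrite rmorphN.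
      by rewrite rmorph1.
    by rewrite rmorph1.
  have iGt : i^T *m F = e *: (adj G *m adj i *m Q).
    have := congr1 (@adj _ _ _) ibG; rewrite adjM adjZ !adjM Qh er ibE !adj_tr adjK Freal trmxK.
    by rewrite mulmxA.
  have GYG : G *m Y^T *m adj G = adj Y.
    have := congr1 (@adj _ _ _) hY; rewrite !adjM conjmx_adj adj_tr adjK => h.
    by rewrite -mulmxA -h mulmxA GG mul1mx.
  rewrite !trmx_mul -ibE !mulmxA ibG -(mulmxA _ (i^T) F) iGt.
  rewrite -!scalemxAl -!scalemxAr -?scalemxAl scalerA ee scale1r.
  by rewrite !adjM adjK -GYG !mulmxA.
by rewrite memvZ // (fproj_mem Fe FF ee).
Qed.

End EigenIso.
End RealForms.

Section SplitIso.
Variables (C : numClosedFieldType) (N : nat).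
Variables (F Q U B : 'M[C]_N).
Hypotheses (UU : adj U *m U = 1%:M) (BB : B *m B = 1%:M).
Hypotheses (UQ : adj U *m Q *m U = B) (UF : U^T *m F *m U = B).

(** In coordinates where the bilinear and the Hermitian form have the same matrix B,
    skewness for both forms says that adj X = X^T, that is, that X is real. *)
Lemma hform_split_iso : real_lie_iso (hform F Q)
  [set X | X \in form_alg B /\ X \is a mxOver Num.real]%classic.
Proof.
have UUt : U *m adj U = 1%:M by exact: mulmx1C.
have UtU : U^T *m map_mx Num.conj U = 1%:M.
  by rewrite conjmx_adj -trmx_mul UU trmx1.
pose f X := adj U *m X *m U; pose g Y := U *m Y *m adj U.
have gK X : f (g X) = X by rewrite /f /g !mulmxA UU mul1mx -mulmxA UU mulmx1.
have fK X : g (f X) = X by rewrite /f /g !mulmxA UUt mul1mx -mulmxA UUt mulmx1.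
have QE : Q = g B by rewrite -UQ fK.
have UtUt : map_mx Num.conj U *m U^T = 1%:M by exact: mulmx1C.
have FE : F = map_mx Num.conj U *m B *m adj U.
  by rewrite -UF !mulmxA UtUt mul1mx -!mulmxA UUt mulmx1.
have fM X Y : f (X *m Y) = f X *m f Y.
  by rewrite /f -!mulmxA (mulmxA U) UUt mul1mx !mulmxA.
have fadj X : f (adj X) = adj (f X) by rewrite /f !adjM adjK mulmxA.
have imL X : (X \in form_alg F) = (f X \in form_alg B).
  rewrite !mem_form_alg.
  have e1 : (f X)^T *m B + B *m f X = U^T *m (X^T *m F + F *m X) *m U.
    rewrite mulmxDr mulmxDl FE /f !trmx_mul !mulmxA; congr (_ + _).
      rewrite -[_ *m adj U *m U]mulmxA UU mulmx1; congr (_ *m B).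
      by rewrite -[adj U]trmxK /adj map_trmx !trmxK.
    by rewrite UtU mul1mx.
  apply/eqP/eqP => [h|h]; first by rewrite e1 h mulmx0 mul0mx.
  have := congr1 (fun Z => map_mx Num.conj U *m Z *m adj U) e1.
  rewrite h mulmx0 mul0mx => /esym.
  by rewrite !mulmxA UtUt mul1mx -mulmxA UUt mulmx1.
have imQ X : adj X *m Q + Q *m X = 0 <-> adj (f X) *m B + B *m f X = 0.
  have e1 : adj (f X) *m B + B *m f X = f (adj X *m Q + Q *m X).
    rewrite -fadj -[B in LHS](gK) -QE -!fM.
    by rewrite /f mulmxDr mulmxDl.
  rewrite e1; split=> [->|/(congr1 g)]; first by rewrite /f mulmx0 mul0mx.
  by rewrite fK /g mulmx0 mul0mx.
have real X : X \in form_alg B -> (adj X *m B + B *m X = 0 <-> X \is a mxOver Num.real).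
  rewrite mem_form_alg => /eqP h; have XB : X^T *m B = - (B *m X) by apply/eqP; rewrite -addr_eq0 h.
  have e1 : X \is a mxOver Num.real <-> adj X = X^T.
    split=> [/mxOverP Xr|Xa].
      by apply/matrixP=> i j; rewrite !mxE; exact/CrealP.
    apply/mxOverP => i j; apply/CrealP.
    by move/matrixP/(_ j i): Xa; rewrite !mxE.
  rewrite e1; split=> [/eqP|->]; last by rewrite XB addNr.
  rewrite addr_eq0 -XB => /eqP/(congr1 (mulmxr B)) /=.
  by rewrite -!mulmxA BB !mulmx1.
exists f; split.
- by move=> a X Y _ _ _; rewrite /f mulmxDr mulmxDl -scalemxAr -scalemxAl.
- by move=> X Y _ _; rewrite /lie -!fM /f mulmxBr mulmxBl.
- by move=> X Y _ _ /(congr1 g); rewrite !fK.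
- apply/seteqP; split=> [_ [X [LX hX] <-]|Y [LY rY]] /=.
    have LfX : f X \in form_alg B by rewrite -imL.
    by split=> //; apply/real => //; apply/imQ.
  exists (g Y); last exact: gK.
  split; first by rewrite imL gK.
  by apply/imQ; rewrite gK; apply/real.
Qed.

End SplitIso.

(** * Passing from an eigenspace of Q to an eigenspace of W *)

Section HalfSpace.
Variables (C : numClosedFieldType) (N k : nat).
Variables (F Q W : 'M[C]_N) (e : C) (J : 'M[C]_(N, k)) (F0 : 'M[C]_k).
Hypotheses (Fe : F^T = e *: F) (FF : F^T *m F = 1%:M) (ee : e * e = 1) (Freal : adj F = F^T).
Hypotheses (Qh : adj Q = Q) (QQ : Q *m Q = 1%:M) (QF : Q^T *m F *m Q = F) (Qt : Q^T = Q).
Hypotheses (Wh : adj W = W) (WW : W *m W = 1%:M) (WQ : W *m Q *m W = - Q).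
Hypotheses (JJ : adj J *m J = 1%:M) (JQ : J *m adj J = 2^-1 *: (1%:M + Q)) (JF : J^T *m F *m J = F0).
Hypothesis F0r : map_mx Num.conj F0 = F0.

(** J is an isometry onto the (+1)-eigenspace of Q, on which F restricts to F0.  As W
    exchanges the eigenspaces of Q, v |-> (v + W v) / sqrt 2 is an isometry onto the
    (+1)-eigenspace of W, with the same matrix F0 for the relevant structure. *)
Definition mixed : 'M[C]_(N, k) := (sqrtC 2)^-1 *: ((1%:M + W) *m J).

Let two : (2 : C) != 0. Proof. by rewrite pnatr_eq0. Qed.

Let QJ : Q *m J = J. Proof. exact: Wi JJ JQ. Qed.

Let WQc : W *m Q = - (Q *m W). Proof. exact: WQc WW WQ. Qed.

Let JWJ : adj J *m W *m J = 0.
Proof.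
have JaQ : adj J *m Q = adj J by exact: iWadj Qh JJ JQ.
have : adj J *m W *m J = - (adj J *m W *m J).
  have {1}-> : adj J *m W *m J = adj J *m (W *m Q) *m J by rewrite -!mulmxA QJ.
  by rewrite WQc mulmxN mulNmx !mulmxA JaQ.
by move/eqP; rewrite -subr_eq0 opprK -mulr2n -scaler_nat scaler_eq0 (negPf two) => /eqP.
Qed.

Let QFc : Q *m F = F *m Q.
Proof. by rewrite -{1}Qt -{2}QF -!mulmxA QQ mulmx1. Qed.

Let JtQ : J^T *m Q = J^T.
Proof. by rewrite -Qt -trmx_mul QJ. Qed.

Let JFWJ : J^T *m F *m W *m J = 0.
Proof.
have : J^T *m F *m W *m J = - (J^T *m F *m W *m J).
  have {1}-> : J^T *m F *m W *m J = J^T *m F *m (W *m Q) *m J by rewrite -!mulmxA QJ.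
  by rewrite WQc mulmxN mulNmx !mulmxA -(mulmxA J^T F Q) -QFc mulmxA JtQ.
by move/eqP; rewrite -subr_eq0 opprK -mulr2n -scaler_nat scaler_eq0 (negPf two) => /eqP.
Qed.

Let s2 : (sqrtC 2)^-1 * (sqrtC 2)^-1 = 2^-1 :> C.
Proof. by rewrite -invfM -expr2 sqrtCK. Qed.

Let s2r : Num.conj (sqrtC 2)^-1 = (sqrtC 2)^-1 :> C.
Proof. by apply/CrealP/ger0_real; rewrite invr_ge0 sqrtC_ge0 ler0n. Qed.

Let sqW : (1%:M + W) *m (1%:M + W) = 2 *: (1%:M + W).
Proof. by rewrite mulmxDr mulmx1 mulmxDl mul1mx WW scaler_nat mulr2n [W + _]addrC. Qed.

Lemma mixed_isometry : adj mixed *m mixed = 1%:M.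
Proof.
rewrite /mixed adjZ s2r !adjM adjD adj1 Wh -scalemxAl -scalemxAr scalerA s2.
have -> : adj J *m (1%:M + W) *m ((1%:M + W) *m J) = 2 *: 1%:M.
  rewrite -mulmxA (mulmxA (1%:M + W)) sqW -scalemxAl -scalemxAr mulmxDl mul1mx.
  by rewrite mulmxDr JJ mulmxA JWJ addr0.
by rewrite scalerA mulVf // scale1r.
Qed.

Lemma mixed_proj : mixed *m adj mixed = 2^-1 *: (1%:M + W).
Proof.
rewrite /mixed adjZ s2r !adjM adjD adj1 Wh -scalemxAl -scalemxAr scalerA s2; congr (_ *: _).
rewrite -mulmxA (mulmxA J) JQ -scalemxAl -scalemxAr.
have -> : (1%:M + W) *m ((1%:M + Q) *m (1%:M + W)) = 2 *: (1%:M + W).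
  rewrite !(mulmxDl, mulmxDr) !mul1mx !mulmx1 WW mulmxA WQ.
  rewrite scaler_nat mulr2n; apply/matrixP=> i j.
  have := congr1 (fun A : 'M_N => A i j) WQc; rewrite !mxE => ->.
  by ring.
by rewrite scalerA mulVf // scale1r.
Qed.

Lemma mixed_form : W^T *m F *m W = F -> mixed^T *m F *m mixed = F0.
Proof.
move=> WF; have WF' : W^T *m F = F *m W by rewrite -{2}WF -!mulmxA WW mulmx1.
have -> : mixed^T = (sqrtC 2)^-1 *: (J^T *m (1%:M + W^T)).
  by rewrite /mixed linearZ /= trmx_mul linearD /= trmx1.
rewrite /mixed -!scalemxAl -scalemxAr scalerA s2.
have -> : J^T *m (1%:M + W^T) *m F *m ((1%:M + W) *m J) = 2 *: F0.
  rewrite -(mulmxA J^T _ F) mulmxDl mul1mx WF' -{1}(mulmx1 F) -mulmxDr.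
  rewrite -!mulmxA (mulmxA (1%:M + W)) sqW -scalemxAl -!scalemxAr mulmxDl mul1mx.
  by rewrite !mulmxDr !mulmxA JF JFWJ addr0.
by rewrite scalerA mulVf // scale1r.
Qed.

(** Since F0 is real, F (conj v) is F0 applied to conjugate coordinates on the
    eigenspace of Q. *)
Lemma half_conj : Q *m F *m map_mx Num.conj J = J *m F0.
Proof.
have QJb : Q *m map_mx Num.conj J = map_mx Num.conj J.
  have Qb : map_mx Num.conj Q = Q by rewrite conjmx_adj Qh Qt.
  by rewrite -{1}Qb -map_mxM QJ.
have Fb : map_mx Num.conj F = F by rewrite conjmx_adj Freal trmxK.
have JJ' : J *m adj J *m F *m map_mx Num.conj J = F *m map_mx Num.conj J.
  rewrite JQ -!scalemxAl mulmxDl mul1mx QFc mulmxDl -(mulmxA F Q) QJb.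
  by rewrite -mulr2n -scaler_nat scalerA mulVf // scale1r.
rewrite QFc -mulmxA QJb -JJ' -!mulmxA; congr (J *m _).
by rewrite -F0r -JF !map_mxM Fb mulmxA.
Qed.

Lemma mixed_conj : W^T *m F *m W = - F ->
  Q *m F *m map_mx Num.conj mixed = mixed *m F0.
Proof.
move=> WF; have Wb : map_mx Num.conj W = W^T by rewrite conjmx_adj Wh.
have WF' : W^T *m F = - (F *m W) by rewrite -mulNmx -WF -!mulmxA WW mulmx1.
have F1 : F = e *: F^T by rewrite Fe scalerA ee scale1r.
have FW : F *m W^T = - (W *m F).
  have FFe : F *m F = e%:M by rewrite {1}F1 -scalemxAl FF scalemx1.
  rewrite -[LHS]mulmx1 -(FFt FF) mulmxA -(mulmxA F) WF' mulmxN mulNmx mulmxA FFe.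
  by rewrite mul_scalar_mx -scalemxAl scalemxAr -F1.
rewrite /mixed map_mxZ [X in X *: _](s2r) -scalemxAr -scalemxAl; congr (_ *: _).
have QFW : Q *m F *m (1%:M + W^T) = (1%:M + W) *m (Q *m F).
  rewrite mulmxDr mulmx1 mulmxDl mul1mx -mulmxA FW mulmxN !mulmxA WQc mulNmx.
  by [].
by rewrite map_mxM map_mxD map_mx1 Wb mulmxA QFW -!mulmxA (mulmxA Q) half_conj.
Qed.

Lemma mixed_form_iso : W^T *m F *m W = F ->
  real_lie_iso (real_fixed (hform F Q) (cj W)) [set Y | Y \in form_alg F0]%classic.
Proof.
move=> WF; apply: (fixed_form_iso Fe FF ee Freal Qh QQ QF Wh WW WQ mixed_isometry mixed_proj WF).
exact: mixed_form.
Qed.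

Lemma mixed_gl_iso : W^T *m F *m W = - F ->
  real_lie_iso (real_fixed (hform F Q) (cj W))
    [set Y | Y *m F0 = F0 *m map_mx Num.conj Y]%classic.
Proof.
move=> WF; have iG := mixed_conj WF.
exact: (fixed_gl_iso Fe FF ee Freal Qh QQ Wh WW WQ mixed_isometry mixed_proj WF iG).
Qed.

End HalfSpace.

Section SplitForm.
Variables (C : numClosedFieldType) (k : nat).
Local Notation N := (k + k)%N.
Variables (F Q W : 'M[C]_N) (J : 'M[C]_(N, k)).
Hypotheses (Qh : adj Q = Q) (QQ : Q *m Q = 1%:M) (QF : Q^T *m F *m Q = F) (Qt : Q^T = Q).
Hypotheses (Wh : adj W = W) (WW : W *m W = 1%:M) (WQ : W *m Q *m W = - Q) (WF : W^T *m F *m W = - F).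
Hypotheses (JJ : adj J *m J = 1%:M) (JQ : J *m adj J = 2^-1 *: (1%:M + Q)) (JF : J^T *m F *m J = 1%:M).

(** The columns of J and W J form a unitary basis in which Q and F have the same matrix
    Ipq, since W exchanges the eigenspaces of Q and changes the sign of F. *)
Lemma hform_so_iso : real_lie_iso (hform F Q) (so_pq C k k).
Proof.
have QJ : Q *m J = J by exact: Wi JJ JQ.
have JaQ : adj J *m Q = adj J by exact: iWadj Qh JJ JQ.
have WQc := WQc WW WQ.
have two : (2 : C) != 0 by rewrite pnatr_eq0.
have half (A : 'M[C]_k) : A = - A -> A = 0.
  by move/eqP; rewrite -subr_eq0 opprK -mulr2n -scaler_nat scaler_eq0 (negPf two) => /eqP.
have JWJ : adj J *m W *m J = 0.
  apply: half; have {1}-> : adj J *m W *m J = adj J *m (W *m Q) *m J by rewrite -!mulmxA QJ.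
  by rewrite WQc mulmxN mulNmx !mulmxA JaQ.
have QFc : Q *m F = F *m Q by rewrite -{1}Qt -{2}QF -!mulmxA QQ mulmx1.
have JtQ : J^T *m Q = J^T by rewrite -Qt -trmx_mul QJ.
have JFWJ : J^T *m F *m W *m J = 0.
  apply: half; have {1}-> : J^T *m F *m W *m J = J^T *m F *m (W *m Q) *m J by rewrite -!mulmxA QJ.
  by rewrite WQc mulmxN mulNmx !mulmxA -(mulmxA J^T F Q) -QFc mulmxA JtQ.
have WF' : W^T *m F = - (F *m W) by rewrite -mulNmx -WF -!mulmxA WW mulmx1.
have adjU : adj (row_mx J (W *m J)) = col_mx (adj J) (adj J *m W).
  by rewrite /adj tr_row_mx map_col_mx -/(adj _) -/(adj _) adjM Wh.
have QWJ : Q *m (W *m J) = - (W *m J).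
  by rewrite mulmxA -[Q *m W]opprK -WQc mulNmx -mulmxA QJ.
apply: (@hform_split_iso C N F Q (row_mx J (W *m J)) (Ipq C k k)).
- rewrite adjU mul_col_row !mulmxA JJ JWJ -(mulmxA _ W W) WW mulmx1 JJ.
  by rewrite -scalar_mx_block.
- rewrite /Ipq mulmx_block !(mulmx1, mulmx0, mul0mx, mulmxN, mulNmx, addr0, add0r, opprK, oppr0).
  by rewrite -scalar_mx_block.
- rewrite -mulmxA mul_mx_row QJ QWJ adjU mul_col_row /Ipq !mulmxN !mulmxA JJ JWJ.
  by rewrite oppr0 -(mulmxA _ W W) WW mulmx1 JJ.
- rewrite tr_row_mx -mulmxA mul_mx_row mul_col_row !mulmxA JF JFWJ trmx_mul /Ipq.
  rewrite -(mulmxA J^T W^T F) WF' !mulmxN !mulNmx !mulmxA JFWJ oppr0.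
  by rewrite -(mulmxA _ W W) WW mulmx1 JF.
Qed.

End SplitForm.

(** * Root vectors *)

(** The matrices of L are described by their coefficients hat X a b in the basis given
    by the columns of V.  In this basis F is monomial: it pairs the position a with bar a, with
    a coefficient determined by s.  For h diagonal in this basis, eps a h is its a-th
    eigenvalue, and the root vector rootv a b has weight eps a - eps b. *)
Section RootVectors.
Variables (C : numClosedFieldType) (N : nat).
Local Notation M := 'M[C]_N.
Variables (V : M) (L : {vspace M}) (bar : 'I_N -> 'I_N) (s : 'I_N -> C).

Definition hat (X : M) : M := locked (V *m X *m V).
Definition eps a (h : M) : C := hat h a a.
Definition rootv a b : M :=
  hat (delta_mx a b - (s a * s b) *: delta_mx (bar b) (bar a)).
(** The normalisation of rootv a b: it is 2 on the long roots of sp, where b = bar a,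
    and 0 for the same pairs in so, where the root vector vanishes. *)
Definition gam a b : C := 1 - s a * s b *+ (b == bar a).

Definition frame := [/\ V *m V = 1%:M, involutive bar, forall a, s a * s a = 1,
  forall a b, s (bar a) * s (bar b) = s a * s b &
  forall X, X \in L <-> forall a b, hat X (bar b) (bar a) = - (s a * s b * hat X a b)].

Hypothesis fr : frame.

Lemma hatE X : hat X = V *m X *m V. Proof. by rewrite /hat -lock. Qed.

Let VV : V *m V = 1%:M. Proof. by case: fr. Qed.
Let barK : involutive bar. Proof. by case: fr. Qed.
Let ss a : s a * s a = 1. Proof. by case: fr. Qed.
Let sbar a b : s (bar a) * s (bar b) = s a * s b. Proof. by case: fr. Qed.
Let LP X : X \in L <-> forall a b, hat X (bar b) (bar a) = - (s a * s b * hat X a b).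
Proof. by case: fr. Qed.

Lemma hatK X : hat (hat X) = X.
Proof. by rewrite 2!hatE !mulmxA VV mul1mx -mulmxA VV mulmx1. Qed.

Lemma hatD X Y : hat (X + Y) = hat X + hat Y.
Proof. by rewrite !hatE mulmxDr mulmxDl. Qed.
Lemma hatN X : hat (- X) = - hat X.
Proof. by rewrite !hatE mulmxN mulNmx. Qed.
Lemma hatB X Y : hat (X - Y) = hat X - hat Y.
Proof. by rewrite hatD hatN. Qed.
Lemma hatZ a X : hat (a *: X) = a *: hat X.
Proof. by rewrite !hatE -scalemxAr -scalemxAl. Qed.
Lemma hatM X Y : hat (X *m Y) = hat X *m hat Y.
Proof. by rewrite !hatE -!mulmxA (mulmxA V V) VV mul1mx. Qed.
Lemma hat_lie X Y : hat (lie X Y) = lie (hat X) (hat Y).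
Proof. by rewrite /lie hatB !hatM. Qed.
Lemma hat_inj X Y : (forall a b, hat X a b = hat Y a b) -> X = Y.
Proof. by move=> h; rewrite -[X]hatK -[Y]hatK; congr (hat _); apply/matrixP. Qed.
Lemma hat0 : hat 0 = 0.
Proof. by rewrite !hatE mulmx0 mul0mx. Qed.

Lemma hat_sum (I : finType) (E : I -> M) : hat (\sum_i E i) = \sum_i hat (E i).
Proof. by rewrite hatE mulmx_sumr mulmx_suml; apply: eq_bigr => i _; rewrite hatE. Qed.

Lemma eqbarC a b : (b == bar a) = (a == bar b).
Proof. by rewrite -(inj_eq (inv_inj barK)) barK eq_sym. Qed.

Lemma rootvE a b c d : hat (rootv a b) c d =
  ((c == a) && (d == b))%:R - s a * s b * ((c == bar b) && (d == bar a))%:R.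
Proof. by rewrite hatK !mxE. Qed.

Lemma rootv_gam a b : hat (rootv a b) a b = gam a b.
Proof.
rewrite rootvE !eqxx /gam eqbarC /=; congr (1 - _).
by rewrite [b == _]eqbarC andbb; case: (a == _); rewrite ?mulr1 ?mulr0.
Qed.

Lemma rootv_mem a b : rootv a b \in L.
Proof.
apply/LP=> c d; rewrite !rootvE !(inj_eq (inv_inj barK)).
have e c' d' : (bar c' == d') = (c' == bar d') by rewrite eq_sym eqbarC eq_sym.
rewrite !e [(d == bar a) && _]andbC [(d == b) && _]andbC.
have hx : s c * s d * ((c == a) && (d == b))%:R = s a * s b * ((c == a) && (d == b))%:R.
  by case: (boolP (_ && _)) => [/andP[/eqP -> /eqP ->]|_]; rewrite ?mulr0.
have hy : s c * s d * (s a * s b) * ((c == bar b) && (d == bar a))%:R =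
    ((c == bar b) && (d == bar a))%:R.
  case: (boolP (_ && _)) => [/andP[/eqP -> /eqP ->]|_]; rewrite ?mulr0 // mulr1.
  by rewrite sbar [s b * _]mulrC mulrACA !ss mulr1.
by rewrite mulrBr opprB mulrA hx hy.
Qed.

Lemma hat_lieE X Y a b :
  hat (lie X Y) a b = \sum_c (hat X a c * hat Y c b - hat Y a c * hat X c b).
Proof. by rewrite hat_lie !mxE -sumrB. Qed.

Lemma lie_entry_neq0 X Y a b : hat (lie X Y) a b != 0 ->
  exists c, (hat X a c != 0 /\ hat Y c b != 0) \/ (hat Y a c != 0 /\ hat X c b != 0).
Proof.
rewrite hat_lieE => h; pose f c := hat X a c * hat Y c b - hat Y a c * hat X c b.
have [c /= fc] : exists c, f c != 0.
  case: (pickP (fun c => f c != 0)) => [c fc|f0]; first by exists c.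
  by rewrite big1 ?eqxx // in h => c _; apply/eqP; have := f0 c; rewrite /f => /negbFE.
exists c; move: fc; rewrite /f.
have [->|x1] := eqVneq (hat X a c) 0.
  rewrite mul0r sub0r oppr_eq0 mulf_eq0 => /norP[x2 x3]; by right.
have [->|x2] := eqVneq (hat Y c b) 0; last by left.
by rewrite mulr0 sub0r oppr_eq0 mulf_eq0 => /norP[x3 x4]; right.
Qed.

Lemma hat_lie_diag h X a b : (forall c d, c != d -> hat h c d = 0) ->
  hat (lie h X) a b = (eps a h - eps b h) * hat X a b.
Proof.
move=> dh; rewrite hat_lie !mxE (bigD1 a) //= big1 => [|c ca]; last first.
  by rewrite dh ?mul0r // eq_sym.
rewrite (bigD1 b) //= big1 => [|c cb]; last by rewrite dh ?mulr0 // eq_sym.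
by rewrite !addr0 mulrBl [eps b h * _]mulrC.
Qed.

Lemma lie_rootv a b :
  lie (rootv a b) (rootv b a) = gam a b *: (rootv a a - rootv b b).
Proof.
rewrite -[LHS]hatK -[RHS]hatK; congr (hat _).
rewrite hat_lie hatZ hatB !hatK /lie /gam [s b * s a]mulrC.
rewrite !(mulmxBl, mulmxBr) -!scalemxAl -!scalemxAr !mul_delta_mx_cond.
rewrite !eqxx [bar b == a]eq_sym [bar a == b]eq_sym [a == bar b]eqbarC.
rewrite !mulr1n !ss !scale1r !scalerA mulrACA !ss mulr1 !scale1r.
case: eqP => [->|_]; rewrite ?barK ?mulr0n ?mulr1n ?scaler0 ?subr0 ?sub0r ?scale1r ?opprK; last first.
  by rewrite !opprB addrACA [RHS]addrAC; apply/matrixP=> i j; rewrite !mxE; ring.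
by apply/matrixP=> i j; rewrite !mxE; ring.
Qed.

Lemma eps_bar h a : h \in L -> eps (bar a) h = - eps a h.
Proof. by move=> /LP Lh; rewrite /eps Lh ss mul1r. Qed.

(** The factor is one half because (a, b) and (bar b, bar a) give the same root vector
    up to sign. *)
Lemma rootv_span X : X \in L ->
  X = 2^-1 *: \sum_a \sum_b hat X a b *: rootv a b.
Proof.
move=> /LP h; apply: hat_inj => c d; rewrite hatZ hat_sum mxE summxE.
under eq_bigr do rewrite hat_sum summxE.
under eq_bigr do under eq_bigr do rewrite hatZ mxE.
under eq_bigr do under eq_bigr do rewrite rootvE mulrBr.
under eq_bigr do rewrite sumrB; rewrite sumrB.
rewrite (bigD1 c) //= (bigD1 d) //= !eqxx mulr1 big1 ?addr0; last first.
  by move=> b /negPf bd; rewrite eq_sym bd mulr0.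
rewrite big1 ?addr0; last first.
  by move=> a /negPf ac; rewrite big1 // => b _; rewrite [c == a]eq_sym ac mulr0.
rewrite (bigD1 (bar d)) //= (bigD1 (bar c)) //= !barK !eqxx !mulr1 big1 ?addr0; last first.
  by move=> b /negPf bd; rewrite eqbarC bd !mulr0.
rewrite big1 ?addr0; last first.
  move=> a /negPf ac; rewrite big1 // => b _.
  by rewrite [d == _]eqbarC ac andbF !mulr0.
rewrite h sbar.
have hs : s c * s d * (s d * s c) = 1 by rewrite [s d * _]mulrC mulrACA !ss mulr1.
have -> : - (s c * s d * hat X c d) * (s d * s c) = - hat X c d.
  by rewrite mulNr mulrAC hs mul1r.
rewrite opprK.
by field.
Qed.

End RootVectors.

(** ** Subalgebras cut out by an equivalence of positions *)

(** K consists of the X in L whose coefficients vanish outside an equivalence relation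
    rel; it is L itself when rel is total, and L^theta when rel compares the
    eigenvalues of theta.  T is the diagonal part.  The condition separated says
    that T is its own centraliser in K, and rich that every coordinate of T is
    reached by brackets of opposite root vectors. *)
Section Subalgebra.
Variables (C : numClosedFieldType) (N : nat).
Local Notation M := 'M[C]_N.
Variables (V : M) (L : {vspace M}) (bar : 'I_N -> 'I_N) (s : 'I_N -> C).
Variables (rel : 'I_N -> 'I_N -> bool) (K T : {vspace M}).
Local Notation hat := (hat V).
Local Notation eps := (eps V).
Local Notation rootv := (rootv V bar s).
Local Notation gam := (gam bar s).
Hypothesis fr : frame V L bar s.

Definition in_class := forall X, X \in K <-> X \in L /\ forall a b, ~~ rel a b -> hat X a b = 0.
Definition class_ok := [/\ (forall a, rel a a), (forall a b, rel a b = rel b a),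
  (forall a b c, rel a b -> rel b c -> rel a c) & forall a b, rel a (bar b) = rel a b].
Definition diagonal_part := forall h, h \in T <-> h \in L /\ forall a b, a != b -> hat h a b = 0.
Definition separated := forall a b, a != b -> rel a b ->
  exists2 h, h \in T & eps a h != eps b h.
Definition rich := forall a, bar a != a -> exists b,
  [/\ rel a b, gam a b != 0 & gam a (bar b) != 0].

Hypotheses (KP : in_class) (relP : class_ok) (TP : diagonal_part).
Hypothesis lieL : lie_closed L.

Let rr a : rel a a. Proof. by case: relP. Qed.
Let rC a b : rel a b = rel b a. Proof. by case: relP. Qed.
Let rT a b c : rel a b -> rel b c -> rel a c. Proof. by case: relP => _ _ h _; exact: h. Qed.
Let rbar a b : rel a (bar b) = rel a b. Proof. by case: relP. Qed.
Let barK : involutive bar. Proof. by case: fr. Qed.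

Lemma diag_class : (T <= K)%VS.
Proof.
apply/subvP=> h /TP[Lh hd]; apply/KP; split=> // a b rab.
by apply: hd; apply: contraNN rab => /eqP ->; rewrite rr.
Qed.

Lemma lie_class : lie_closed K.
Proof.
move=> X Y /KP[LX hX] /KP[LY hY]; apply/KP; split; first exact: lieL.
move=> a b rab; rewrite (hat_lieE fr) big1 // => c _.
have [rac|rac] := boolP (rel a c); last by rewrite (hX a c) // (hY a c) // !mul0r subrr.
have rcb : ~~ rel c b by apply: contraNN rab; exact: rT.
by rewrite (hX c b) // (hY c b) // !mulr0 subrr.
Qed.

Lemma rootv_class a b : rel a b -> rootv a b \in K.
Proof.
move=> rab; apply/KP; split=> [|c d rcd]; first exact: rootv_mem fr _ _.
rewrite (rootvE fr); case: (boolP (_ && _)) => [/andP[/eqP ca /eqP db]|_].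
  by rewrite ca db rab in rcd.
case: (boolP (_ && _)) => [/andP[/eqP cb /eqP da]|_]; last by rewrite mulr0 subr0.
by rewrite cb da rbar rC rbar rab in rcd.
Qed.

Lemma lie_diag h X a b : h \in T ->
  hat (lie h X) a b = (eps a h - eps b h) * hat X a b.
Proof. by move=> /TP[_ hd]; exact: hat_lie_diag fr _ _ _ _ hd. Qed.

Lemma weight_entry (U : {vspace M}) y X a b : weight_space U T y X -> hat X a b != 0 ->
  {in T, forall h, y h = eps a h - eps b h}.
Proof.
move=> [_ wX] Xab h Th; apply: (mulIf Xab).
by rewrite -lie_diag // wX // hatZ mxE.
Qed.

Lemma weight_spaceP (U : {vspace M}) y X : X \in U ->
  (forall a b, hat X a b != 0 -> {in T, forall h, y h = eps a h - eps b h}) ->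
  weight_space U T y X.
Proof.
move=> UX h; split=> // t Tt; apply: (hat_inj fr) => a b.
rewrite lie_diag // hatZ mxE; have [->|n0] := eqVneq (hat X a b) 0.
  by rewrite !mulr0.
by rewrite (h a b).
Qed.

Lemma rootv_weight (U : {vspace M}) y a b : rootv a b \in U ->
  {in T, forall h, y h = eps a h - eps b h} -> weight_space U T y (rootv a b).
Proof.
move=> Rab yE; apply: weight_spaceP => // c d; rewrite (rootvE fr).
case: (boolP (_ && _)) => [/andP[/eqP -> /eqP ->] _|_]; first exact: yE.
case: (boolP (_ && _)) => [/andP[/eqP -> /eqP ->] _|_]; last by rewrite mulr0 subr0 eqxx.
move=> h Th.
by have [Lh _] := (TP h).1 Th; rewrite yE // !(eps_bar fr) // opprK addrC.
Qed.

Lemma diag_abelian X Y : X \in T -> Y \in T -> lie X Y = 0.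
Proof.
move=> TX /TP[_ Yd]; apply: (hat_inj fr) => a b; rewrite lie_diag // hat0 mxE.
by case: (eqVneq a b) => [->|ab]; rewrite ?subrr ?mul0r // Yd // mulr0.
Qed.

Lemma diag_nilpotent : nilpotent_alg T.
Proof.
exists 1%N; apply/eqP; rewrite -subv0 /=; apply/span_subvP => _ /allpairsP[[X Y] /= [TX TY ->]].
by rewrite diag_abelian ?mem0v // vbasis_mem.
Qed.

(** An element normalising T has its off-diagonal coefficients killed by any h that
    separates their two indices. *)
Lemma diag_cartan : separated -> cartan_subalgebra K T.
Proof.
move=> sep; split; [exact: diag_class | | exact: diag_nilpotent |].
  by move=> X Y TX TY; rewrite diag_abelian // mem0v.
move=> X KX nX; apply/TP; have [LX Xc] := (KP X).1 KX; split=> // a b ab.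
have [rab|/Xc//] := boolP (rel a b).
have [h Th nh] := sep _ _ ab rab; have := nX _ Th.
rewrite lieC memvN => /TP[_ /(_ _ _ ab)]; rewrite lie_diag // => /eqP.
by rewrite mulf_eq0 subr_eq0 (negPf nh) => /eqP.
Qed.

Lemma mem_lie_prod (U W : {vspace M}) X Y : X \in U -> Y \in W -> lie X Y \in lie_prod U W.
Proof.
move=> UX WY; rewrite (coord_vbasis UX) (coord_vbasis WY).
have -> (A : M) (n : nat) (E : 'I_n -> M) : lie (\sum_i E i) A = \sum_i lie (E i) A.
  by rewrite /lie mulmx_suml mulmx_sumr -sumrB.
apply: memv_suml => i _; rewrite lieZl memvZ //.
have -> (A : M) (n : nat) (E : 'I_n -> M) : lie A (\sum_i E i) = \sum_i lie A (E i).
  by rewrite /lie mulmx_suml mulmx_sumr -sumrB.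
apply: memv_suml => j _; rewrite lieZr memvZ //.
by apply/memv_span/allpairsP; exists ((vbasis U)`_i, (vbasis W)`_j); split; rewrite ?mem_nth ?size_tuple.
Qed.

(** Off the diagonal a root vector is an eigenvector of some element of T.  On the
    diagonal put D a = rootv a a, so that D (bar b) = - D b.  With b as in rich, brackets of
    root vectors give D a - D b and D a + D b, whence D a. *)
Lemma derived_class : separated -> rich -> derived K = K.
Proof.
move=> sep ri; apply/eqP; rewrite eqEsubv; apply/andP; split.
  apply/span_subvP => _ /allpairsP[[X Y] /= [KX KY ->]].
  by apply: lie_class; rewrite vbasis_mem.
have RD a b : rel a b -> rootv a b \in derived K.
  move=> rab; have [<-|ab] := eqVneq a b; last first.
    have [h Th nh] := sep _ _ ab rab.
    have : lie h (rootv a b) \in derived K.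
      by apply: mem_lie_prod; [exact: (subvP diag_class)|exact: rootv_class].
    have [_ wR] := rootv_weight (rootv_class rab) (fun _ _ => erefl).
    by rewrite wR // rpredZeq subr_eq0 (negPf nh).
  have [ba|ba] := eqVneq (bar a) a.
    have -> : rootv a a = 0.
      apply: (hat_inj fr) => c d; rewrite (rootvE fr) hat0 !mxE ba.
      by have [_ _ ss _ _] := fr; rewrite ss mul1r subrr.
    by rewrite mem0v.
  have [c [rac g1 g2]] := ri _ ba.
  have D1 d : rel a d -> gam a d != 0 -> rootv a a - rootv d d \in derived K.
    move=> rad g; have : lie (rootv a d) (rootv d a) \in derived K.
      by apply: mem_lie_prod; apply: rootv_class; rewrite // rC.
    by rewrite (lie_rootv fr) rpredZeq (negPf g).
  have Rc : rootv (bar c) (bar c) = - rootv c c.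
    apply: (hat_inj fr) => i j; rewrite hatN mxE !(rootvE fr) barK.
    by have [_ _ ss _ _] := fr; rewrite !ss !mul1r opprB.
  have := memvD (D1 _ rac g1) (D1 (bar c) _ g2); rewrite rbar => /(_ rac).
  rewrite Rc opprK addrACA addNr addr0 -mulr2n -scaler_nat rpredZeq.
  by rewrite pnatr_eq0.
apply/subvP=> X KX; have [LX Xc] := (KP X).1 KX.
rewrite (rootv_span fr LX) memvZ //; apply: memv_suml => a _; apply: memv_suml => b _.
have [rab|/Xc ->] := boolP (rel a b); last by rewrite scale0r mem0v.
by rewrite memvZ // RD.
Qed.

(** A central element is diagonal as T is its own centraliser, and the two root vectors
    of the condition rich force eps a = eps b and eps a = - eps b. *)
Lemma center_class : separated -> rich -> center K = 0%VS.
Proof.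
move=> sep ri; apply/eqP; rewrite -subv0; apply/subvP=> X; rewrite memv_cap memv0.
move=> /andP[KX]; rewrite big_tnth => Xc.
have comm Y : Y \in K -> lie Y X = 0.
  move=> KY; rewrite (coord_vbasis KY) /lie mulmx_suml mulmx_sumr -sumrB big1 // => i _.
  rewrite -/(lie _ _) lieZl -adE.
  suff : X \in lker (ad (vbasis K)`_i) by rewrite memv_ker => /eqP ->; rewrite scaler0.
  have lt_i : (i < size (vbasis K))%N by rewrite size_tuple.
  have := bigcapv_inf (Ordinal lt_i) (P := xpredT) (Us := fun i => lker (ad (tnth (in_tuple (vbasis K)) i))).
  move=> /(_ _ isT (subvv _))/subvP/(_ _ Xc).
  by rewrite (tnth_nth 0).
have [LX XK] := (KP X).1 KX.
have TX : X \in T.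
  apply/TP; split=> // a b ab; have [rab|/XK//] := boolP (rel a b).
  have [h Th nh] := sep _ _ ab rab.
  have := lie_diag X a b Th; rewrite comm ?(subvP diag_class) // hat0 mxE.
  by move/esym/eqP; rewrite mulf_eq0 subr_eq0 (negPf nh) => /eqP.
have [_ Xd] := (TP X).1 TX.
apply/eqP/(hat_inj fr) => a b; rewrite hat0 mxE.
have [<-|/Xd //] := eqVneq a b; rewrite -/(eps a X).
have [ba|ba] := eqVneq (bar a) a.
  have := eps_bar fr a LX; rewrite ba => /eqP.
  by rewrite -addr_eq0 -mulr2n mulrn_eq0 /= => /eqP.
have [c [rac g1 g2]] := ri _ ba.
have E d : rel a d -> gam a d != 0 -> eps a X = eps d X.
  move=> rad g; have := lie_diag (rootv a d) a d TX.
  rewrite lieC comm ?rootv_class // oppr0 hat0 mxE (rootv_gam fr) => /esym/eqP.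
  by rewrite mulf_eq0 (negPf g) orbF subr_eq0 => /eqP.
have e1 := E _ rac g1; have e2 := E (bar c); rewrite rbar (eps_bar fr) // in e2.
have := e2 rac g2; rewrite -e1 => /eqP.
by rewrite -addr_eq0 -mulr2n mulrn_eq0 /= => /eqP.
Qed.

End Subalgebra.

(** * Integral weights along an affine chain *)

(** The shape of both ends of an affine diagram which is symmetric about its middle:
    long end vertices (C_n^(1)), forks (D_n^(1)) or short end vertices (D_(n+1)^(2)). *)
Inductive endtype := EC | ED | EB.

Section Codes.
Variables (ty : endtype) (n : nat).

(** The weights of L are encoded by integers: k > 0 stands for the k-th coordinate
    function of a Cartan subalgebra, - k for its opposite, 0 for the zero weight.  The
    vertex i of the affine diagram is the difference of the codes i and i + 1, where
    the codes at both ends turn back, e.g. x_0 = - 2 t_1 for long ends, - t_1 - t_2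
    for forks, - t_1 for short ends. *)
Definition code (i : nat) : int :=
  if i == 0%N then (match ty with EC => -1 | ED => -2 | EB => 0 end)
  else if i == n.+1 then (match ty with EC => - n%:Z | ED => - n.-1%:Z | EB => 0 end)
  else i%:Z.

(** The value of the weight of code z at the point of coordinates t. *)
Definition ev (t : nat -> int) (z : int) : int := sgz z * t `|z|%N.

Lemma evN t z : ev t (- z) = - ev t z.
Proof. by rewrite /ev sgzN abszN mulNr. Qed.

Lemma ev_nat t (k : nat) : (0 < k)%N -> ev t k = t k.
Proof. by case: k => // k _; rewrite /ev gtr0_sgz ?mul1r. Qed.

Lemma ev0 t : ev t 0 = 0. Proof. by rewrite /ev sgz0 mul0r. Qed.

Lemma evD t u z : ev (fun k => t k + u k) z = ev t z + ev u z.
Proof. by rewrite /ev mulrDr. Qed.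

(** The z-coordinate of the diagonal matrix with entries 1 at w and -1 at - w. *)
Definition pairing (z w : int) : int := (z == w)%:Z - (z == - w)%:Z.

Lemma pairingN z w : pairing z (- w) = - pairing z w.
Proof. by rewrite /pairing opprK opprB. Qed.

Lemma ev_delta (k : nat) z : (0 < k)%N -> ev (fun j => (j == k)%:Z) z = pairing z k.
Proof.
move=> k0; rewrite /ev /pairing; case: z => [[|z]|z].
- by rewrite sgz0 mul0r; case: k k0.
- by rewrite gtr0_sgz // mul1r /=; lia.
- by rewrite ltr0_sgz // NegzE abszN mulN1r /=; lia.
Qed.

(** The weight of the vertex i. *)
Definition xz (i : nat) t := ev t (code i) - ev t (code i.+1).

Lemma code_mid i : (0 < i <= n)%N -> code i = i%:Z.
Proof. by case: i => // i /= ni; rewrite /code /= ltn_eqF. Qed.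

Lemma xz_mid i t : (0 < i < n)%N -> xz i t = t i - t i.+1.
Proof. by move=> ni; rewrite /xz !code_mid ?ev_nat; lia. Qed.

Lemma xz0 t : (0 < n)%N -> xz 0 t =
  match ty with EC => - (2 * t 1%N) | ED => - t 2%N - t 1%N | EB => - t 1%N end.
Proof.
move=> n0; rewrite /xz (@code_mid 1%N) // (ev_nat _ (k := 1)) // /code eqxx.
case: ty; rewrite ?ev0 ?sub0r // evN.
  by rewrite -[1]/(Posz 1) ev_nat //; ring.
by rewrite -[2]/(Posz 2) ev_nat.
Qed.

Lemma xzn t : (1 < n)%N -> xz n t =
  match ty with EC => 2 * t n | ED => t n + t n.-1 | EB => t n end.
Proof.
move=> n0; rewrite /xz (@code_mid n) ?leqnn ?andbT; last lia.
rewrite (ev_nat _ (k := n)); last lia.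
rewrite /code /= eqxx; case: ty; rewrite ?ev0 ?evN ?ev_nat //; lia.
Qed.

(** The simple coroots, the one of the lowest root included. *)
Definition cort (i : nat) (k : nat) : int :=
  if i == 0%N then match ty with EC => - (k == 1%N)%:Z | ED => - (k == 1%N)%:Z - (k == 2%N)%:Z
                   | EB => - (2 * (k == 1%N)%:Z) end
  else if i == n then match ty with EC => (k == n)%:Z | ED => (k == n)%:Z + (k == n.-1)%:Z
                   | EB => 2 * (k == n)%:Z end
  else (k == i)%:Z - (k == i.+1)%:Z.

(** The coroot of x_i and the bracket of its root vectors are proportional; the ratio
    is written as a fraction, whose terms depend on the length of x_i. *)
Definition kap (i : nat) : int * int :=
  if (i == 0%N) || (i == n) then match ty with EC => (2, 1) | ED => (1, 1) | EB => (1, 2) end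
  else (1, 1).

Lemma cortP i z : (1 < n)%N -> (i <= n)%N ->
  (kap i).1 * ev (cort i) z = (kap i).2 * (pairing z (code i) - pairing z (code i.+1)).
Proof.
move=> n1 ni; have ev_ext t u : (forall k, t k = u k) -> ev t z = ev u z.
  by move=> h; rewrite /ev h.
have evZ a t : ev (fun k => a * t k) z = a * ev t z by rewrite /ev; ring.
have evN' t : ev (fun k => - t k) z = - ev t z by rewrite /ev; ring.
have p1 : pairing z 1 = pairing z 1%N by [].
have p2 : pairing z 2 = pairing z 2%N by [].
have p0 : pairing z 0 = 0 by rewrite /pairing oppr0 subrr.
rewrite /kap; have [->|i0] /= := eqVneq i 0%N.
  rewrite (@code_mid 1%N); last lia.
  rewrite /code /cort /=.
  case: ty => /=; rewrite ?(evD, evN', evZ) !ev_delta // ?pairingN ?p0 ?p1 ?p2; lia.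
have [->|ni'] := eqVneq i n.
  rewrite (@code_mid n) ?leqnn ?andbT; last lia.
  rewrite /code /= eqxx.
  have e : n == 0%N = false by lia.
  rewrite /cort e eqxx.
  case: ty => /=; rewrite ?(evD, evN', evZ) !ev_delta ?pairingN ?p0; lia.
rewrite !code_mid; try lia.
rewrite /cort (negPf i0) (negPf ni') (evD _ (fun k => - (k == i.+1)%:Z)) evN' !ev_delta //; lia.
Qed.

(** Up to a factor, the fundamental coweight dual to x_k among x_1, ..., x_n. *)
Definition cow (k j : nat) : int :=
  if (ty : endtype) is ED then
    if k == n.-1 then (if j == n then -1 else 1) else (j <= k)%N%:Z
  else (j <= k)%N%:Z.

Lemma cow_spec k : (2 < n)%N || (if ty is ED then false else (1 < n)%N) -> (0 < k <= n)%N ->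
  [/\ xz k (cow k) != 0, xz 0 (cow k) != 0 &
      forall j, (0 < j <= n)%N -> j != k -> xz j (cow k) = 0].
Proof.
move=> n1 kn; have n1' : (1 < n)%N by move: n1; case: ty => /=; lia.
have X j : (0 < j <= n)%N -> xz j (cow k) = if j == n then
   match ty with EC => 2 * cow k n | ED => cow k n + cow k n.-1 | EB => cow k n end
  else cow k j - cow k j.+1.
  move=> jn; case: eqVneq => [->|jn']; first by rewrite xzn.
  by rewrite xz_mid //; lia.
rewrite (X k) // xz0; last lia.
split; [apply/eqP | apply/eqP | move=> j jn jk; rewrite X //]; rewrite /cow;
move: n1; case: ty => /= n1; repeat (case: eqP => ?); lia.
Qed.

End Codes.

(** ** Chains of positions *)

(** The positions P_0, ..., P_(n+1) carry the weights of the affine diagram; x_i is the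
    difference of the weights of P_i and P_(i+1). *)
Section Chain.
Variables (C : numClosedFieldType) (N : nat).
Local Notation M := 'M[C]_N.
Variables (V : M) (L : {vspace M}) (bar : 'I_N -> 'I_N) (s : 'I_N -> C).
Variables (T : {vspace M}) (wt : 'I_N -> int) (ty : endtype) (n : nat) (P : nat -> 'I_N).
Local Notation hat := (hat V).
Local Notation eps := (eps V).
Local Notation rootv := (rootv V bar s).
Local Notation gam := (gam bar s).

Definition chain := [/\ forall a, wt (bar a) = - wt a,
  forall k, (k <= n.+1)%N -> wt (P k) = code ty n k,
  forall a b, wt a != 0 -> wt a = wt b -> a = b,
  forall a, wt a = 0 -> bar a = a &
  forall i, (i <= n)%N -> gam (P i) (P i.+1) != 0].

Definition xv i (h : M) : C := eps (P i) h - eps (P i.+1) h.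

Hypotheses (fr : frame V L bar s) (TP : diagonal_part V L T) (ch : chain).
Hypothesis n1 : (1 < n)%N.

Let barK : involutive bar. Proof. by case: fr. Qed.

Definition hT (t : nat -> int) : M :=
  hat (diag_mx (\row_a (ev t (wt a))%:~R)).

Lemma eps_hT t a : eps a (hT t) = (ev t (wt a))%:~R.
Proof. by rewrite /eps (hatK fr) !mxE eqxx. Qed.

Lemma hT_mem t : hT t \in T.
Proof.
have [wbar _ _ _ _] := ch; have [_ _ ss _ LP] := fr.
apply/TP; split; last by move=> a b ab; rewrite (hatK fr) !mxE (negPf ab).
apply/LP=> a b; rewrite (hatK fr) !mxE (inj_eq (inv_inj barK)) eq_sym.
case: eqP => [->|_]; last by rewrite !mulr0n mulr0 oppr0.
by rewrite !mulr1n wbar evN ss mul1r rmorphN.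
Qed.

Lemma diag_ext h h' : h \in T -> h' \in T -> (forall a, eps a h = eps a h') -> h = h'.
Proof.
move=> /TP[_ hd] /TP[_ hd'] e; apply: (hat_inj fr) => a b.
by have [<-|ab] := eqVneq a b; [exact: e | rewrite hd // hd'].
Qed.

Lemma xv_hT i t : (i <= n)%N -> xv i (hT t) = (xz ty n i t)%:~R.
Proof.
move=> ni; have [_ wP _ _ _] := ch.
by rewrite /xv !eps_hT !wP ?rmorphB // ltnW.
Qed.

(** The element with distinct positive coordinates 1, ..., n separates all weights. *)
Lemma chain_separated (rel : 'I_N -> 'I_N -> bool) :
  (forall a b, wt a = 0 -> wt b = 0 -> rel a b -> a = b) -> separated V rel T.
Proof.
move=> rel0 a b ab rab; exists (hT (fun k => k%:Z)); first exact: hT_mem.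
have evid z : ev (fun k => k%:Z) z = z by rewrite /ev; lia.
rewrite !eps_hT !evid eqr_int; apply: contraNneq ab => wab.
have [_ _ winj _ _] := ch; have [a0|a0] := eqVneq (wt a) 0; last exact/eqP/winj.
by apply/eqP/rel0; rewrite // -wab.
Qed.

Lemma eps_root a c : eps c (rootv a a) = (pairing (wt c) (wt a))%:~R.
Proof.
have [wbar _ winj w0 _] := ch; have [_ _ ss _ _] := fr.
rewrite /eps (rootvE fr) !andbb ss mul1r /pairing rmorphB /=.
have [a0|a0] := eqVneq (wt a) 0; first by rewrite a0 oppr0 w0 // !subrr.
have -> : (c == a) = (wt c == wt a).
  by apply/eqP/eqP => [->//|h]; apply/esym/winj.
have -> : (c == bar a) = (wt c == - wt a).
  by apply/eqP/eqP => [->//|h]; apply/esym/winj; rewrite ?wbar ?oppr_eq0.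
by rewrite !pmulrn.
Qed.

Definition kapC i : C := (kap ty n i).1%:~R^-1 * (kap ty n i).2%:~R.

Lemma coroot_hT i : (i <= n)%N ->
  hT (cort ty n i) = kapC i *: (rootv (P i) (P i) - rootv (P i.+1) (P i.+1)).
Proof.
move=> ni; have Troot a : rootv a a \in T.
  apply/TP; split; first exact: rootv_mem fr _ _.
  move=> c d cd; rewrite (rootvE fr); have [_ _ ss _ _] := fr.
  have e x : (c == x) && (d == x) = false.
    by apply: contraNF cd => /andP[/eqP -> /eqP ->].
  by rewrite !e mulr0 subr0.
apply: diag_ext; first exact: hT_mem.
  by rewrite memvZ // memvB.
move=> a; have [_ wP _ _ _] := ch; rewrite eps_hT.
have -> : eps a (kapC i *: (rootv (P i) (P i) - rootv (P i.+1) (P i.+1))) =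
    kapC i * (eps a (rootv (P i) (P i)) - eps a (rootv (P i.+1) (P i.+1))).
  by rewrite /eps hatZ hatB !mxE.
rewrite !eps_root !wP ?(leqW ni) //.
have k0 : (kap ty n i).1%:~R != 0 :> C by rewrite intr_eq0 /kap; case: ifP => _; case: (ty).
by apply: (mulfI k0); rewrite /kapC !mulrA mulfV // mul1r -intrM cortP // intrM intrB.
Qed.

(** The Cartan matrix in terms of codes; the entries of a generalized Cartan matrix are
    the values of the x_j at the coroots. *)
Definition chain_cartan (A : nat -> nat -> int) :=
  forall i j, (i <= n)%N -> (j <= n)%N -> A i j = xz ty n j (cort ty n i).

Lemma chain_coroot (U : {vspace M}) i : (i <= n)%N ->
  rootv (P i) (P i.+1) \in U -> rootv (P i.+1) (P i) \in U ->
  xz ty n i (cort ty n i) = 2 -> is_coroot U T (xv i) (hT (cort ty n i)).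
Proof.
move=> ni R1 R2 x2; have [_ _ _ _ g0] := ch; split.
- exact: hT_mem.
- by rewrite xv_hT // x2.
exists ((kapC i / gam (P i) (P i.+1)) *: rootv (P i) (P i.+1)), (rootv (P i.+1) (P i)).
have wZ y (X : M) a : weight_space U T y X -> weight_space U T y (a *: X).
  by move=> [UX wX]; split=> [|h Th]; [rewrite memvZ | rewrite lieZr wX // scalerA mulrC -scalerA].
split.
- exact/wZ/(rootv_weight fr TP).
- by apply: (rootv_weight fr TP) => // h _; rewrite /xv opprB.
- by rewrite lieZl (lie_rootv fr) coroot_hT // scalerA divfK // g0.
Qed.

Lemma chain_has_cartan (U : {vspace M}) (A : 'I_n.+1 -> 'I_n.+1 -> int)
    (A' : nat -> nat -> int) (S : {set 'I_n.+1}) :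
  (forall i j, A i j = A' i j) -> (forall i, A i i = 2) -> chain_cartan A' ->
  (forall i : 'I_n.+1, i \in S -> rootv (P i) (P i.+1) \in U /\ rootv (P i.+1) (P i) \in U) ->
  has_cartan_matrix U T S (fun i => xv i) A.
Proof.
move=> AA A2 AP RU i Si; have [R1 R2] := RU i Si.
have ni (j : 'I_n.+1) : (j <= n)%N by rewrite -ltnS.
exists (hT (cort ty n i)).
  by apply: chain_coroot => //; rewrite -AP // -AA A2.
by move=> j Sj; rewrite xv_hT // AA AP.
Qed.

Lemma chain_marks (A : 'I_n.+1 -> 'I_n.+1 -> int) (A' : nat -> nat -> int) (m : nat -> int) :
  (forall i j, A i j = A' i j) -> chain_cartan A' ->
  (forall t, \sum_(j < n.+1) m j * xz ty n j t = 0) ->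
  forall i, \sum_j A i j * m j = 0.
Proof.
move=> AA AP m0 i; rewrite -[RHS](m0 (cort ty n i)); apply: eq_bigr => j _.
have [ni nj] : (i <= n)%N /\ (j <= n)%N by rewrite -!(ltnS _ n).
by rewrite AA AP // [RHS]mulrC.
Qed.

(** The coweight of x_k involves only x_0 and x_k, both with nonzero value.  So one
    vanishing coefficient forces a_0 = 0 and then all the others vanish: the x_i satisfy
    a single relation, with nonzero coefficients. *)
Lemma chain_indep (a : 'I_n.+1 -> C) : (if ty is ED then 2 < n else true)%N ->
  {in T, forall h, \sum_i a i * xv i h = 0} -> (exists j, a j = 0) -> forall i, a i = 0.
Proof.
move=> n2 a0 [j0 aj0].
have key (k : 'I_n.+1) : k != ord0 ->
  exists c d : C, [/\ c != 0, d != 0 & a ord0 * c + a k * d = 0].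
  move=> k0; have kn : (0 < k <= n)%N by rewrite -[(k <= n)%N](ltnS k n) ltn_ord andbT lt0n.
  have [|x1 x2 x3] := @cow_spec ty n k _ kn.
    by case: (ty) n2 => /= n2; rewrite ?n2 ?n1 // orbT.
  exists (xz ty n 0 (cow ty n k))%:~R, (xz ty n k (cow ty n k))%:~R.
  rewrite !intr_eq0 x1 x2; split=> //.
  rewrite -(a0 _ (hT_mem (cow ty n k))) (bigD1 ord0) //= (bigD1 k) //= big1 => [|j /andP[jn0 jk]].
    by rewrite addr0 !xv_hT //; case/andP: kn.
  have nj : (j <= n)%N by rewrite -(ltnS _ n).
  by rewrite xv_hT // x3 ?mulr0 // lt0n jn0.
have a00 : a ord0 = 0.
  have [<-//|k0] := eqVneq j0 ord0.
  have [c [d [c0 d0]]] := key _ k0.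
  by rewrite aj0 mul0r addr0 => /eqP; rewrite mulf_eq0 (negPf c0) orbF => /eqP.
move=> i; have [->//|i0] := eqVneq i ord0.
have [c [d [c0 d0]]] := key _ i0.
by rewrite a00 mul0r add0r => /eqP; rewrite mulf_eq0 (negPf d0) orbF => /eqP.
Qed.

End Chain.

Section ChainShape.
Variables (C : numClosedFieldType) (N : nat) (bar : 'I_N -> 'I_N) (s : 'I_N -> C).
Variables (wt : 'I_N -> int) (ty : endtype) (n : nat) (P : nat -> 'I_N).

(** The form is alternating for long ends and symmetric otherwise. *)
Definition sign_ok := forall a, match ty with EC => s a * s (bar a) = -1 | _ => s a * s (bar a) = 1 end.

(** For short ends the zero weight occurs. *)
Definition wt_ok := forall a, [/\ (`|wt a| <= n)%N & if ty is EB then true else wt a != 0].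

Hypotheses (ch : chain bar s wt ty n P) (wo : wt_ok).
Hypothesis n2 : (if ty is ED then 2 < n else 1 < n)%N.

Lemma chain_gt1 : (1 < n)%N.
Proof. by move: n2; case: ty => //; lia. Qed.

Let n1 := chain_gt1.
Let wP k : (k <= n.+1)%N -> wt (P k) = code ty n k. Proof. by case: ch => _ + _ _ _; exact. Qed.
Let wbar a : wt (bar a) = - wt a. Proof. by case: ch. Qed.
Let winj a b : wt a != 0 -> wt a = wt b -> a = b. Proof. by case: ch => _ _ h _ _; exact: h. Qed.
Let w0 a : wt a = 0 -> bar a = a. Proof. by case: ch => _ _ _ h _; exact: h. Qed.

Lemma wt_chain k : (0 < k <= n)%N -> wt (P k) = k%:Z.
Proof. by move=> kn; rewrite wP ?code_mid //; lia. Qed.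

Lemma chain_left : match ty with EC => P 0 = bar (P 1) | ED => P 0 = bar (P 2) | EB => bar (P 0) = P 0 end.
Proof.
have := @wP 0%N isT; rewrite /code eqxx.
case: (ty) n2 => h; last (by move=> h0; apply: w0); move=> h0; apply: winj; rewrite ?wbar h0 //.
  by rewrite wt_chain //; lia.
by rewrite wt_chain //; lia.
Qed.

Lemma chain_right : match ty with EC => P n.+1 = bar (P n) | ED => P n.+1 = bar (P n.-1)
  | EB => bar (P n.+1) = P n.+1 end.
Proof.
have := @wP n.+1 (leqnn _); rewrite /code eqxx /=.
case: (ty) n2 => h; last (by move=> h0; apply: w0); move=> h0; apply: winj; rewrite ?wbar h0 //.
- by rewrite oppr_eq0; lia.
- by rewrite wt_chain //; lia.
- by rewrite oppr_eq0; lia.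
- by rewrite wt_chain //; lia.
Qed.

Lemma chain_cover a : (exists2 k, (0 < k <= n)%N & a = P k \/ a = bar (P k)) \/
  (if ty is EB then wt a = 0 else False).
Proof.
have [wn wz] := wo a; have [a0|a0] := eqVneq (wt a) 0.
  by right; rewrite a0 in wz *; case: (ty) wz.
left; exists `|wt a|%N; first by rewrite wn andbT absz_gt0.
case: (ltrP 0 (wt a)) => h; [left|right]; apply: winj => //.
  by rewrite wt_chain; lia.
by rewrite wbar wt_chain; lia.
Qed.

End ChainShape.

(** * Simple systems from chains *)

Section SimpleSystem.
Variables (C : numClosedFieldType) (N : nat).
Local Notation M := 'M[C]_N.
Variables (V : M) (L : {vspace M}) (bar : 'I_N -> 'I_N) (s : 'I_N -> C).
Variables (rel : 'I_N -> 'I_N -> bool) (K T : {vspace M}).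
Local Notation hat := (hat V).
Local Notation eps := (eps V).
Local Notation rootv := (rootv V bar s).
Local Notation gam := (gam bar s).
Hypotheses (fr : frame V L bar s) (KP : in_class V L rel K) (relP : class_ok bar rel).
Hypothesis TP : diagonal_part V L T.
Variables (I : finType) (S : {set I}) (x : I -> M -> C).

Let barK : involutive bar. Proof. by case: fr. Qed.

(** The weight difference of a and b is a combination of simple roots with natural
    coefficients.  A simple system is obtained by showing that this relation is
    total on the pairs which give a root. *)
Definition pge a b := exists k : I -> nat,
  {in T, forall h, eps a h - eps b h = nat_comb_of S x k h}.

Lemma pge_refl a : pge a a.
Proof.
by exists (fun _ => 0%N) => h _; rewrite subrr /nat_comb_of big1 // => i _; rewrite mul0r.
Qed.

Lemma pge_trans b a c : pge a b -> pge b c -> pge a c.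
Proof.
move=> [k hk] [l hl]; exists (fun i => k i + l i)%N => h Th.
rewrite -(subrKA (eps b h)) hk // hl // /nat_comb_of -big_split /=.
by apply: eq_bigr => i _; rewrite natrD mulrDl.
Qed.

Lemma pge_bar a b : pge a b -> pge (bar b) (bar a).
Proof.
move=> [k hk]; exists k => h Th; have [Lh _] := (TP h).1 Th.
by rewrite !(eps_bar fr) // opprK addrC hk.
Qed.

Lemma pge_step i a b : i \in S -> {in T, forall h, x i h = eps a h - eps b h} -> pge a b.
Proof.
move=> Si xi; exists (fun j => (j == i)%N : nat) => h Th; rewrite /nat_comb_of (bigD1 i) //=.
rewrite eqxx mul1r xi // big1 ?addr0 // => j /andP[_ /negPf ->].
by rewrite mul0r.
Qed.

(** A finite Dynkin diagram of classical type is a descending chain g lo, ..., g n of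
    positions which, at one end, passes to the opposite positions: directly (C), by a
    fork (D), or through the zero weight z (B).  Hence all positions are comparable,
    except g n and its opposite for a fork. *)
Section Total.
Variables (ty : endtype) (lo n : nat) (g : nat -> 'I_N) (z : 'I_N).
Hypothesis gstep : forall k, (lo <= k < n)%N -> pge (g k) (g k.+1).
Hypothesis glast : match ty with EC => pge (g n) (bar (g n))
  | ED => (lo < n)%N /\ pge (g n) (bar (g n.-1)) | EB => bar z = z /\ pge (g n) z end.

Lemma chain_desc p q : (lo <= p <= q)%N -> (q <= n)%N -> pge (g p) (g q).
Proof.
elim: q => [|q IH] pq qn.
  have -> : p = 0%N by lia.
  exact: pge_refl.
have [->|pq'] := eqVneq p q.+1; first exact: pge_refl.
by apply: (@pge_trans (g q)); [apply: IH; lia | apply: gstep; lia].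
Qed.

Lemma chain_turn p q : (lo <= p <= n)%N -> (lo <= q <= n)%N ->
  (if ty is ED then p != q else true) -> pge (g p) (bar (g q)).
Proof.
move=> pn qn pq; have le k : (lo <= k <= n)%N -> pge (g k) (g n) by move=> kn; apply: chain_desc; lia.
move: glast pq; case: ty => [e _|[ln e] pq|[zz e] _].
- by apply: (pge_trans (le _ pn)); apply: (pge_trans e); apply/pge_bar/le.
- have base a b : (lo <= a < n)%N -> (lo <= b <= n)%N -> pge (g a) (bar (g b)).
    move=> an bn; apply: (@pge_trans (g n.-1)); first by apply: chain_desc; lia.
    by rewrite -[g n.-1]barK; apply: (pge_trans (pge_bar e)); apply/pge_bar/le.
  have [pn'|pn'] := ltnP p n; first by apply: base; lia.
  have qn' : (lo <= q < n)%N by move/eqP: pq; lia.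
  by rewrite -[g p]barK; apply/pge_bar/base; lia.
- have lez k : (lo <= k <= n)%N -> pge (g k) z by move=> kn; exact: pge_trans (le _ kn) e.
  by apply: (pge_trans (lez _ pn)); rewrite -zz; apply/pge_bar/lez.
Qed.

Definition in_chain a := (exists2 k, (lo <= k <= n)%N & a = g k \/ a = bar (g k)) \/
  (if ty is EB then a = z else False).

Lemma chain_total a b : in_chain a -> in_chain b -> a != b ->
  (if ty is ED then b != bar a else true) -> pge a b \/ pge b a.
Proof.
have lez k : (lo <= k <= n)%N -> if ty is EB then pge (g k) z /\ pge z (bar (g k)) else True.
  move=> kn; move: glast; case: ty => // -[zz e].
  have e1 : pge (g k) z by apply: (pge_trans _ e); apply: chain_desc; lia.
  by split=> //; rewrite -zz; exact: pge_bar.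
move=> [[k kn ak]|az] [[l ln bl]|bz] ab nb.
- have [ak'|ak'] := ak; have [bl'|bl'] := bl; subst a b.
  + have [kl|kl] := leqP k l; [left|right]; apply: chain_desc; lia.
  + left; apply: chain_turn => //; move: nb; case: (ty) => //.
    by apply: contraNneq => ->.
  + right; apply: chain_turn => //; move: nb; case: (ty) => //.
    by apply: contraNneq => ->; rewrite barK.
  + by have [kl|kl] := leqP k l; [right|left]; apply: pge_bar; apply: chain_desc; lia.
- move: (lez _ kn) bz; case: (ty) => // -[h1 h2] ->.
  by case: ak => ->; [left|right].
- move: (lez _ ln) az; case: (ty) => // -[h1 h2] ->.
  by case: bl => ->; [right|left].
- by move: az bz ab; case: (ty) => // -> ->; rewrite eqxx.
Qed.

End Total.

(** Only the coefficients (a, bar a) of elements of so are forced to vanish, and these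
    are the pairs with gam a (bar a) = 0. *)
Lemma entry_gam X a b : X \in L -> hat X a b != 0 -> gam a b != 0.
Proof.
move=> LX; have [_ _ ss _ /(_ X) [/(_ LX) LP _]] := fr.
rewrite /gam; case: (b =P bar a) => [bE|_]; last by rewrite /= mulr0n subr0 oner_eq0.
rewrite /= mulr1n; have := LP a b; rewrite bE barK; set u := hat X _ _; set e := s a * _.
move=> h u0; have : (1 + e) * u = 0 by rewrite mulrDl mul1r {1}h addNr.
move/eqP; rewrite mulf_eq0 (negPf u0) orbF addr_eq0 => /eqP e1.
have -> : e = -1 by rewrite e1 opprK.
by rewrite opprK -[1 + 1]/(2%:R) pnatr_eq0.
Qed.

(** Every root of K is the weight of some nonzero coefficient, hence a difference of
    two weights of positions. *)
Lemma simple_system_of_pge :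
  (forall i, i \in S -> exists a b, [/\ rel a b, gam a b != 0,
     {in T, forall h, x i h = eps a h - eps b h} & exists2 h, h \in T & eps a h != eps b h]) ->
  (forall a : I -> C, {in T, forall h, \sum_(i in S) a i * x i h = 0} -> forall i, i \in S -> a i = 0) ->
  (forall a b, rel a b -> a != b -> gam a b != 0 -> pge a b \/ pge b a) ->
  simple_system K T S x.
Proof.
move=> roots indep total; split=> //.
  move=> i /roots[a [b [rab gab xi [h Th nh]]]]; split.
    exists (rootv a b); last first.
      apply: contraNneq gab => R0; rewrite -(rootv_gam fr) R0 hat0 mxE eqxx //.
    by apply: (rootv_weight fr TP) => //; exact: rootv_class fr KP relP _ _ rab.
  by move=> /(_ h Th); rewrite xi // => /eqP; rewrite subr_eq0 (negPf nh).
move=> y [[X wX X0] ynt].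
have [a [b Xab]] : exists a b, hat X a b != 0.
  case: (pickP (fun ij : 'I_N * 'I_N => hat X ij.1 ij.2 != 0)) => [[i j] /=|h].
    by exists i, j.
  case/eqP: X0; apply: (hat_inj fr) => i j; rewrite hat0 mxE.
  by have := h (i, j) => /= /negbFE/eqP.
have [KX _] := wX; have [LX Xrel] := (KP X).1 KX.
have yE := weight_entry fr TP wX Xab.
have rab : rel a b by apply/negPn/negP => /Xrel h; rewrite h eqxx in Xab.
have ab : a != b.
  by apply/eqP => ab; apply: ynt => h Th; rewrite yE // ab subrr.
have [[k hk]|[k hk]] := total _ _ rab ab (entry_gam LX Xab); exists k; [left|right] => h Th.
  by rewrite yE // hk.
by rewrite -hk // opprB yE.
Qed.

End SimpleSystem.

(** * The Kac diagram with the middle vertex black *)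

Section Kac.
Variables (C : numClosedFieldType) (N : nat).
Local Notation M := 'M[C]_N.
Variables (V : M) (L : {vspace M}) (bar : 'I_N -> 'I_N) (s : 'I_N -> C).
Variables (T K Q : {vspace M}) (wt : 'I_N -> int) (ty : endtype) (m : nat) (P : nat -> 'I_N).
Variable (col : 'I_N -> bool).
Local Notation n := (m + m)%N.
Local Notation hat := (hat V).
Local Notation eps := (eps V).
Local Notation rootv := (rootv V bar s).
Local Notation gam := (gam bar s).
Local Notation xv := (xv V P).
Local Notation hT := (hT V wt).

(** The colour of a position tells the eigenvalue of Q.  The chain changes colour
    between P_m and P_(m+1), so that x_m is the only vertex in L^(-theta). *)
Definition coloured := [/\ forall a, col (bar a) = col a,
   forall i, (i <= n.+1)%N -> col (P i) = (m < i)%N &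
   forall a b, wt a = 0 -> wt b = 0 -> col a = col b -> a = b].

Hypotheses (fr : frame V L bar s) (TP : diagonal_part V L T) (ch : chain bar s wt ty n P).
Hypotheses (so : sign_ok bar s ty) (wo : wt_ok wt ty n) (co : coloured).
Hypotheses (m0 : if ty is ED then (1 < m)%N else (0 < m)%N) (lieL : lie_closed L).

Definition rel a b := col a == col b.

Hypothesis KP : in_class V L rel K.
Hypothesis QP : forall X, X \in Q <-> X \in L /\ forall a b, col a = col b -> hat X a b = 0.

Let barK : involutive bar. Proof. by case: fr. Qed.
Let m1 : (0 < m)%N. Proof. by move: m0; case: ty => //; lia. Qed.
Let n1 : (1 < n)%N. Proof. by have := m1; lia. Qed.
Let relP : class_ok bar rel.
Proof.
have [cb _ _] := co; rewrite /rel; split=> [a|a b|a b c /eqP -> //|a b].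
- exact: eqxx.
- exact: eq_sym.
- by rewrite cb.
Qed.

Let wP k : (k <= n.+1)%N -> wt (P k) = code ty n k. Proof. by case: ch => _ + _ _ _; exact. Qed.
Let wPk k : (0 < k <= n)%N -> wt (P k) = k%:Z.
Proof. by move=> kn; rewrite wP ?code_mid //; lia. Qed.
Let wbar a : wt (bar a) = - wt a. Proof. by case: ch. Qed.
Let winj a b : wt a != 0 -> wt a = wt b -> a = b. Proof. by case: ch => _ _ h _ _; exact: h. Qed.
Let w0 a : wt a = 0 -> bar a = a. Proof. by case: ch => _ _ _ h _; exact: h. Qed.

Let n2 : (if ty is ED then 2 < n else 1 < n)%N.
Proof. by move: m0; case: ty => //; lia. Qed.
Let chain_left := chain_left ch n2.
Let chain_right := chain_right ch n2.

Lemma coloured_cover a : (exists2 k, (0 < k <= n)%N & a = P k \/ a = bar (P k)) \/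
  (if ty is EB then a = P 0 \/ a = P n.+1 else False).
Proof.
have [ca|a0] := chain_cover ch wo n2 a; [by left|right].
have [_ cP c0] := co; have := @wP 0%N isT; have := @wP n.+1 (leqnn _); rewrite /code !eqxx /=.
case: (ty) a0 => // a0 z1 z0; case ca: (col a); [right|left]; apply: c0 => //.
  by rewrite cP // ca; lia.
by rewrite cP.
Qed.

Lemma colP k : (k <= n.+1)%N -> col (P k) = (m < k)%N. Proof. by case: co => _ + _; exact. Qed.
Lemma colbar a : col (bar a) = col a. Proof. by case: co. Qed.

Lemma gam_neq a b : b != bar a -> gam a b = 1.
Proof. by move=> /negPf ab; rewrite /gam ab subr0. Qed.

Lemma gam_bar a : gam a (bar a) = 1 - s a * s (bar a).
Proof. by rewrite /gam eqxx. Qed.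

(** For long ends a and bar a are paired themselves; for forks a second position of the
    same colour exists since m > 1, at one of the first two places of its half of the
    chain; for short ends the zero weight of the same colour serves. *)
Lemma kac_rich : rich bar s rel.
Proof.
move=> a aa; have gaa : gam a a = 1 by rewrite gam_neq // eq_sym.
have [wa wz] := wo a; move: (so a) (m0) wz chain_left chain_right.
case: (ty) => sa mm wz cl cr.
- exists a; rewrite /rel eqxx gaa gam_bar sa opprK oner_eq0; split=> //.
  by rewrite -[1 + 1]/(2%:R) pnatr_eq0.
- (* a place of the chain of the same colour as a, other than those of a and bar a *)
  pose k := if col a then (if `|wt a|%N == m.+1 then m.+2 else m.+1)
            else (if `|wt a|%N == 1%N then 2 else 1)%N.
  have kn : (0 < k <= n)%N by rewrite /k; do 2 case: ifP => _; lia.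
  have wk : `|wt a|%N != k.
    rewrite /k; case: (col a); last by case: (`|wt a|%N =P 1%N) => [->|/eqP].
    by case: (`|wt a|%N =P m.+1) => [->|/eqP //]; apply/eqP; lia.
  exists (P k); have gk b : `|wt b|%N = k -> gam a b != 0.
    move=> wb; rewrite gam_neq ?oner_eq0 //; apply: contraNneq wk => ba.
    by rewrite -wb ba wbar abszN.
  split; last 1 first.
  + by apply: gk; rewrite wbar wPk // abszN.
  + rewrite /rel colP; last lia.
    by rewrite /k; case: (col a); case: ifP => _; apply/eqP; lia.
  + by apply: gk; rewrite wPk.
- pose b := if col a then P n.+1 else P 0.
  have bb : bar b = b by rewrite /b; case: (col a).
  have ba : b != bar a by apply: contraNneq aa => ba; rewrite -ba -bb ba barK.
  exists b; rewrite bb gam_neq // oner_eq0; split=> //.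
  by rewrite /rel /b; case: (col a); rewrite colP //; apply/eqP; lia.
Qed.

Lemma kac_separated : separated V rel T.
Proof.
apply: (chain_separated fr TP ch n1) => a b a0 b0 /eqP cab.
by case: co => _ _; exact.
Qed.

Local Notation S := (~: [set i : 'I_n.+1 | val i == m])%SET.

Lemma root_in_K i : (i <= n)%N -> i != m -> rootv (P i) (P i.+1) \in K /\ rootv (P i.+1) (P i) \in K.
Proof.
move=> ni im; split; apply: (rootv_class fr KP relP); rewrite /rel !colP; apply/eqP; lia.
Qed.

Lemma xv_neq0 i : (i <= n)%N -> exists2 h, h \in T & eps (P i) h != eps (P i.+1) h.
Proof.
move=> ni; exists (hT (fun k => k%:Z)); first exact: (hT_mem fr TP ch).
have evid z : ev (fun k => k%:Z) z = z by rewrite /ev; lia.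
rewrite !(eps_hT _ fr) !evid eqr_int !wP ?(leqW ni) // /code.
by apply/eqP; move: m0; case: (ty); do ![case: eqP => ?]; lia.
Qed.

(** L^theta is a sum of two ideals, one for each colour.  The chain from P_(m+1) to
    P_(n+1) covers one colour; the other one is covered by the chain from P_m to P_0
    read backwards, which is made descending by applying bar. *)
Lemma in_chain_right a : col a -> in_chain bar ty m.+1 n P (P n.+1) a.
Proof.
move=> ca; have [[k kn ak]|az] := coloured_cover a; [left|right].
  exists k => //; have : col (P k) by case: ak ca => ->; rewrite ?colbar.
  by rewrite colP; lia.
by move: az; case: (ty) => // -[az|//]; move: ca; rewrite az colP.
Qed.

Lemma in_chain_left a : ~~ col a -> in_chain bar ty m.+1 n (fun k => bar (P (n.+1 - k))) (P 0) a.
Proof.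
move=> ca; have [[k kn ak]|az] := coloured_cover a; [left|right].
  have : ~~ col (P k) by case: ak ca => ->; rewrite ?colbar.
  rewrite colP => [km|]; last lia.
  exists (n.+1 - k)%N; first lia.
  have -> : (n.+1 - (n.+1 - k) = k)%N by lia.
  by case: ak => ->; [right|left]; rewrite ?barK.
by move: az; case: (ty) => // -[//|az]; move: ca; rewrite az colP // ltnS leq_addr.
Qed.

Lemma kac_simple : simple_system K T S (fun i => xv i).
Proof.
apply: (simple_system_of_pge fr KP relP TP) => [i|a a0|a b rab ab gab].
- rewrite !inE => /eqP im; have ni : (i <= n)%N by rewrite -ltnS.
  have {}im : nat_of_ord i <> m by [].
  exists (P i), (P i.+1); split=> //; last exact: xv_neq0.
    by rewrite /rel !colP; [apply/eqP; lia|lia|lia].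
  by case: ch => _ _ _ _; exact.
- pose a' i := if i \in S then a i else 0.
  have h : forall i, a' i = 0.
    apply: (chain_indep fr TP ch n1); first by move: (m0); case: (ty) => //; lia.
      move=> t Tt; rewrite -[RHS](a0 t Tt) [RHS]big_mkcond.
      by apply: eq_bigr => i _; rewrite /a'; case: ifP => _; rewrite ?mul0r.
    have mn : (m < n.+1)%N by lia.
    by exists (Ordinal mn); rewrite /a' !inE eqxx.
  by move=> i Si; have := h i; rewrite /a' Si.
- have stp i : (i <= n)%N -> i != m -> pge V T S (fun i : 'I_n.+1 => xv i) (P i) (P i.+1).
    move=> ni im; have ni' : (i < n.+1)%N by [].
    by apply: (@pge_step _ _ _ _ _ _ _ (Ordinal ni')) => //; rewrite !inE.
  have turn : is_true (if ty is ED then b != bar a else true).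
    move: (so a); case: (ty) => // sa; apply: contraNneq gab => ->.
    by rewrite gam_bar sa subrr.
  case ca: (col a).
  + apply: (chain_total fr TP (ty := ty) (lo := m.+1) (n := n) (g := P) (z := P n.+1)) => //.
    * by move=> k kn; apply: stp; lia.
    * have := stp n (leqnn _); move: chain_right (m0); case: (ty) => e mm st.
      - by rewrite -e; apply: st; lia.
      - by split; [lia|rewrite -e; apply: st; lia].
      - by split=> //; apply: st; lia.
    * exact: in_chain_right.
    * by apply: in_chain_right; rewrite -(eqP rab).
  + pose g k := bar (P (n.+1 - k)).
    apply: (chain_total fr TP (ty := ty) (lo := m.+1) (n := n) (g := g) (z := P 0)) => //; rewrite /g.
    * move=> k kn; apply: (pge_bar fr TP).
      have -> : (n.+1 - k = (n.+1 - k.+1).+1)%N by lia.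
      by apply: stp; lia.
    * have := stp 0%N (leq0n _).
      have -> : (n.+1 - n = 1)%N by lia.
      move: chain_left (m0); case: (ty) => e mm st.
      - by rewrite barK -e; apply: st; lia.
      - have -> : (n.+1 - n.-1 = 2)%N by lia.
        by split; [lia|apply: (pge_bar fr TP); rewrite -e; apply: st; lia].
      - by split=> //; rewrite -e; apply: (pge_bar fr TP); apply: st; lia.
    * by apply: in_chain_left; rewrite ca.
    * by apply: in_chain_left; rewrite -(eqP rab) ca.
Qed.

Lemma coloured_step a : (exists2 k, (k <= n)%N & a = P k) \/ (exists2 k, (k <= n)%N & a = bar (P k.+1)).
Proof.
have [[[|k] // kn [ak|ak]]|] := coloured_cover a.
- by left; exists k.+1 => //; lia.
- by right; exists k => //; lia.
move: chain_right; case: (ty) => // cr [->|->]; first by left; exists 0%N.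
by right; exists n.
Qed.

Lemma gamC a b : gam a b = gam b a.
Proof. by rewrite /gam (eqbarC fr) [s a * _]mulrC. Qed.

Lemma gam_barbar a b : gam (bar a) (bar b) = gam a b.
Proof.
have [_ _ _ sb _] := fr.
by rewrite /gam (inj_eq (inv_inj barK)) sb.
Qed.

(** A root vector of L^theta moves the coefficients in row a to row a', and no other
    coefficient of v can contribute to the entry (a', b). *)
Lemma low_entry v a a' b : v \in Q -> col a' = col a -> col b != col a ->
  hat (lie (rootv a' a) v) a' b = gam a' a * hat v a b.
Proof.
move=> Qv ca cb; rewrite (hat_lieE fr) (bigD1 a) //= big1 => [|c ca'].
  rewrite (rootv_gam fr) (rootvE fr) [a == bar a](_ : _ = false || (a == bar a)) //=.
  have -> : (b == a) = false by apply: contraNF cb => /eqP ->.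
  have -> : (b == bar a') = false by apply: contraNF cb => /eqP ->; rewrite colbar ca.
  by rewrite !andbF mulr0 subr0 mulr0 subr0 addr0.
rewrite !(rootvE fr) (negPf ca').
have -> : (b == a) = false by apply: contraNF cb => /eqP ->.
have -> : (b == bar a') = false by apply: contraNF cb => /eqP ->; rewrite colbar ca.
have -> : (a' == bar a) && (c == bar a') = false.
  by apply: contraNF ca' => /andP[/eqP aE /eqP ->]; rewrite aE barK.
by rewrite !andbF !(mulr0, subr0, mul0r).
Qed.

(** A coweight which is positive on the white vertices and takes its minimum over all
    weight differences at x_m: it decreases from 0 to - m on the first half of the
    chain and from m on the second half. *)
Definition height (k : nat) : int := if (k <= m)%N then - k%:Z else (n.+1 - k)%:Z.

Lemma height_bound a : - m%:Z <= ev height (wt a) <= m%:Z.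
Proof.
have [wn _] := wo a; case: (wt a) wn => [[|k]|k] wn.
- by rewrite ev0; lia.
- by rewrite ev_nat // /height; case: ifP => ?; lia.
- by rewrite NegzE evN ev_nat // /height; case: ifP => ?; move: wn; rewrite NegzE abszN /=; lia.
Qed.

Lemma height_black : xz ty n m height = - n%:Z.
Proof.
rewrite xz_mid; last (have := m1; lia).
by rewrite /height leqnn ltnn; lia.
Qed.

Lemma height_white i : (i <= n)%N -> i != m -> 0 < xz ty n i height.
Proof.
move=> ni im; have [i0|i0] := eqVneq i 0%N.
  rewrite i0 xz0; last by have := m1; lia.
  by rewrite /height; move: (m0); case: (ty) => mm; do ?case: ifP => ?; lia.
have [ni'|ni'] := eqVneq i n.
  rewrite ni' xzn // /height; move: (m0); case: (ty) => mm; do ?case: ifP => ?; lia.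
by rewrite xz_mid; [rewrite /height; do ?case: ifP => ?; lia|lia].
Qed.

Lemma xv_int i (Y : M) a b : (i <= n)%N -> hat Y a b != 0 ->
  weight_space K T (fun h => - xv i h) Y ->
  ev height (wt a) - ev height (wt b) = - xz ty n i height.
Proof.
move=> ni Yab wY; have := weight_entry fr TP wY Yab (hT_mem fr TP ch height).
rewrite (xv_hT fr ch) // !(eps_hT _ fr) -rmorphN -rmorphB => /eqP.
by rewrite eqr_int => /eqP ->.
Qed.

(** A lowest weight vector has its coefficients killed by every step of the chain
    other than the step from P_m to P_(m+1), so its rows lie at P_m or at the opposite of
    P_(m+1), and by symmetry its columns at the opposites of these.  Conversely x_m has the least height
    among weight differences, so nothing lies below it. *)
Lemma kac_lowest y : lowest_weight K T S (fun i => xv i) Q y <->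
  exists2 i : 'I_n.+1, i \in [set i : 'I_n.+1 | val i == m]%SET & {in T, y =1 xv i}.
Proof.
have mn : (m <= n)%N by lia.
split=> [[v [wv v0 vlow]] | [ i]].
  have [Qv _] := wv; have [Lv vcol] := (QP v).1 Qv.
  have [_ _ _ _ /(_ v) [/(_ Lv) LP _]] := fr.
  have [a [b vab]] : exists a b, hat v a b != 0.
    case: (pickP (fun ij : 'I_N * 'I_N => hat v ij.1 ij.2 != 0)) => [[i j] /=|h].
      by exists i, j.
    case/eqP: v0; apply: (hat_inj fr) => i j; rewrite hat0 mxE.
    by have := h (i, j) => /= /negbFE/eqP.
  have low c d : hat v c d != 0 -> c = P m \/ c = bar (P m.+1).
    move=> vcd; have cd : col d != col c.
      by apply/eqP => cd; move: vcd; rewrite vcol ?eqxx.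
    have kill k c' : (k <= n)%N -> k != m -> col c' = col c -> gam c' c != 0 ->
        {in T, forall h, - xv k h = eps c' h - eps c h} -> False.
      move=> kn km cc g0 wk; have kn' : (k < n.+1)%N by [].
      have := low_entry Qv cc cd.
      have RK : rootv c' c \in K by apply: (rootv_class fr KP relP); rewrite /rel cc.
      rewrite (vlow (Ordinal kn') (rootv c' c)); last first.
      - exact: (rootv_weight fr TP RK).
      - by rewrite !inE.
      by rewrite hat0 mxE => /esym/eqP; rewrite mulf_eq0 (negPf g0) (negPf vcd).
    have [[k kn ck]|[k kn ck]] := coloured_step c; have [km|km] := eqVneq k m; subst.
    - by left.
    - case: (kill k (P k.+1)) => //.
      + by rewrite !colP ?(leqW kn) // ltnS [(m <= k)%N]leq_eqVlt eq_sym (negPf km).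
      + by rewrite gamC; case: ch => _ _ _ _; exact.
      + by move=> h _; rewrite /xv opprB.
    - by right.
    - case: (kill k (bar (P k))) => //.
      + by rewrite !colbar !colP ?(leqW kn) // ltnS [(m <= k)%N]leq_eqVlt eq_sym (negPf km).
      + by rewrite gam_barbar; case: ch => _ _ _ _; exact.
      + by move=> h Th; have [Lh _] := (TP h).1 Th; rewrite /xv !(eps_bar fr) // opprB opprK addrC.
  have cab : col a != col b by apply/eqP => cd; move: vab; rewrite vcol ?eqxx.
  have vba : hat v (bar b) (bar a) != 0.
    rewrite LP oppr_eq0 mulf_neq0 //; have [_ _ ss _ _] := fr.
    have sn c : s c != 0.
      by apply/eqP => sc; have := ss c; rewrite sc mul0r => /eqP; rewrite eq_sym oner_eq0.
    by rewrite mulf_neq0.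
  have im : nat_of_ord (inord m : 'I_n.+1) = m by exact: inordK.
  exists (inord m); first by rewrite inE; apply/eqP.
  move=> h Th; rewrite /xv im (weight_entry fr TP wv vab Th).
  have [Lh _] := (TP h).1 Th.
  have ca := low _ _ vab; have cb := low _ _ vba.
  have bE : b = bar (bar b) by rewrite barK.
  move: cab; rewrite bE; case: ca => ->; case: cb => ->; rewrite ?colbar ?eqxx // => _.
    by rewrite barK.
  by rewrite !(eps_bar fr) // opprK addrC.
rewrite inE => /eqP im yx; exists (rootv (P m) (P m.+1)).
have Rmn : rootv (P m) (P m.+1) \in Q.
  apply/QP; split; first exact: rootv_mem fr _ _.
  move=> a b cab; rewrite (rootvE fr).
  case: (boolP (_ && _)) => [/andP[/eqP aE /eqP bE]|_].
    by move: cab; rewrite aE bE !colP ?ltnn ?ltnS ?leqnn //; lia.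
  case: (boolP (_ && _)) => [/andP[/eqP aE /eqP bE]|_]; last by rewrite mulr0 subr0.
  by move: cab; rewrite aE bE !colbar !colP ?ltnn ?ltnS ?leqnn //; lia.
have g0 : gam (P m) (P m.+1) != 0 by case: ch => _ _ _ _; apply.
have wR : weight_space Q T y (rootv (P m) (P m.+1)).
  by apply: (rootv_weight fr TP Rmn) => h Th; rewrite yx // /xv im.
split=> //.
  by apply: contraNneq g0 => R0; rewrite -(rootv_gam fr) R0 hat0 mxE.
move=> j Y; rewrite !inE => jm wY; apply: (hat_inj fr) => a b; rewrite hat0 mxE.
have jn : (j <= n)%N by rewrite -ltnS.
have [KY _] := wY; have [_ Yc] := (KP Y).1 KY; have [_ Rc] := (QP _).1 Rmn.
apply/eqP; apply: contraT => /(lie_entry_neq0 fr)[c].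
have hR a' b' : hat (rootv (P m) (P m.+1)) a' b' != 0 ->
    ev height (wt a') - ev height (wt b') = - n%:Z.
  move=> Rab; have := weight_entry fr TP wR Rab (hT_mem fr TP ch height).
  rewrite yx ?(hT_mem fr TP ch) // im (xv_hT fr ch) // !(eps_hT _ fr) -rmorphB => /eqP.
  by rewrite eqr_int height_black => /eqP ->.
have := height_white jn jm; have := height_bound a; have := height_bound b; have := height_bound c.
by case=> -[] // h1 h2 h3 h4 [[/(xv_int jn) /(_ wY) e1 /hR e2]|[/hR e2 /(xv_int jn) /(_ wY) e1]]; lia.
Qed.

Lemma kac_main (A : 'I_n.+1 -> 'I_n.+1 -> int) (A' : nat -> nat -> int) :
  (forall i j, A i j = A' i j) -> (forall i, A i i = 2) -> chain_cartan ty n A' ->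
  [/\ dynkin_diagram_of (derived K) (T :&: derived K)%VS S (fun i => xv i) A,
      #|[set i : 'I_n.+1 | val i == m]%SET| = (1 + \dim (center K))%N &
      forall y, lowest_weight K T S (fun i => xv i) Q y <->
       exists2 i : 'I_n.+1, i \in [set i : 'I_n.+1 | val i == m]%SET & {in T, y =1 xv i}].
Proof.
move=> AA A2 AP; have sep := kac_separated; have ri := kac_rich.
have dK := derived_class fr KP relP TP lieL sep ri.
have TK : (T :&: K)%VS = T by apply/capv_idPl; exact: diag_class KP relP TP.
rewrite dK TK (center_class fr KP relP TP sep ri) dimv0; split; last exact: kac_lowest.
  split; [exact: diag_cartan fr KP relP TP sep | exact: kac_simple |].
  apply: (chain_has_cartan fr TP ch n1 AA A2 AP) => i; rewrite !inE => im.
  by apply: root_in_K => //; rewrite -ltnS.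
rewrite -[RHS](cards1 (inord m : 'I_n.+1)); apply: eq_card => i; rewrite !inE.
by rewrite -val_eqE /= [inord m : nat]inordK // ltnS leq_addr.
Qed.

(** ** The second involution *)

(** sigma is conjugation by a monomial matrix which permutes the positions by tau.  As
    tau reverses the chain up to bar, sigma maps x_i to x_(n-i).  On the root space of
    x_m it is the scalar del, read off from the weights w of the monomial matrix. *)
Section Vogan.
Variables (sigma : 'End(M)) (tau : 'I_N -> 'I_N) (w : 'I_N -> C) (del : C).
Hypotheses (tauK : involutive tau) (coltau : forall a, col (tau a) = ~~ col a).
Hypothesis tauP : forall k, (k <= n.+1)%N -> tau (P k) = bar (P (n.+1 - k)).
Hypothesis w0' : forall a, w a != 0.
Hypotheses (sL : forall X, X \in L -> sigma X \in L) (sK : forall X, sigma (sigma X) = X).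
Hypothesis sE : forall X a b, hat (sigma X) (tau a) (tau b) = w a / w b * hat X a b.
Hypothesis wm : w (P m) / w (P m.+1) = - del * (s (P m) * s (P m.+1)).

Lemma sigma_T X : X \in T -> sigma X \in T.
Proof.
move=> /TP[LX Xd]; apply/TP; split; first exact: sL.
move=> a b ab; rewrite -[a]tauK -[b]tauK sE Xd ?mulr0 //.
by rewrite (inj_eq (inv_inj tauK)).
Qed.

Lemma eps_sigma X a : eps (tau a) (sigma X) = eps a X.
Proof. by rewrite /eps sE divff // mul1r. Qed.

Lemma xv_sigma X i : X \in T -> (i <= n)%N -> xv (n - i) (sigma X) = xv i X.
Proof.
move=> TX ni; have [Ls _] := (TP _).1 (sigma_T TX).
have E k : (k <= n.+1)%N -> eps (P k) X = - eps (P (n.+1 - k)) (sigma X).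
  by move=> kn; rewrite -eps_sigma tauP // (eps_bar fr).
rewrite /xv !E ?(leqW ni) // opprK addrC.
by have -> : (n.+1 - i.+1 = n - i)%N by []; rewrite -subSn.
Qed.

Lemma sigma_weight (U : {vspace M}) i X : (forall Y, Y \in U -> sigma Y \in U) ->
  (i <= n)%N -> weight_space U T (xv i) X -> weight_space U T (xv (n - i)) (sigma X).
Proof.
move=> sU ni wX; have [UX _] := wX; apply: (weight_spaceP fr TP); first exact: sU.
move=> a b; rewrite -[a]tauK -[b]tauK sE; set a' := tau a; set b' := tau b => nz h Th.
have Xab : hat X a' b' != 0 by apply: contraNneq nz => ->; rewrite mulr0.
have := weight_entry fr TP wX Xab (sigma_T Th).
by rewrite -!(eps_sigma (sigma h)) sK -(xv_sigma (sigma_T Th) ni) sK.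
Qed.

Lemma vogan_main (c : {set 'I_n.+1}) (p := [set i : 'I_n.+1 | val i == m]%SET) :
  (forall i : 'I_n.+1, val i = m -> del = if i \in c then -1 else 1) ->
  let W a i := weight_space (if a then K else Q) T (xv i) in
  [/\ forall i : 'I_n.+1, (sigma @` W true i)%classic = W true (rev_ord i),
      forall i : 'I_n.+1, (sigma @` W false i)%classic = W false (rev_ord i) &
      forall i : 'I_n.+1, rev_ord i = i ->
        forall X, W (i \notin p) i X -> sigma X = (if i \in c then - X else X)].
Proof.
move=> hc W.
have sKK X : X \in K -> sigma X \in K.
  move=> /KP[LX Xc]; apply/KP; split; first exact: sL.
  move=> a b rab; rewrite -[a]tauK -[b]tauK sE Xc ?mulr0 //.
  by move: rab; rewrite /rel !coltau; case: (col a); case: (col b).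
have sQ X : X \in Q -> sigma X \in Q.
  move=> /QP[LX Xc]; apply/QP; split; first exact: sL.
  by move=> a b rab; rewrite -[a]tauK -[b]tauK sE Xc ?mulr0 // !coltau rab.
have sU (a : bool) X : X \in (if a then K else Q) -> sigma X \in (if a then K else Q).
  by case: a; [exact: sKK|exact: sQ].
have im a (i : 'I_n.+1) : (sigma @` W a i)%classic = W a (rev_ord i).
  have ni : (i <= n)%N by rewrite -ltnS.
  have re : (rev_ord i : nat) = (n - i)%N by rewrite /= subSS.
  apply/seteqP; split=> [_ [X WX <-]|X WX]; rewrite /W ?re.
    by apply: sigma_weight => // Y; exact: sU.
  exists (sigma X); last exact: sK.
  rewrite /W; have -> : nat_of_ord i = (n - (n - i))%N by rewrite subKn.
  by apply: sigma_weight; [exact: sU|lia|rewrite -re].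
split; [exact: im|exact: im|].
move=> i /(congr1 val) /= ri X; have im' : nat_of_ord i = m by move: ri; have := ltn_ord i; lia.
rewrite {1}/W inE /= im' eqxx /= => wX; have := hc i im'.
have [QX _] := wX; have [LX Xc] := (QP X).1 QX.
(* x_m has the least height and the height determines these two positions *)
have supp a b : hat X a b != 0 -> (a = P m /\ b = P m.+1) \/ (a = bar (P m.+1) /\ b = bar (P m)).
  move=> Xab; have := weight_entry fr TP wX Xab (hT_mem fr TP ch height).
  rewrite (xv_hT fr ch) ?leq_addr // !(eps_hT _ fr) -rmorphB => /eqP.
  rewrite eqr_int height_black => /eqP ht.
  have cab : col a != col b by apply/eqP => cd; move: Xab; rewrite Xc ?eqxx.
  have ext e : ev height (wt e) = - m%:Z -> e = P m \/ e = bar (P m.+1).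
    case: (wo e) => wn _ he; have wm1 : wt e = m%:Z \/ wt e = - m.+1%:Z.
      move: wn he; case: (wt e) => [[|k]|k] wn.
      - by rewrite ev0; have := m1; lia.
      - by rewrite ev_nat // /height; case: ifP => ?; lia.
      - move: wn; rewrite NegzE abszN evN ev_nat // /height /=; case: ifP => ?; lia.
    case: wm1 => we; [left|right]; apply: winj; rewrite ?wbar ?we //.
    - by rewrite eqz_nat; have := m1; lia.
    - by rewrite wPk //; have := m1; lia.
    - by rewrite wPk //; have := m1; lia.
  have ha : ev height (wt a) = - m%:Z.
    by have := height_bound a; have := height_bound b; lia.
  have hb : ev height (wt (bar b)) = - m%:Z.
    by rewrite wbar evN; have := height_bound a; have := height_bound b; lia.
  have bE : b = bar (bar b) by rewrite barK.
  move: cab; rewrite bE; case: (ext _ ha) => ->; case: (ext _ hb) => ->;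
    rewrite ?colbar ?eqxx // => _; rewrite ?barK; by [left|right].
have [_ _ ss _ LP] := fr.
have LXe := (LP X).1 LX; have LsX := (LP (sigma X)).1 (sL LX).
pose x := hat X (P m) (P m.+1).
have sgn : s (P m) * s (P m.+1) * (s (P m) * s (P m.+1)) = 1.
  by rewrite mulrACA !ss mulr1.
have tm : tau (P m) = bar (P m.+1).
  by rewrite tauP; [congr (bar (P _)); lia|lia].
have tm1 : tau (P m.+1) = bar (P m).
  by rewrite tauP; [congr (bar (P _)); lia|lia].
have s1 : hat (sigma X) (bar (P m.+1)) (bar (P m)) = - del * (s (P m) * s (P m.+1)) * x.
  by rewrite -tm -tm1 sE wm.
have s2 : hat (sigma X) (P m) (P m.+1) = del * x.
  have := LsX (P m) (P m.+1); rewrite s1 => /(congr1 (fun z => s (P m) * s (P m.+1) * z)).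
  rewrite mulrN [in RHS]mulrA sgn mul1r => /(congr1 -%R); rewrite opprK => <-.
  by rewrite mulrA mulrCA sgn mulr1 mulNr opprK.
have sX : sigma X = del *: X.
  apply: (hat_inj fr) => a b; rewrite hatZ mxE.
  have [[-> ->]|n1'] := pselect (a = P m /\ b = P m.+1); first exact: s2.
  have [[-> ->]|n2'] := pselect (a = bar (P m.+1) /\ b = bar (P m)).
    by rewrite s1 LXe -/x; ring.
  have -> : hat X a b = 0.
    by apply/eqP; apply: contraT => /supp[].
  rewrite mulr0 -[a]tauK -[b]tauK sE.
  have -> : hat X (tau a) (tau b) = 0; last by rewrite mulr0.
  apply/eqP; apply: contraT => /supp[] [ta tb].
    by case: n2'; rewrite -tm -tm1 -ta -tb !tauK.
  by case: n1'; rewrite -[a]tauK ta -[b]tauK tb -tm -tm1 !tauK.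
by move=> dE; rewrite sX dE; case: ifP => _; rewrite ?scaleN1r ?scale1r.
Qed.

End Vogan.

End Kac.

(** * The affine realization of an inner involution *)

(** The whole algebra L with the simple system x_1, ..., x_n and the lowest root x_0. *)
Section FullChain.
Variables (C : numClosedFieldType) (N : nat).
Local Notation M := 'M[C]_N.
Variables (V : M) (L : {vspace M}) (bar : 'I_N -> 'I_N) (s : 'I_N -> C).
Variables (H : {vspace M}) (wt : 'I_N -> int) (ty : endtype) (n : nat) (P : nat -> 'I_N).
Local Notation hat := (hat V).
Local Notation eps := (eps V).
Local Notation rootv := (rootv V bar s).
Local Notation gam := (gam bar s).
Local Notation xv := (xv V P).
Local Notation hT := (hT V wt).

Hypotheses (fr : frame V L bar s) (HP : diagonal_part V L H) (ch : chain bar s wt ty n P).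
Hypotheses (so : sign_ok bar s ty) (wo : wt_ok wt ty n).
Hypothesis n2 : (if ty is ED then 2 < n else 1 < n)%N.
Hypotheses (tyB : ty <> EB) (lieL : lie_closed L).

Let barK : involutive bar. Proof. by case: fr. Qed.
Let n1 : (1 < n)%N. Proof. exact: chain_gt1 n2. Qed.
Let anyrel (a b : 'I_N) := true.
Let LP : in_class V L anyrel L.
Proof. by move=> X; split=> [LX|[]//]; split. Qed.
Let relP : class_ok bar anyrel. Proof. by []. Qed.
Let wneq0 a : wt a != 0. Proof. by case: (wo a) => _; case: (ty) tyB. Qed.

Lemma full_separated : separated V anyrel H.
Proof.
apply: (chain_separated fr HP ch n1) => a b a0.
by have := wneq0 a; rewrite a0 eqxx.
Qed.

Lemma full_cartan : cartan_subalgebra L H.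
Proof. exact: diag_cartan fr LP relP HP full_separated. Qed.

Lemma full_simple : simple_system L H [set: 'I_n]%SET (fun j => xv j.+1).
Proof.
apply: (simple_system_of_pge fr LP relP HP) => [i _|a a0|a b _ ab gab].
- exists (P i.+1), (P i.+2); have [_ wP winj _ gP] := ch; split=> //; first by apply: gP.
  apply: full_separated => //; apply/eqP => Pi; have := wP i.+1; have := wP i.+2; rewrite Pi => -> //.
    have := ltn_ord i; move: n2 tyB; rewrite /code /=; case: (ty) => // h _ li; last first.
      by case: eqP => ?; case: eqP => ?; lia.
    by case: eqP => ?; case: eqP => ?; lia.
  by have := ltn_ord i; lia.
- pose a' (i : 'I_n.+1) := if unlift ord0 i is Some j then a j else 0.
  have a'0 : a' ord0 = 0 by rewrite /a' unlift_none.
  have a'S j : a' (lift ord0 j) = a j by rewrite /a' liftK.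
  have h : forall i, a' i = 0.
    apply: (chain_indep fr HP ch n1); first by move: n2; case: (ty).
      move=> t Ht; rewrite big_ord_recl a'0 mul0r add0r -[RHS](a0 t Ht).
      by apply: eq_big => [i|i _]; rewrite ?inE // a'S.
    by exists ord0.
  by move=> i _; rewrite -a'S h.
- have stp i : (0 < i <= n)%N -> pge V H [set: 'I_n]%SET (fun j : 'I_n => xv j.+1) (P i) (P i.+1).
    case: i => // i ni; have ni' : (i < n)%N by [].
    by apply: (@pge_step _ _ _ _ _ _ _ (Ordinal ni')); rewrite ?inE.
  have turn : is_true (if ty is ED then b != bar a else true).
    move: (so a); case: (ty) => // sa; apply: contraNneq gab => ->.
    by rewrite /gam eqxx /= mulr1n sa subrr.
  have cov c : in_chain bar ty 1 n P c c.
    left; have [//|] := chain_cover ch wo n2 c.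
    by move: tyB; case: (ty).
  apply: (chain_total fr HP (ty := ty) (lo := 1%N) (n := n) (g := P) (z := P 0)) => //.
  + by move=> k kn; apply: stp; lia.
  + have := stp n; move: (chain_right ch n2) n2 tyB; case: (ty) => // e h _ st.
      by rewrite -e; apply: st; lia.
    by split; [lia|rewrite -e; apply: st; lia].
  + by case: (cov a) => [|]; [left|move: tyB; case: (ty)].
  + by case: (cov b) => [|]; [left|move: tyB; case: (ty)].
Qed.

(** A coweight positive on the simple roots, with coordinates n, ..., 1. *)
Definition rho (k : nat) : int := (n.+1 - k)%N%:Z.

Lemma rho_pos i : (0 < i <= n)%N -> 0 < xz ty n i rho.
Proof.
move=> ni; have [ni'|ni'] := eqVneq i n.
  by rewrite ni' xzn // /rho; move: (n2); case: (ty) => h; lia.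
by rewrite xz_mid; [rewrite /rho; lia|lia].
Qed.

Lemma rho_bound a : [/\ - n%:Z <= ev rho (wt a) <= n%:Z,
   ev rho (wt a) = - n%:Z -> a = bar (P 1) & ev rho (wt a) = n%:Z -> a = P 1].
Proof.
have [wn _] := wo a; have [wbar _ winj _ _] := ch.
have w1 : wt (P 1) = 1 by rewrite (wt_chain ch n2) //; lia.
have wn0 := wneq0 a; move: wn wn0; case wa: (wt a) => [[|k]|k] wn wn0 //.
- rewrite ev_nat // /rho; split; [lia|lia|move=> h].
  by apply: winj; rewrite ?wneq0 // wa w1; lia.
- rewrite NegzE evN ev_nat // /rho; move: wn; rewrite NegzE abszN /= => wn; split; [lia|move=> h|lia].
  by apply: winj; rewrite ?wneq0 // wa wbar w1 NegzE; lia.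
Qed.

(** A bracket of the root vector of x_0 with a negative root vector would have smaller
    height rho than x_0.  For long ends this is below every weight difference.  For
    forks only the coefficient (bar P_1, P_1) lies below, which vanishes because the form
    is symmetric. *)
Lemma full_lowest : lowest_weight L H [set: 'I_n]%SET (fun j => xv j.+1) L (xv 0).
Proof.
exists (rootv (P 0) (P 1)).
have R0 : rootv (P 0) (P 1) \in L by exact: rootv_mem fr _ _.
have wR : weight_space L H (xv 0) (rootv (P 0) (P 1)) by exact: (rootv_weight fr HP R0).
have g0 : gam (P 0) (P 1) != 0 by case: ch => _ _ _ _; exact.
split=> //.
  by apply: contraNneq g0 => R00; rewrite -(rootv_gam fr) R00 hat0 mxE.
move=> j Y _ wY; apply: (hat_inj fr) => a b; rewrite hat0 mxE.
apply/eqP; apply: contraT => Zab; have := Zab => /(lie_entry_neq0 fr)[c].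
have hR a' b' : hat (rootv (P 0) (P 1)) a' b' != 0 ->
    ev rho (wt a') - ev rho (wt b') = xz ty n 0 rho.
  move=> Rab; have := weight_entry fr HP wR Rab (hT_mem fr HP ch rho).
  by rewrite (xv_hT fr ch) // !(eps_hT _ fr) -intrB => /eqP; rewrite eqr_int => /eqP ->.
have hY a' b' : hat Y a' b' != 0 -> ev rho (wt a') - ev rho (wt b') = - xz ty n j.+1 rho.
  move=> Yab; have := weight_entry fr HP wY Yab (hT_mem fr HP ch rho).
  rewrite (xv_hT fr ch) ?(ltn_ord j) // !(eps_hT _ fr) -intrN -intrB => /eqP.
  by rewrite eqr_int => /eqP ->.
have jpos := @rho_pos j.+1 (ltn_ord j).
have low : ev rho (wt a) - ev rho (wt b) < xz ty n 0 rho -> False.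
  have [ba alow _] := rho_bound a; have [bb _ bhigh] := rho_bound b.
  rewrite xz0; last lia.
  move: n2 tyB (so (P 1)); rewrite /rho; case: (ty) => // h _ sP; rewrite -/rho; first by lia.
  move=> lt; have ha : ev rho (wt a) = - n%:Z by lia.
  have hb : ev rho (wt b) = n%:Z by lia.
  move: Zab; rewrite (alow ha) (bhigh hb).
  have LZ : lie Y (rootv (P 0) (P 1)) \in L.
    by apply: lieL => //; case: wY.
  move: LZ; case: fr => _ _ ss sb LPP /LPP/(_ (bar (P 1)) (P 1)).
  rewrite barK [s (bar _) * _]mulrC sP mul1r => /eqP.
  by rewrite -subr_eq0 opprK -mulr2n mulrn_eq0 /= => h0 /eqP; rewrite (eqP h0).
by move=> [[/hY e1 /hR e2]|[/hR e2 /hY e1]]; case: low; lia.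
Qed.

End FullChain.

(** * The matrices *)

Section Monomial.
Variables (C : numClosedFieldType) (N : nat).
Implicit Types (f g : 'I_N -> 'I_N) (w u : 'I_N -> C).

Definition mono f w : 'M[C]_N := \matrix_(a, b) (w b *+ (a == f b)).

Lemma monoM f w g u : mono f w *m mono g u = mono (f \o g) (fun b => w (g b) * u b).
Proof.
apply/matrixP=> a b; rewrite !mxE (bigD1 (g b)) //= !mxE eqxx mulr1n big1 => [|c cg].
  by rewrite addr0 mulrnAl.
by rewrite !mxE (negPf cg) mulr0.
Qed.

Lemma eq_mono f w g u : f =1 g -> w =1 u -> mono f w = mono g u.
Proof. by move=> fg wu; apply/matrixP=> a b; rewrite !mxE fg wu. Qed.

Lemma mono1 : mono id (fun _ => 1) = 1%:M.
Proof. by apply/matrixP=> a b; rewrite !mxE. Qed.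

Lemma tr_mono f w : involutive f -> (mono f w)^T = mono f (fun b => w (f b)).
Proof.
move=> fK; apply/matrixP=> a b; rewrite !mxE [b == _]eq_sym.
have -> : (f a == b) = (a == f b) by rewrite -(inj_eq (inv_inj fK)) fK.
by case: eqP => [->|_]; rewrite ?fK.
Qed.

Lemma adj_mono f w : involutive f -> adj (mono f w) = mono f (fun b => Num.conj (w (f b))).
Proof.
move=> fK; rewrite /adj tr_mono //; apply/matrixP=> a b; rewrite !mxE.
by case: eqP; rewrite ?rmorph0.
Qed.

End Monomial.

(** ** Positions *)

(** C^N, with N = 2 (r + n) and n = 2 m, is decomposed into quarters: a position
    (b, c, j) is the j-th basis vector of the quarter c in the half b, where the form F
    pairs both halves, Q has eigenvalue (-1)^c and W exchanges the quarters.
    In addition there are r hyperbolic planes, one in type D_n with n odd and none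
    otherwise, with positions (b, x). *)
Section Positions.
Variables (r m' : nat).
Local Notation m := m'.+1.
Local Notation n := (m + m)%N.
Local Notation N := ((r + n) + (r + n))%N.

Definition pos := ((bool * 'I_r) + (bool * bool * 'I_m))%type.

Definition enc_half (y : 'I_r + (bool * 'I_m)) : 'I_(r + n) :=
  match y with inl x => lshift n x
  | inr (c, j) => rshift r (if c then rshift m j else lshift m j) end.

Definition enc (p : pos) : 'I_N :=
  let sh (b : bool) i := if b then rshift (r + n) i else lshift (r + n) i in
  match p with inl (b, x) => sh b (enc_half (inl x)) | inr (b, c, j) => sh b (enc_half (inr (c, j))) end.

Definition dec_half (i : 'I_(r + n)) : 'I_r + (bool * 'I_m) :=
  match split i with inl x => inl x
  | inr y => match split y with inl j => inr (false, j) | inr j => inr (true, j) end end.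

Definition dec (a : 'I_N) : pos :=
  let d b i := match dec_half i with inl x => inl (b, x) | inr (c, j) => inr (b, c, j) end in
  match split a with inl i => d false i | inr i => d true i end.

Lemma split_lshift k l (i : 'I_k) : split (lshift l i) = inl i.
Proof. exact: (unsplitK (inl i)). Qed.
Lemma split_rshift k l (i : 'I_l) : split (rshift k i) = inr i.
Proof. exact: (unsplitK (inr i)). Qed.

Lemma enc_halfK : cancel enc_half dec_half.
Proof.
by move=> [x|[[] j]] /=; rewrite /dec_half !(split_lshift, split_rshift).
Qed.

Lemma dec_halfK : cancel dec_half enc_half.
Proof.
move=> i; rewrite -[ i]splitK; case: (split i) => [x|y] /=; rewrite /dec_half.
  by rewrite split_lshift.
rewrite split_rshift -[y]splitK; case: (split y) => j /=.
  by rewrite split_lshift.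
by rewrite split_rshift.
Qed.

Lemma encK : cancel enc dec.
Proof.
by move=> [[[] x]|[[[] c] j]]; rewrite /dec /enc ?split_rshift ?split_lshift enc_halfK.
Qed.

Lemma decK : cancel dec enc.
Proof.
move=> a; rewrite -[a]splitK; case: (split a) => i /=; rewrite /dec ?split_lshift ?split_rshift;
by case: (dec_half i) (dec_halfK i) => [x|[c j]] <-.
Qed.

Lemma enc_inj : injective enc. Proof. exact: can_inj encK. Qed.

Definition lft (f : pos -> pos) (a : 'I_N) : 'I_N := enc (f (dec a)).

Lemma lft_inv f : involutive f -> involutive (lft f).
Proof. by move=> fK a; rewrite /lft encK fK decK. Qed.

Lemma pos_ind (T : 'I_N -> Prop) : (forall p, T (enc p)) -> forall a, T a.
Proof. by move=> h a; rewrite -[a]decK. Qed.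

(** In a plane there are two useful bases: the isotropic one, in which F pairs both
    positions (pbar0), and the orthogonal one, in which F is diagonal (pbar).  The
    matrix Vmx passes from one to the other. *)
Definition pbar (p : pos) : pos :=
  match p with inl y => inl y | inr (b, c, j) => inr (~~ b, c, j) end.
Definition pbar0 (p : pos) : pos :=
  match p with inl (b, x) => inl (~~ b, x) | inr (b, c, j) => inr (~~ b, c, j) end.
Definition ptau (p : pos) : pos :=
  match p with inl (b, x) => inl (~~ b, x) | inr (b, c, j) => inr (b, ~~ c, j) end.
Definition pcol (p : pos) : bool := match p with inl (b, _) => b | inr (_, c, _) => c end.

Lemma pbarK : involutive pbar. Proof. by move=> [[b x]|[[b c] j]] //=; rewrite negbK. Qed.
Lemma pbar0K : involutive pbar0. Proof. by move=> [[b x]|[[b c] j]] //=; rewrite negbK. Qed.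
Lemma ptauK : involutive ptau. Proof. by move=> [[b x]|[[b c] j]] //=; rewrite negbK. Qed.

Variable C : numClosedFieldType.
Variables (e d : C).
Hypotheses (ee : e = 1 \/ e = -1) (er : (0 < r)%N -> e = 1) (dd : d = 1 \/ d = -1).

(** Signs and coefficients of the monomial matrices below: ps and ps0 for the form, in
    the orthogonal and in the isotropic basis, pq for Q, pw for W, pv1 and pv2 for the
    two terms of Vmx.  In the plane, W exchanges the two orthogonal vectors, of squares
    1 and -1; the factor i makes this an isometry when d = 1. *)
Definition ps (p : pos) : C := match p with
  | inl (b, _) => if b then -1 else 1
  | inr (b, _, _) => if b then e else 1 end.
Definition ps0 (p : pos) : C := match p with inl (b, _) | inr (b, _, _) => if b then e else 1 end.
Definition pq (p : pos) : C := if pcol p then -1 else 1.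
Definition pw (p : pos) : C := match p with
  | inl (b, _) => if d == 1 then (if b then - 'i else 'i) else 1
  | inr (b, _, _) => if b then d else 1 end.
Definition pv1 (p : pos) : C := match p with
  | inl (b, _) => if b then - (sqrtC 2)^-1 else (sqrtC 2)^-1 | _ => 1 end.
Definition pv2 (p : pos) : C := if p is inl _ then (sqrtC 2)^-1 else 0.

Definition on (T : Type) (f : pos -> T) (a : 'I_N) := f (dec a).

Definition Vmx : 'M[C]_N := mono (lft id) (on pv1) + mono (lft pbar0) (on pv2).
Definition Fmx : 'M[C]_N := block_mx 0 1%:M (e%:M) 0.
Definition Fhat : 'M[C]_N := mono (lft pbar) (on (ps \o pbar)).
Definition Qhat : 'M[C]_N := mono (lft id) (on pq).
Definition What : 'M[C]_N := mono (lft ptau) (on pw).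

Let two : (2 : C) != 0. Proof. by rewrite pnatr_eq0. Qed.
Let s2 : (sqrtC 2)^-1 * (sqrtC 2)^-1 = 2^-1 :> C.
Proof. by rewrite -invfM -expr2 sqrtCK. Qed.
Let s2r : Num.conj (sqrtC 2)^-1 = (sqrtC 2)^-1 :> C.
Proof. by apply/CrealP/ger0_real; rewrite invr_ge0 sqrtC_ge0 ler0n. Qed.
Let e2 : e * e = 1. Proof. by case: ee => ->; rewrite ?mulrNN mulr1. Qed.
Let d2 : d * d = 1. Proof. by case: dd => ->; rewrite ?mulrNN mulr1. Qed.

Lemma lft_enc f p : lft f (enc p) = enc (f p). Proof. by rewrite /lft encK. Qed.
Lemma on_enc T (f : pos -> T) p : on f (enc p) = f p. Proof. by rewrite /on encK. Qed.

Lemma enc_eq p q : (enc p == enc q) = (p == q). Proof. exact: inj_eq enc_inj _ _. Qed.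

Lemma monoE (f : pos -> pos) (w : pos -> C) p q : mono (lft f) (on w) (enc p) (enc q) = w q *+ (p == f q).
Proof. by rewrite mxE on_enc lft_enc enc_eq. Qed.

Lemma mono_pos (f g : pos -> pos) (w u : pos -> C) :
  mono (lft f) (on w) *m mono (lft g) (on u) = mono (lft (f \o g)) (on (fun q => w (g q) * u q)).
Proof.
rewrite monoM; apply: eq_mono => a; first by rewrite /lft /= encK.
by rewrite /on /lft encK.
Qed.

Lemma pos_matrixP (A B : 'M[C]_N) : (forall p q, A (enc p) (enc q) = B (enc p) (enc q)) -> A = B.
Proof. by move=> h; apply/matrixP; apply: pos_ind => p; apply: pos_ind => q. Qed.

Lemma eq_mono_pos (f g : pos -> pos) (w u : pos -> C) : f =1 g -> w =1 u ->
  mono (lft f) (on w) = mono (lft g) (on u).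
Proof. by move=> fg wu; apply: eq_mono => a; rewrite /lft /on ?fg ?wu. Qed.

Lemma monoZ_pos a (f : pos -> pos) (w : pos -> C) :
  a *: mono (lft f) (on w) = mono (lft f) (on (fun p => a * w p)).
Proof. by apply/matrixP=> i j; rewrite !mxE mulrnAr. Qed.

Lemma mono_pos1 : mono (lft id) (on (fun _ => 1)) = 1%:M :> 'M[C]_N.
Proof. by rewrite -mono1; apply: eq_mono => a //; rewrite /lft decK. Qed.

Lemma tr_mono_pos f (w : pos -> C) : involutive f ->
  (mono (lft f) (on w))^T = mono (lft f) (on (w \o f)).
Proof.
move=> fK; rewrite tr_mono; last exact: lft_inv.
by apply: eq_mono => // a; rewrite /on /lft encK.
Qed.

Lemma adj_mono_pos f (w : pos -> C) : involutive f ->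
  adj (mono (lft f) (on w)) = mono (lft f) (on (fun p => Num.conj (w (f p)))).
Proof.
move=> fK; rewrite adj_mono; last exact: lft_inv.
by apply: eq_mono => // a; rewrite /on /lft encK.
Qed.

Lemma Vsym : Vmx^T = Vmx.
Proof.
rewrite /Vmx linearD /= !tr_mono_pos //; last exact: pbar0K.
by congr (_ + _); apply: eq_mono_pos => // -[[b x]|[[b c] j]].
Qed.

Lemma Vadj : adj Vmx = Vmx.
Proof.
rewrite /Vmx adjD !adj_mono_pos //; last exact: pbar0K.
congr (_ + _); apply: eq_mono_pos => // -[[b x]|[[b c] j]] /=; rewrite ?rmorph1 ?rmorph0 ?s2r //.
by case: b; [rewrite rmorphN; congr (- _)|]; exact: s2r.
Qed.

Lemma VV : Vmx *m Vmx = 1%:M.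
Proof.
rewrite /Vmx mulmxDl !mulmxDr !mono_pos -mono_pos1; apply: pos_matrixP => p q.
rewrite !mxE !on_enc !lft_enc !enc_eq /=.
case: q => [[b x]|[[b c] j]] /=; last first.
  by rewrite negbK !(mulr0, mul0r, mul0rn, addr0, mulr1, mulr0n).
rewrite negbK; case: b => /=; rewrite ?mulrNN ?mulNr ?mulrN s2 ?mulNrn.
  by case: (_ == inl (true, x)); case: (_ == _); rewrite /= ?mulr1n ?mulr0n; field.
by case: (_ == inl (false, x)); case: (_ == _); rewrite /= ?mulr1n ?mulr0n; field.
Qed.

Definition half_of (p : pos) : 'I_r + (bool * 'I_m) :=
  match p with inl (_, x) => inl x | inr (_, c, j) => inr (c, j) end.
Definition side (p : pos) : bool := match p with inl (b, _) | inr (b, _, _) => b end.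

Lemma encE p : enc p =
  if side p then rshift (r + n) (enc_half (half_of p)) else lshift (r + n) (enc_half (half_of p)).
Proof. by case: p => [[[] x]|[[[] c] j]]. Qed.

Lemma half_eq x y : (enc_half x == enc_half y) = (x == y).
Proof. exact/inj_eq/(can_inj enc_halfK). Qed.

Lemma Fmx_mono : Fmx = mono (lft pbar0) (on (ps0 \o pbar0)).
Proof.
apply: pos_matrixP => p q; rewrite monoE !encE /Fmx /=.
have sq q' : ps0 (pbar0 q') = if side q' then 1 else e.
  by case: q' => [[[] x]|[[[] c] j]].
have pq0 p' q' : (p' == pbar0 q') = (side p' == ~~ side q') && (half_of p' == half_of q').
  case: p' q' => [[b x]|[[b c] j]] [[b' x']|[[b' c'] j']] //=; rewrite ?andbF //.
  by apply/eqP/andP=> [[-> -> ->]|[/eqP -> /eqP[-> ->]]]; rewrite ?eqxx.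
rewrite sq pq0; case: (side p); case: (side q) => /=.
- by rewrite block_mxEdr mxE mulr0n.
- by rewrite block_mxEdl mxE half_eq.
- by rewrite block_mxEur mxE half_eq.
- by rewrite block_mxEul mxE mulr0n.
Qed.

Lemma VF : Vmx *m Fhat = Fmx *m Vmx.
Proof.
rewrite Fmx_mono /Vmx /Fhat mulmxDl mulmxDr !mono_pos; apply: pos_matrixP => p q.
rewrite !mxE !on_enc !lft_enc !enc_eq /=.
case: q => [[b x]|[[b c] j]] /=; last by rewrite !(mul0r, mulr0, mul0rn, addr0, mulr1, mul1r).
have -> : e = 1 by apply: er; case: (x) => x0 h; case: (r) h.
rewrite negbK addrC; case: b => /=; rewrite ?(mulr1, mul1r, mulrN, mulNr, opprK) //.
Qed.

Lemma VFV : Vmx *m Fmx *m Vmx = Fhat.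
Proof. by rewrite -mulmxA -VF mulmxA VV mul1mx. Qed.

Lemma FhatE : Vmx *m Fhat *m Vmx = Fmx.
Proof. by rewrite VF -mulmxA VV mulmx1. Qed.

Lemma F_tr : Fmx^T = e *: Fmx.
Proof.
rewrite /Fmx tr_block_mx !trmx0 trmx1 tr_scalar_mx scale_block_mx !scaler0.
by rewrite !scale_scalar_mx e2 mulr1.
Qed.

Lemma F_orth : Fmx^T *m Fmx = 1%:M.
Proof.
rewrite F_tr -scalemxAl /Fmx mulmx_block !(mulmx0, mul0mx, addr0, add0r, mulmx1, mul1mx).
rewrite scale_block_mx !scaler0 !scale_scalar_mx e2.
by rewrite -scalar_mx_block.
Qed.

Lemma e_conj : Num.conj e = e.
Proof. by case: ee => ->; rewrite ?rmorphN rmorph1. Qed.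

Lemma d_conj : Num.conj d = d.
Proof. by case: dd => ->; rewrite ?rmorphN rmorph1. Qed.

Lemma F_real : adj Fmx = Fmx^T.
Proof.
rewrite Fmx_mono adj_mono_pos ?tr_mono_pos //; try exact: pbar0K.
apply: eq_mono_pos => // -[[b x]|[[b c] j]] /=; rewrite negbK; case: b;
by rewrite ?rmorph1 ?e_conj.
Qed.

Definition Vconj (A : 'M[C]_N) := Vmx *m A *m Vmx.

Lemma VconjM A B : Vconj A *m Vconj B = Vconj (A *m B).
Proof. by rewrite /Vconj -!mulmxA (mulmxA Vmx Vmx) VV mul1mx. Qed.

Lemma Vconj_adj A : adj (Vconj A) = Vconj (adj A).
Proof. by rewrite /Vconj !adjM Vadj mulmxA. Qed.

Lemma Vconj_tr A : (Vconj A)^T = Vconj A^T.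
Proof. by rewrite /Vconj !trmx_mul Vsym mulmxA. Qed.

Lemma Vconj1 : Vconj 1%:M = 1%:M.
Proof. by rewrite /Vconj mulmx1 VV. Qed.

Definition Qmx := Vconj Qhat.
Definition Wmx := Vconj What.

Lemma pq2 p : pq p * pq p = 1. Proof. by rewrite /pq; case: ifP; rewrite ?mulrNN mulr1. Qed.

Lemma Q_adj : adj Qmx = Qmx.
Proof.
rewrite /Qmx Vconj_adj /Qhat adj_mono_pos //; congr Vconj; apply: eq_mono_pos => // p.
by rewrite /pq; case: ifP; rewrite ?rmorphN rmorph1.
Qed.

Lemma Q_tr : Qmx^T = Qmx.
Proof. by rewrite /Qmx Vconj_tr /Qhat tr_mono_pos. Qed.

Lemma Q_sq : Qmx *m Qmx = 1%:M.
Proof.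
rewrite /Qmx VconjM /Qhat mono_pos -[RHS]Vconj1; congr Vconj; rewrite -mono_pos1.
by apply: eq_mono_pos => // p; exact: pq2.
Qed.

Lemma Q_form : Qmx^T *m Fmx *m Qmx = Fmx.
Proof.
rewrite Q_tr -FhatE /Qmx -/(Vconj Fhat) !VconjM /Qhat /Fhat !mono_pos; congr Vconj.
apply: eq_mono_pos => //= p; have -> : pq (pbar p) = pq p by case: p => [[b x]|[[b c] j]].
by rewrite mulrAC pq2 mul1r.
Qed.

Lemma pwP p : Num.conj (pw (ptau p)) = pw p /\ pw (ptau p) * pw p = 1.
Proof.
case: p => [[b x]|[[b c] j]] /=; last first.
  by case: b; rewrite ?d_conj ?rmorph1 ?d2 ?mulr1.
case: eqP => _; last by rewrite rmorph1 mulr1.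
have ci : Num.conj (- 'i) = 'i :> C by rewrite rmorphN /= conjCi opprK.
by case: b; rewrite /= ?ci ?conjCi ?mulrN ?mulNr -expr2 sqrCi opprK.
Qed.

Lemma W_adj : adj Wmx = Wmx.
Proof.
rewrite /Wmx Vconj_adj /What adj_mono_pos; last exact: ptauK.
by congr Vconj; apply: eq_mono_pos => // p; case: (pwP p).
Qed.

Lemma W_sq : Wmx *m Wmx = 1%:M.
Proof.
rewrite /Wmx VconjM /What mono_pos -[RHS]Vconj1; congr Vconj; rewrite -mono_pos1.
by apply: eq_mono_pos => [p|p] /=; [rewrite ptauK | case: (pwP p)].
Qed.

Lemma W_anti : Wmx *m Qmx *m Wmx = - Qmx.
Proof.
have VN A : - Vconj A = Vconj (- A) by rewrite /Vconj mulmxN mulNmx.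
rewrite /Qmx /Wmx !VconjM VN; congr Vconj.
rewrite /What /Qhat !mono_pos -scaleN1r monoZ_pos; apply: eq_mono_pos => [p|p] /=; first by rewrite ptauK.
have -> : pq (ptau p) = - pq p.
  by rewrite /pq; case: p => [[[] x]|[[b []] j]] /=; rewrite ?opprK.
by rewrite mulrN mulNr mulN1r mulrAC; case: (pwP p) => _ ->; rewrite mul1r.
Qed.

Lemma W_form : Wmx^T *m Fmx *m Wmx = d *: Fmx.
Proof.
have VZ a A : a *: Vconj A = Vconj (a *: A) by rewrite /Vconj -scalemxAr -scalemxAl.
rewrite /Wmx Vconj_tr -FhatE -/(Vconj Fhat) !VconjM VZ; congr Vconj.
rewrite /What tr_mono_pos; last exact: ptauK.
rewrite /Fhat !mono_pos monoZ_pos.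
apply: eq_mono_pos => [p|p] /=; first by case: p => [[b x]|[[b c] j]] /=; rewrite ?negbK.
case: p => [[b x]|[[b c] j]] /=; last first.
  by case: b; rewrite /= ?mulr1 ?mul1r // mulrC.
case: dd => ->; rewrite ?eqxx.
  by case: b; rewrite /= ?mulr1 ?mul1r ?mulrN ?mulNr ?mulr1 ?mul1r -?expr2 ?sqrCi ?opprK.
have -> : (-1 == 1 :> C) = false.
  by apply/negbTE; rewrite eq_sym -subr_eq0 opprK (_ : 1 + 1 = 2%:R) // pnatr_eq0.
by case: b; rewrite /= ?mulN1r ?mulr1 ?mul1r ?opprK.
Qed.

(** The positions where Q has eigenvalue 1; J0 is the inclusion of their span. *)
Definition cpos (y : 'I_r + (bool * 'I_m)) : pos :=
  match y with inl x => inl (false, x) | inr (c, j) => inr (c, false, j) end.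

Definition J0 : 'M[C]_(N, r + n) := \matrix_(a, i) (a == enc (cpos (dec_half i)))%:R.

Lemma half_ind (T : 'I_(r + n) -> Prop) : (forall y, T (enc_half y)) -> forall i, T i.
Proof. by move=> h i; rewrite -[ i]dec_halfK. Qed.

Lemma J0E p y : J0 (enc p) (enc_half y) = (p == cpos y)%:R.
Proof. by rewrite mxE enc_halfK enc_eq. Qed.

Lemma cpos_inj : injective cpos.
Proof. by move=> [x|[c j]] [x'|[c' j']] //= [] => [->|-> ->]. Qed.

Lemma mulJ0 (A : 'M[C]_N) p y : (A *m J0) (enc p) (enc_half y) = A (enc p) (enc (cpos y)).
Proof.
rewrite mxE (bigD1 (enc (cpos y))) //= mxE enc_halfK eqxx mulr1 big1 ?addr0 // => a.
by rewrite mxE enc_halfK => /negPf ->; rewrite mulr0.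
Qed.

Lemma J0T_mul (A : 'M[C]_(N, r + n)) y z :
  (J0^T *m A) (enc_half y) (enc_half z) = A (enc (cpos y)) (enc_half z).
Proof.
rewrite mxE (bigD1 (enc (cpos y))) //= !mxE enc_halfK eqxx mul1r big1 ?addr0 // => a.
by rewrite !mxE enc_halfK => /negPf ->; rewrite mul0r.
Qed.

Lemma J0_adj : adj J0 = J0^T.
Proof. by apply/matrixP=> a b; rewrite !mxE; case: eqP; rewrite ?rmorph1 ?rmorph0. Qed.

Lemma J0_iso : adj J0 *m J0 = 1%:M.
Proof.
rewrite J0_adj; apply/matrixP; apply: half_ind => y; apply: half_ind => z.
by rewrite J0T_mul J0E mxE (inj_eq cpos_inj) half_eq.
Qed.

Lemma J0_proj : J0 *m adj J0 = 2^-1 *: (1%:M + Qhat).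
Proof.
rewrite J0_adj; apply: pos_matrixP => p q; rewrite mxE.
have -> : \sum_j J0 (enc p) j * J0^T j (enc q) = ((p == q) && ~~ pcol p)%:R.
  have [pc|pc] := boolP (pcol p).
    rewrite andbF big1 // => j _; rewrite -[j]dec_halfK J0E.
    by case: eqP pc => [->|]; [case: (dec_half j) => [x|[c i]] | rewrite mul0r].
  have [y py] : exists y, p = cpos y.
    case: p pc => [[[] x]|[[b []] j]] //= _; [by exists (inl x)|by exists (inr (b, j))].
  rewrite (bigD1 (enc_half y)) //= [_^T _ _]mxE !J0E py eqxx mul1r big1 ?addr0.
    by rewrite andbT eq_sym.
  move=> j; rewrite -[j]dec_halfK half_eq J0E => jy.
  by rewrite (inj_eq cpos_inj) eq_sym (negPf jy) mul0r.
rewrite !mxE on_enc lft_enc !enc_eq /pq; case: eqP => [->|_]; last by rewrite mulr0n addr0 mulr0.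
by case: (pcol q); rewrite /= ?mulr1n; field.
Qed.

Definition F0mx : 'M[C]_(r + n) := block_mx 1%:M 0 0 (block_mx 0 1%:M e%:M 0).

Lemma J0_form : J0^T *m Fhat *m J0 = F0mx.
Proof.
apply/matrixP; apply: half_ind => y; apply: half_ind => z.
rewrite -mulmxA J0T_mul mulJ0 monoE /F0mx /=.
case: y => [x|[c j]]; case: z => [x'|[c' j']]; rewrite /enc_half.
- rewrite block_mxEul mxE; congr (_ *+ _).
- by rewrite block_mxEur mxE.
- by rewrite block_mxEdl mxE.
rewrite block_mxEdr.
by case: c; case: c'; rewrite ?(block_mxEul, block_mxEur, block_mxEdl, block_mxEdr) mxE //=
  -?[inr _ == _]/((_ == _) && (_ == _)) ?mulr0n //.
Qed.

Definition Jmat := Vmx *m J0.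

Lemma J_iso : adj Jmat *m Jmat = 1%:M.
Proof. by rewrite /Jmat adjM Vadj -mulmxA (mulmxA Vmx) VV mul1mx J0_iso. Qed.

Lemma J_proj : Jmat *m adj Jmat = 2^-1 *: (1%:M + Qmx).
Proof.
rewrite /Jmat adjM Vadj mulmxA -(mulmxA Vmx) J0_proj -scalemxAr -scalemxAl.
by rewrite (mulmxDr Vmx 1%:M) (mulmxDl (Vmx *m 1%:M)) mulmx1 VV.
Qed.

Lemma J_form : Jmat^T *m Fmx *m Jmat = F0mx.
Proof.
rewrite /Jmat trmx_mul Vsym -FhatE -!mulmxA (mulmxA Vmx Vmx) VV mul1mx.
by rewrite (mulmxA Vmx Vmx) VV mul1mx mulmxA J0_form.
Qed.

End Positions.

Arguments pbar {r m'} p.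
Arguments pbar0 {r m'} p.
Arguments ptau {r m'} p.
Arguments pcol {r m'} p.
Arguments pq {r m' C} p.
Arguments ps {r m' C} e p.
Arguments ps0 {r m' C} e p.
Arguments pw {r m' C} d p.
Arguments enc {r m'} p : simpl never.
Arguments dec {r m'} a.
Arguments lft {r m'} f a.
Arguments on {r m' T} f a.

(** * The chain of positions *)

Lemma frame_of_form (C : numClosedFieldType) (N : nat) (V F : 'M[C]_N) bar s :
  V^T = V -> V *m V = 1%:M -> V *m F *m V = mono bar (s \o bar) -> involutive bar ->
  (forall a, s a * s a = 1) -> (forall a b, s (bar a) * s (bar b) = s a * s b) ->
  frame V (form_alg F) bar s.
Proof.
move=> Vt VV VF barK ss sb; split=> // X.
have hatT : V *m X^T *m V = (hat V X)^T by rewrite hatE !trmx_mul Vt mulmxA.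
have e1 : (X \in form_alg F) = ((hat V X)^T *m mono bar (s \o bar) + mono bar (s \o bar) *m hat V X == 0).
  rewrite mem_form_alg.
  have -> : (hat V X)^T *m mono bar (s \o bar) + mono bar (s \o bar) *m hat V X =
            V *m (X^T *m F + F *m X) *m V.
    rewrite -hatT -VF hatE mulmxDr mulmxDl.
    by rewrite -!mulmxA !(mulmxA V V) VV !mul1mx.
  apply/eqP/eqP => [->|h]; first by rewrite mulmx0 mul0mx.
  have /(congr1 (fun A => V *m A *m V)) := h.
  by rewrite mulmx0 mul0mx !mulmxA VV mul1mx -mulmxA VV mulmx1.
have entry a b : ((hat V X)^T *m mono bar (s \o bar) + mono bar (s \o bar) *m hat V X) (bar a) b =
    hat V X (bar b) (bar a) * s (bar b) + s (bar a) * hat V X a b.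
  rewrite mxE; congr (_ + _).
    rewrite mxE (bigD1 (bar b)) //= !mxE eqxx mulr1n big1 ?addr0 // => c /negPf cb.
    by rewrite !mxE cb mulr0.
  rewrite mxE (bigD1 a) //= !mxE eqxx mulr1n big1 ?addr0 // => c ca.
  by rewrite !mxE (inj_eq (inv_inj barK)) eq_sym (negPf ca) mul0r.
rewrite e1; split=> [/eqP/matrixP h a b|h].
  have := h (bar a) b; rewrite entry mxE => /eqP; rewrite addr_eq0 => /eqP.
  move=> /(congr1 (fun x => x * s (bar b))); rewrite -mulrA ss mulr1 => ->.
  by rewrite mulNr mulrAC sb.
apply/eqP/matrixP=> a0 b; rewrite -[a0]barK; move: (bar a0) => a; rewrite entry mxE h.
have e2 : s a * s b * s (bar b) = s (bar a) by rewrite -sb -mulrA ss mulr1.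
by rewrite mulNr mulrAC e2 addNr.
Qed.

Section Instances.
Variables (r m' : nat) (C : numClosedFieldType) (e : C) (ty : endtype).
Local Notation m := m'.+1.
Local Notation n := (m + m)%N.
Local Notation N := ((r + n) + (r + n))%N.
Local Notation pos := (pos r m').
Local Notation lft := (@lft r m').
Local Notation on := (@on r m' _).
Local Notation enc := (@enc r m').
Local Notation L := (form_alg (Fmx r m' e)).
Variable (x0 : bool -> pos).

(** C_n: alternating form; D_n with n even: symmetric form; D_n with n odd: symmetric
    form with an additional plane, whose two orthogonal vectors x0 have weight zero. *)
Definition type_ok := match ty with EC => r = 0%N /\ e = -1 | ED => r = 0%N /\ e = 1 /\ (0 < m')%N
  | EB => r = 1%N /\ e = 1 /\ exists x, forall b, x0 b = inl (b, x) end.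
Hypothesis tyH : type_ok.

Lemma type_e : e = 1 \/ e = -1.
Proof. by move: tyH; rewrite /type_ok; case: ty => -[_ h]; [right|left; case: h|left; case: h]. Qed.
Lemma type_er : (0 < r)%N -> e = 1.
Proof. by move: tyH; rewrite /type_ok; case: ty => [[-> _]|[-> _]|[_ [-> _]]]. Qed.

Lemma lft_on (T : Type) (f : pos -> T) (g : pos -> pos) a : on f (lft g a) = on (f \o g) a.
Proof. exact: (congr1 f (encK (g (dec a)))). Qed.

Lemma hat_frame : frame (Vmx r m' C) L (lft pbar) (on (ps e)).
Proof.
have e2 : e * e = 1 by case: type_e => ->; rewrite ?mulrNN mulr1.
apply: frame_of_form; rewrite ?Vsym ?VV //.
- rewrite VFV; last exact: type_er.
  by apply: eq_mono => // a /=; rewrite lft_on.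
- exact/lft_inv/pbarK.
- by apply: pos_ind => -[[[] x]|[[[] c] j]]; rewrite on_enc /= ?mulrNN ?mulr1.
apply: pos_ind => p; apply: pos_ind => q; rewrite !lft_enc !on_enc.
case: p q => [[b x]|[[b c] j]] [[b' x']|[[b' c'] j']] //=;
  have e1 : (0 < r)%N -> e = 1 := type_er.
- rewrite e1; last by case: (r) x => // -[].
  by case: b'; rewrite /= ?mulr1.
- rewrite e1; last by case: (r) x' => // -[].
  by case: b; rewrite /= ?mulr1.
- by case: b b' => -[]; rewrite /= ?mulr1 ?mul1r ?e2.
Qed.

(** The chain runs through the quarter c = 0 of the second half, with weights 1, ..., m,
    and then through the quarter c = 1 of the first half, with weights m + 1, ..., n.  It
    is continued at both ends by the positions at which the diagram turns back. *)
Definition pnum (c : bool) (j : 'I_m) : int := if c then (m.+1 + j)%N%:Z else - (m - j)%N%:Z.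
Definition pwt (p : pos) : int := match p with inl _ => 0
  | inr (b, c, j) => if b then - pnum c j else pnum c j end.
Definition ppos (k : nat) : pos :=
  if (k <= m)%N then inr (true, false, inord (m - k)) else inr (false, true, inord (k - m.+1)).
Definition pchain (k : nat) : pos :=
  if k == 0%N then match ty with EC => pbar (ppos 1) | ED => pbar (ppos 2) | EB => x0 false end
  else if k == n.+1 then match ty with EC => pbar (ppos n) | ED => pbar (ppos n.-1) | EB => x0 true end
  else ppos k.

Lemma inord_lt k : (k <= m')%N -> nat_of_ord (inord k : 'I_m) = k.
Proof. exact: inordK. Qed.

Lemma pwt_bar p : pwt (pbar p) = - pwt p.
Proof. by case: p => [[b x]|[[[] c] j]] /=; rewrite ?oppr0 ?opprK. Qed.

Lemma pwt_pos k : (0 < k <= n)%N -> pwt (ppos k) = k%:Z.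
Proof.
move=> kn; rewrite /ppos /pwt; case: ifP => km; rewrite /pnum inord_lt; lia.
Qed.

Lemma pwt_inj p q : pwt p != 0 -> pwt p = pwt q -> p = q.
Proof.
case: p q => [[b x]|[[b c] j]] [[b' x']|[[b' c'] j']] //=.
- have := ltn_ord j; rewrite /pnum => jm h1 h2; exfalso; move: h1; rewrite h2.
  by rewrite eqxx.
have := ltn_ord j; have := ltn_ord j'; rewrite /pnum => j'm jm _ h.
have [bb cc jj] : [/\ b = b', c = c' & nat_of_ord j = j'].
  by move: h; case: b; case: b'; case: c; case: c' => /=; split=> //; lia.
by rewrite bb cc (val_inj jj : j = j').
Qed.

Lemma pwt_chain k : (k <= n.+1)%N -> pwt (pchain k) = code ty n k.
Proof.
move=> kn; rewrite /pchain /code; case: eqP => [_|k0].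
  move: tyH; rewrite /type_ok; case: ty => [_|[_ [_ m1]]|[_ [_ [x ->]]]] //; by rewrite pwt_bar pwt_pos; lia.
case: eqP => [_|k1]; last by rewrite pwt_pos; lia.
move: tyH; rewrite /type_ok; case: ty => [_|[_ [_ m1]]|[_ [_ [x ->]]]] //; by rewrite pwt_bar pwt_pos; lia.
Qed.

Lemma hat_sign : sign_ok (lft pbar) (on (ps e)) ty.
Proof.
apply: pos_ind => p; rewrite !lft_enc !on_enc; move: tyH; rewrite /type_ok.
case: ty => -[r0 h].
- case: p => [[b x]|[[[] c] j]] /=; rewrite ?h ?mulr1 ?mul1r //.
  by exfalso; move: x; rewrite r0 => -[].
- by case: h => -> _; case: p => [[[] x]|[[[] c] j]] /=; rewrite ?mulrNN mulr1.
- by case: h => -> _; case: p => [[[] x]|[[[] c] j]] /=; rewrite ?mulrNN mulr1.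
Qed.

Lemma gam_sign (bar : 'I_N -> 'I_N) (s : 'I_N -> C) t a b : sign_ok bar s t ->
  (if t is EC then True else b <> bar a) -> gam bar s a b != 0.
Proof.
move=> so ab; rewrite /gam; case: (b =P bar a) => [ba|_]; last by rewrite mulr0n subr0 oner_eq0.
move: (so a) ab; rewrite ba; case: t so => // _ -> _.
by rewrite mulr1n opprK (_ : 1 + 1 = 2%:R) // pnatr_eq0.
Qed.

Lemma hat_chain : chain (lft pbar) (on (ps e)) (on pwt) ty n (enc \o pchain).
Proof.
split.
- by apply: pos_ind => p; rewrite lft_enc !on_enc pwt_bar.
- by move=> k kn /=; rewrite on_enc pwt_chain.
- apply: pos_ind => p; apply: pos_ind => q; rewrite !on_enc => p0 pq.
  by rewrite (pwt_inj p0 pq).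
- apply: pos_ind => p; rewrite on_enc lft_enc; case: p => [//|[[b c] j]] /=.
  by have := ltn_ord j; rewrite /pnum; case: b; case: c; lia.
move=> i ni /=; apply: (gam_sign hat_sign); have := @pwt_chain i (leqW ni); have := @pwt_chain i.+1 ni.
rewrite lft_enc; move: tyH; rewrite /type_ok; case: (ty) => // h h1 h2 /enc_inj hb;
  move: h1; rewrite hb pwt_bar h2 /code.
  by case: h => _ [_ m1]; do ![case: eqP => ?]; lia.
by do ![case: eqP => ?]; lia.
Qed.

Lemma hat_wt : wt_ok (on pwt) ty n.
Proof.
apply: pos_ind => p; rewrite !on_enc; case: p => [[b x]|[[b c] j]] /=; last first.
  have := ltn_ord j; rewrite /pnum => jm; split; first by case: b; case: c; lia.
  by case: ty => //; case: b; case: c; lia.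
split=> //; move: tyH; rewrite /type_ok.
by case: ty => [[r0 _]|[r0 _]|//]; exfalso; move: x; rewrite r0 => -[].
Qed.

Lemma hat_coloured : coloured (lft pbar) (on pwt) m (enc \o pchain) (on pcol).
Proof.
have ccb p : pcol (pbar p) = pcol p by case: p => [[b x]|[[b c] j]].
have cpp k : (0 < k <= n)%N -> pcol (ppos k) = (m < k)%N.
  by move=> kn; rewrite /ppos ltnNge; case: ifP => km /=; rewrite ?km.
split.
- by apply: pos_ind => p; rewrite lft_enc !on_enc.
- move=> k kn /=; rewrite on_enc /pchain; case: eqP => [->|k0].
    move: tyH; rewrite /type_ok; case: ty => [_|[_ [_ m1]]|[_ [_ [x ->]]]] //; by rewrite ccb cpp; lia.
  case: eqP => [->|k1]; last by rewrite cpp; lia.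
  move: tyH; rewrite /type_ok; case: ty => [_|[_ [_ m1]]|[_ [_ [x ->]]]] //=; by rewrite ?ccb ?cpp; lia.
apply: pos_ind => p; apply: pos_ind => q; rewrite !on_enc => wp wq cpq; congr enc.
case: p wp cpq => [[b x] _|[[b c] j]] /=; last first.
  by have := ltn_ord j; rewrite /pnum; case: b; case: c; lia.
case: q wq => [[b' x'] _|[[b' c'] j']] /=; last first.
  by have := ltn_ord j'; rewrite /pnum; case: b'; case: c'; lia.
move=> ->; move: tyH; rewrite /type_ok; case: ty => -[r0 _]; move: x x'; rewrite r0 => x x'.
- by case: x.
- by case: x.
- by rewrite !ord1.
Qed.

Lemma tau_chain k : (k <= n.+1)%N ->
  lft ptau (enc (pchain k)) = lft pbar (enc (pchain (n.+1 - k))).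
Proof.
move=> kn; rewrite !lft_enc; congr enc.
have tb p : ptau (pbar p) = pbar (ptau p) by case: p => [[b x]|[[b c] j]].
have tp i : (0 < i <= n)%N -> ptau (ppos i) = pbar (ppos (n.+1 - i)).
  move=> hi; rewrite /ppos; case: ifP => im; case: ifP => im' /=; try lia.
    by congr (inr (_, _, inord _)); lia.
  by congr (inr (_, _, inord _)); lia.
have p0 : pchain 0 = match ty with EC => pbar (ppos 1) | ED => pbar (ppos 2) | EB => x0 false end by [].
have pn : pchain n.+1 = match ty with EC => pbar (ppos n) | ED => pbar (ppos n.-1) | EB => x0 true end.
  by rewrite /pchain eqxx.
have [->|k0] := eqVneq k 0%N.
  rewrite subn0 p0 pn; move: tyH; rewrite /type_ok; case: ty => [_|[_ [_ m1]]|[_ [_ [x h]]]].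
  - by rewrite tb tp; [congr (pbar (pbar (ppos _))); lia|lia].
  - by rewrite tb tp; [congr (pbar (pbar (ppos _))); lia|lia].
  - by rewrite !h.
have [->|k1] := eqVneq k n.+1.
  rewrite subnn p0 pn; move: tyH; rewrite /type_ok; case: ty => [_|[_ [_ m1]]|[_ [_ [x h]]]].
  - by rewrite tb tp; [congr (pbar (pbar (ppos _))); lia|lia].
  - by rewrite tb tp; [congr (pbar (pbar (ppos _))); lia|lia].
  - by rewrite !h.
rewrite /pchain (negPf k0) (negPf k1).
have -> : (n.+1 - k == 0)%N = false by lia.
have -> : (n.+1 - k == n.+1)%N = false by lia.
by rewrite tp //; lia.
Qed.

End Instances.

Arguments pwt {r m'} p.

(** * The double Vogan diagram of the two conjugations *)

Lemma eigsubP (C : numClosedFieldType) (N : nat) (L : {vspace 'M[C]_N}) f a X :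
  X \in eigsub L f a <-> X \in L /\ f X = a *: X.
Proof.
rewrite memv_cap memv_ker add_lfunE opp_lfunE scale_lfunE id_lfunE subr_eq0.
by split=> [/andP[-> /eqP ->]|[-> ->]] //; rewrite eqxx.
Qed.

Definition diag_sub (C : numClosedFieldType) (N : nat) (L : {vspace 'M[C]_N}) : {vspace 'M[C]_N} :=
  (L :&: <<[seq delta_mx a a | a <- enum 'I_N]>>)%VS.

Lemma diag_subP (C : numClosedFieldType) (N : nat) (L : {vspace 'M[C]_N}) X :
  X \in diag_sub L <-> X \in L /\ forall a b, a != b -> X a b = 0.
Proof.
rewrite memv_cap; split=> [/andP[-> hX]|[-> hX]] /=.
  split=> // a b ab; rewrite (coord_span hX) summxE big1 // => i _.
  have lt_i : (i < size [seq delta_mx a a : 'M[C]_N | a <- enum 'I_N])%N.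
    by rewrite size_map -cardE ltn_ord.
  rewrite mxE; have /mapP[c _ ->] := mem_nth (0 : 'M[C]_N) lt_i.
  rewrite mxE; case: eqP => [ac|_]; last by rewrite mulr0.
  by case: eqP => [bc|_]; rewrite ?mulr0 //; move: ab; rewrite ac bc eqxx.
have -> : X = \sum_a X a a *: delta_mx a a.
  apply/matrixP=> a b; rewrite summxE (bigD1 a) //= big1 => [|c /negPf ca]; last first.
    by rewrite !mxE eq_sym ca mulr0.
  rewrite !mxE eqxx addr0 /=; case: eqP => [->|/eqP ba]; first by rewrite mulr1.
  by rewrite mulr0 hX // eq_sym.
apply: memv_suml => a _; apply: memvZ; apply: memv_span; apply/mapP; exists a => //.
by rewrite mem_enum.
Qed.

Lemma mono_conj (C : numClosedFieldType) (N : nat) (f : 'I_N -> 'I_N) (w : 'I_N -> C) X a b :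
  involutive f -> (mono f w *m X *m mono f w) (f a) (f b) = w a * w (f b) * X a b.
Proof.
move=> fK; rewrite mxE (bigD1 b) //= big1 => [|c cb]; last first.
  rewrite [mono f w c _]mxE fK (negPf cb) mulr0n mulr0 //.
rewrite addr0 [mono f w b _]mxE fK eqxx mulr1n mxE (bigD1 a) //= big1 => [|c ca]; last first.
  by rewrite [mono f w _ c]mxE (inj_eq (inv_inj fK)) eq_sym (negPf ca) mulr0n mul0r.
by rewrite addr0 mxE eqxx mulr1n mulrAC.
Qed.

Section Represented.
Variables (r m' : nat) (C : numClosedFieldType) (e d : C) (ty : endtype).
Local Notation m := m'.+1.
Local Notation n := (m + m)%N.
Local Notation N := ((r + n) + (r + n))%N.
Local Notation pos := (pos r m').
Local Notation lft := (@lft r m').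
Local Notation on := (@on r m' _).
Local Notation enc := (@enc r m').
Local Notation L := (form_alg (Fmx r m' e)).
Local Notation V := (Vmx r m' C).
Variable (x0 : bool -> pos).
Local Notation P := (enc \o pchain ty x0).

Lemma pchain_mid : P m = enc (inr (true, false, inord 0)).
Proof. by rewrite /= /pchain /ppos leqnn subnn; case: eqP => ?; [|case: eqP => ?]; [lia|lia|]. Qed.

Lemma pchain_midS : P m.+1 = enc (inr (false, true, inord 0)).
Proof. by rewrite /= /pchain /ppos ltnn subnn; case: eqP => ?; [|case: eqP => ?]; [lia|lia|]. Qed.

Hypothesis tyH : type_ok e ty x0.
Hypothesis dd : d = 1 \/ d = -1.

Local Notation theta := (cj (Qmx r m' C)).
Local Notation sigma := (cj (Wmx r m' d)).

Let ee := type_e tyH.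
Let er := type_er tyH.
Let fr := hat_frame tyH.
Let ch := hat_chain tyH.
Let m0 : if ty is ED then (1 < m)%N else (0 < m)%N.
Proof. by move: tyH; rewrite /type_ok; case: ty => // -[_ []]. Qed.
Let n1 : (1 < n)%N. Proof. lia. Qed.
Let lieL : lie_closed L. Proof. exact/form_alg_lie/F_orth. Qed.

Lemma hat_theta X a b : hat V (theta X) a b = on pq a * on pq b * hat V X a b.
Proof.
rewrite cjE /Qmx hatE /Vconj !mulmxA VV mul1mx -!(mulmxA _ V V) VV mulmx1.
have -> : Qhat r m' C *m V *m X *m V *m Qhat r m' C = Qhat r m' C *m (V *m X *m V) *m Qhat r m' C.
  by rewrite !mulmxA.
rewrite -(hatE V X) /Qhat; have idE c : lft id c = c by rewrite /lft decK.
by have := @mono_conj C N (lft id) (on pq) (hat V X) a b; rewrite !idE => -> // c; rewrite !idE.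
Qed.

Lemma hat_sigma X a b : hat V (sigma X) (lft ptau a) (lft ptau b) =
  on (pw d) a / on (pw d) b * hat V X a b.
Proof.
rewrite cjE /Wmx hatE /Vconj !mulmxA VV mul1mx -!(mulmxA _ V V) VV mulmx1.
have -> : What r m' d *m V *m X *m V *m What r m' d = What r m' d *m (V *m X *m V) *m What r m' d.
  by rewrite !mulmxA.
rewrite -(hatE V X) /What mono_conj; last exact/lft_inv/ptauK.
congr (_ * _ * _); move: b; apply: pos_ind => p; rewrite lft_enc !on_enc.
have [_ h] := pwP dd p; have w0 : pw d p != 0.
  by apply/eqP => w0; move: h; rewrite w0 mulr0 => /eqP; rewrite eq_sym oner_eq0.
by apply: (mulIf w0); rewrite h mulVf.
Qed.

Variable H : {vspace 'M[C]_N}.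
Local Notation T := (eigsub H theta 1).
Local Notation K := (eigsub L theta 1).
Local Notation Q := (eigsub L theta (-1)).
Hypothesis TP : diagonal_part V L T.

Let on_pq a : on pq a = (if on pcol a then -1 else 1) :> C. Proof. by []. Qed.

Lemma theta_K : in_class V L (rel (on pcol)) K.
Proof.
move=> X; rewrite eigsubP scale1r; split=> -[LX hX]; split=> //.
  move=> a b cab; have := hat_theta X a b; rewrite hX.
  have -> : on pq a * on pq b = -1 :> C.
    move: cab; rewrite /rel !on_pq; case: (on pcol a); case: (on pcol b) => //= _; rewrite ?mulr1 ?mul1r //.
  rewrite mulN1r => /eqP; rewrite -addr_eq0 -mulr2n mulrn_eq0 /= => /eqP //.
apply: (hat_inj fr) => a b; rewrite hat_theta.
have [cab|/hX ->] := boolP (rel (on pcol) a b); last by rewrite mulr0.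
move: cab; rewrite /rel !on_pq => /eqP ->.
by case: (on pcol b); rewrite ?mulrNN !mul1r.
Qed.

Lemma theta_P X : X \in Q <-> X \in L /\ forall a b, on pcol a = on pcol b -> hat V X a b = 0.
Proof.
rewrite eigsubP scaleN1r; split=> -[LX hX]; split=> //.
  move=> a b cab; have := hat_theta X a b; rewrite hX hatN mxE.
  have -> : on pq a * on pq b = 1 :> C.
    by rewrite !on_pq cab; case: (on pcol b); rewrite ?mulrNN mulr1.
  by rewrite mul1r => /eqP; rewrite eq_sym -addr_eq0 -mulr2n mulrn_eq0 /= => /eqP.
apply: (hat_inj fr) => a b; rewrite hat_theta hatN mxE.
have [cab|cab] := eqVneq (on pcol a) (on pcol b); first by rewrite hX // mulr0 oppr0.
by move: cab; rewrite !on_pq; case: (on pcol a); case: (on pcol b) => // _; rewrite ?mulr1 ?mul1r mulN1r.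
Qed.

Let mid : {set 'I_n.+1} := [set i : 'I_n.+1 | val i == m].

(** sigma carries the coefficient (P_m, P_(m+1)) to its mirror, which equals the former
    up to sign on L; together with the weights of W this gives the scalar - d e on the
    root space of the black vertex. *)
Lemma represents (tw : nat) (A : 'I_n.+1 -> 'I_n.+1 -> int) (A' : nat -> nat -> int)
    (c : {set 'I_n.+1}) :
  (forall i j, A i j = A' i j) -> (forall i, A i i = 2) -> chain_cartan ty n A' ->
  @affine_realization (AffineDiagram tw A) C N L theta H (fun i => xv V P i) ->
  (forall i : 'I_n.+1, val i = m -> - d * e = if i \in c then -1 else 1) ->
  @represents_involutions (AffineDiagram tw A) C N L mid c (@rev_ord n.+1) theta sigma.
Proof.
move=> AA A2 AP real hc; exists H, (fun i => xv V P i); split=> //.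
  exact: (kac_main fr TP ch (hat_sign tyH) (hat_wt tyH) (hat_coloured tyH) m0 lieL
    theta_K theta_P AA A2 AP).
have e2 : e * e = 1 by case: ee => ->; rewrite ?mulrNN mulr1.
have coltau a : on pcol (lft ptau a) = ~~ on pcol a.
  by move: a; apply: pos_ind => p; rewrite lft_enc !on_enc; case: p => [[b x]|[[b c'] j]].
have w0 a : on (pw d) a != 0.
  move: a; apply: pos_ind => p; rewrite on_enc.
  have [_ h] := pwP dd p; apply/eqP => w0; move: h; rewrite w0 mulr0 => /eqP.
  by rewrite eq_sym oner_eq0.
have sL X : X \in L -> sigma X \in L.
  apply: mem_cj; [exact: W_sq | exact: W_form | by case: dd => ->; rewrite ?mulrNN mulr1].
have sK X : sigma (sigma X) = X by apply: cjK; exact: W_sq.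
have wm : on (pw d) (P m) / on (pw d) (P m.+1) = - (- d * e) * (on (ps e) (P m) * on (ps e) (P m.+1)).
  by rewrite pchain_mid pchain_midS !on_enc /= divr1 mulr1 !mulNr opprK -mulrA e2 mulr1.
have [v1 v2 v3] := vogan_main fr TP ch (hat_wt tyH) (hat_coloured tyH) m0 theta_K theta_P
   (lft_inv (@ptauK r m')) coltau (tau_chain tyH) w0 sL sK hat_sigma wm hc.
split; [exact: v1 | exact: v2 | move=> i di X; have := v3 i di X].
by case: (boolP (i \in mid)) => _; exact.
Qed.

End Represented.

(** theta acts trivially on the diagonal matrices: T = H and Theta = 1. *)
Section Inner.
Variables (m' : nat) (C : numClosedFieldType) (e : C) (ty : endtype).
Local Notation m := m'.+1.
Local Notation n := (m + m)%N.
Local Notation r := 0%N.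
Local Notation N := ((r + n) + (r + n))%N.
Local Notation pos := (pos r m').
Local Notation lft := (@lft r m').
Local Notation on := (@on r m' _).
Local Notation enc := (@enc r m').
Local Notation L := (form_alg (Fmx r m' e)).
Local Notation V := (Vmx r m' C).
Variable (x0 : bool -> pos).
Hypotheses (tyH : type_ok e ty x0) (tyB : ty <> EB).

Local Notation P := (enc \o pchain ty x0).
Local Notation theta := (cj (Qmx r m' C)).

Let fr := hat_frame tyH.
Let ch := hat_chain tyH.
Let n2 : (if ty is ED then 2 < n else 1 < n)%N.
Proof. by move: tyH; rewrite /type_ok; case: ty => // -[_]; lia. Qed.
Let n1 : (1 < n)%N. Proof. lia. Qed.
Let lieL : lie_closed L. Proof. exact: form_alg_lie (F_orth _ _ (type_e tyH)). Qed.

Lemma Vmx_inner : V = 1%:M.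
Proof.
rewrite -mono_pos1; apply: pos_matrixP => p q; rewrite !mxE !on_enc !lft_enc !enc_eq.
by case: q => [[b []]|[[b c] j]] //=; rewrite mul0rn addr0.
Qed.

Lemma hat_inner X : hat V X = X.
Proof. by rewrite hatE Vmx_inner mul1mx mulmx1. Qed.

Local Notation H := (diag_sub L).

Lemma inner_diag : diagonal_part V L H.
Proof. by move=> h; rewrite diag_subP hat_inner. Qed.

Lemma theta_diag h : h \in H -> theta h = h.
Proof.
move=> /diag_subP[_ hd]; apply: (hat_inj fr) => a b; rewrite hat_theta !hat_inner.
have [<-|ab] := eqVneq a b; last by rewrite hd ?mulr0.
by rewrite [_ * on pq a]pq2 mul1r.
Qed.

Lemma inner_T : eigsub H theta 1 = H.
Proof.
apply/vspaceP=> h; apply/idP/idP => [/eigsubP[]//|Hh]; apply/eigsubP.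
by rewrite scale1r theta_diag.
Qed.

Lemma inner_T_diag : diagonal_part V L (eigsub H theta 1).
Proof. by rewrite inner_T; exact: inner_diag. Qed.

Lemma inner_realization (A : 'I_n.+1 -> 'I_n.+1 -> int) (A' : nat -> nat -> int) :
  (forall i j, A i j = A' i j) -> (forall i, A i i = 2) -> chain_cartan ty n A' ->
  @affine_realization (AffineDiagram 1 A) C N L theta H (fun i => xv V P i).
Proof.
move=> AA A2 AP; have HP := inner_diag.
exists n, (fun j : 'I_n => xv V P j.+1), 1%g, \1%VF,
  (fun j : 'I_n => rootv V (lft pbar) (on (ps e)) (P j.+1) (P j.+2)).
move=> T; have -> : T = H by exact: inner_T.
have thH : (theta @: H)%VS = H.
  apply/vspaceP=> h; apply/memv_imgP/idP => [[k Hk ->]|Hh]; first by rewrite theta_diag.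
  by exists h; rewrite ?theta_diag.
split.
- split=> //.
  + exact: full_cartan fr HP ch (hat_wt tyH) n2 tyB.
  + exact: full_simple fr HP ch (hat_sign tyH) (hat_wt tyH) n2 tyB.
  + by move=> i h Hh; rewrite perm1 theta_diag.
  + exact: order1.
- split.
  + split=> [|X Y _ _]; last by rewrite !id_lfunE.
    by apply/vspaceP=> X; rewrite lim1g.
  + by move=> h Hh; rewrite id_lfunE theta_diag.
  + move=> i; rewrite perm1 id_lfunE; split=> //.
      by apply: (rootv_weight fr HP); [exact: rootv_mem fr _ _|].
    have [_ _ _ _ g0] := ch; have := g0 i.+1 (ltn_ord i); apply: contraNneq => R0.
    by rewrite -(rootv_gam fr) R0 hat0 mxE.
- move=> [[|i] //= ni] _; by exists (Ordinal (ni : (i < n)%N)).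
- move=> j; by exists (lift ord0 j : 'I_n.+1).
split; last first.
  apply: (chain_has_cartan fr HP ch n1 AA A2 AP) => i _.
  by split; exact: rootv_mem fr _ _.
move=> [[|i] //= ni] _; have idL (a : C) : eigsub L \1%VF 1 = L.
  apply/vspaceP=> X; apply/idP/idP => [/eigsubP[]//|LX]; apply/eigsubP.
  by rewrite id_lfunE scale1r.
rewrite expr0 idL //; exact: full_lowest fr HP ch (hat_sign tyH) (hat_wt tyH) n2 tyB lieL.
Qed.

End Inner.

(** * The affine realization of an outer involution *)

(** With an additional plane, Q exchanges its two isotropic vectors.  The diagonal
    matrices of L in the isotropic basis form a Cartan subalgebra H, of type D_(n+1),
    on which theta changes the sign of the last coordinate.  So theta exchanges the
    two branches of the fork at the end of the Dynkin diagram, and T is the part of H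
    where the last coordinate vanishes; there the orthogonal basis applies as well. *)
Section Outer.
Variables (m' : nat) (C : numClosedFieldType).
Local Notation m := m'.+1.
Local Notation n := (m + m)%N.
Local Notation r := 1%N.
Local Notation N := ((r + n) + (r + n))%N.
Local Notation pos := (pos r m').
Local Notation lft := (@lft r m').
Local Notation on := (@on r m' _).
Local Notation enc := (@enc r m').
Local Notation e := (1 : C).
Local Notation L := (form_alg (Fmx r m' e)).
Local Notation V := (Vmx r m' C).
Local Notation M := 'M[C]_N.

Definition zpos (b : bool) : pos := inl (b, ord0).

Lemma outer_type : type_ok e EB zpos.
Proof. by split=> //; split=> //; exists ord0. Qed.

Let tyH := outer_type.
Local Notation P := (enc \o pchain EB zpos).
Local Notation theta := (cj (Qmx r m' C)).

Let fr := hat_frame tyH.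
Let ch := hat_chain tyH.
Let n1 : (1 < n)%N. Proof. lia. Qed.
Let ee : e = 1 \/ e = -1. Proof. by left. Qed.

(** The chain of D_(n+1) in the isotropic basis; the vector zpos false has weight n + 1. *)
Definition pwt0 (p : pos) : int := match p with
  | inl (b, _) => if b then - n.+1%:Z else n.+1%:Z
  | inr _ => pwt p end.
Definition pchain0 (k : nat) : pos :=
  if k == 0%N then pbar0 (ppos r m' 2) else if k == n.+1 then zpos false
  else if k == n.+2 then pbar0 (ppos r m' n) else ppos r m' k.
Local Notation P0 := (enc \o pchain0).

Lemma frame0 : frame 1%:M L (lft pbar0) (on (ps0 e)).
Proof.
apply: frame_of_form; rewrite ?trmx1 ?mulmx1 //.
- rewrite mul1mx Fmx_mono; apply: eq_mono => // a /=; by rewrite lft_on.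
- exact/lft_inv/pbar0K.
- by apply: pos_ind => -[[[] x]|[[[] c] j]]; rewrite on_enc /= mulr1.
apply: pos_ind => p; apply: pos_ind => q; rewrite !lft_enc !on_enc.
by case: p q => [[[] x]|[[[] c] j]] [[[] x']|[[[] c'] j']].
Qed.

Lemma hat_one (X : M) : hat 1%:M X = X.
Proof. by rewrite hatE mul1mx mulmx1. Qed.

Lemma sign0 : sign_ok (lft pbar0) (on (ps0 e)) ED.
Proof.
apply: pos_ind => p; rewrite lft_enc !on_enc.
by case: p => [[[] x]|[[[] c] j]]; rewrite /= mulr1.
Qed.

Lemma pwt0_bar p : pwt0 (pbar0 p) = - pwt0 p.
Proof. by case: p => [[[] x]|[[[] c] j]] //=; rewrite ?opprK. Qed.

Lemma pwt_bound b c (j : 'I_m) : (0 < `|pwt (inr (b, c, j) : pos)| <= n)%N.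
Proof. by have := ltn_ord j; rewrite /= /pnum; case: b; case: c; lia. Qed.

Lemma pwt0_pos k : (0 < k <= n)%N -> pwt0 (ppos r m' k) = k%:Z.
Proof. by move=> kn; rewrite -(pwt_pos r kn) /ppos; case: ifP. Qed.

Lemma chain0 : chain (lft pbar0) (on (ps0 e)) (on pwt0) ED n.+1 P0.
Proof.
have wP k : (k <= n.+2)%N -> pwt0 (pchain0 k) = code ED n.+1 k.
  move=> kn; rewrite /pchain0 /code; case: eqP => [_|k0].
    by rewrite pwt0_bar pwt0_pos.
  case: (k =P n.+1) => [->|k1]; first by rewrite ltn_eqF.
  case: eqP => [_|k2]; first by rewrite pwt0_bar pwt0_pos // leqnn andbT.
  by rewrite pwt0_pos //; lia.
split.
- by apply: pos_ind => p; rewrite lft_enc !on_enc pwt0_bar.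
- by move=> k kn /=; rewrite on_enc wP.
- apply: pos_ind => p; apply: pos_ind => q; rewrite !on_enc => p0 pq; congr enc.
  case: p q p0 pq => [[b x]|[[b c] j]] [[b' x']|[[b' c'] j']] p0.
  + by rewrite /= !ord1; case: b p0; case: b' => //; lia.
  + by move=> h; exfalso; have := pwt_bound b' c' j'; move: h => /= <-; case: b {p0}; lia.
  + by move=> h; exfalso; have := pwt_bound b c j; move: h => /= ->; case: b'; lia.
  + exact: pwt_inj.
- apply: pos_ind => p; rewrite on_enc => p0; exfalso.
  case: p p0 => [[[] x]|[[b c] j]] /= h; try lia.
  by have := pwt_bound b c j; rewrite /= h.
move=> i ni /=; apply: (gam_sign sign0); have := @wP i (leqW ni); have := @wP i.+1 ni.
rewrite lft_enc => h1 h2 /enc_inj hb; move: h1; rewrite hb pwt0_bar h2 /code.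
by do ![case: eqP => ?]; lia.
Qed.

Lemma wt0 : wt_ok (on pwt0) ED n.+1.
Proof.
apply: pos_ind => p; rewrite !on_enc; case: p => [[[] x]|[[b c] j]] //=; try by split; lia.
by have := pwt_bound b c j; rewrite /=; split; lia.
Qed.

(** The reflection Rmx exchanging the two isotropic vectors gives Theta.  It is
    diagonal in the orthogonal basis, with coefficients prh. *)
Definition pref (p : pos) : pos := match p with inl (b, x) => inl (~~ b, x) | _ => p end.
Definition prh (p : pos) : C := if p is inl (true, _) then -1 else 1.
Definition pqo (p : pos) : C := if p is inr (_, true, _) then -1 else 1.
Definition Rmx : M := mono (lft pref) (on (fun _ => 1)).

Lemma prefK : involutive pref. Proof. by move=> [[b x]|q] //=; rewrite negbK. Qed.

Lemma RV : Rmx *m V = V *m mono (lft id) (on prh).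
Proof.
rewrite /Rmx /Vmx !mulmxDr mulmxDl !mono_pos; apply: pos_matrixP => p q.
rewrite !mxE !on_enc !lft_enc !enc_eq /=; case: q => [[b x]|[[b c] j]] /=.
  by rewrite !mul1r addrC negbK; case: b; rewrite /= ?(mulN1r, mulrN1, mulr1, mul1r, opprK).
by rewrite !(mul1r, mulr1, mul0r, mul0rn).
Qed.

Lemma Rmx_hat : Rmx = Vconj (mono (lft id) (on prh)).
Proof. by rewrite /Vconj -RV -mulmxA VV mulmx1. Qed.

Lemma Qmx_orig : Qmx r m' C = mono (lft pref) (on pqo).
Proof.
have QV : mono (lft pref) (on pqo) *m V = V *m Qhat r m' C.
  rewrite /Qhat /Vmx !mulmxDr mulmxDl !mono_pos; apply: pos_matrixP => p q.
  rewrite !mxE !on_enc !lft_enc !enc_eq /=; case: q => [[b x]|[[b c] j]] /=.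
    by rewrite !mul1r addrC negbK /pq; case: b; rewrite /= ?(mulN1r, mulrN1, mulr1, mul1r, opprK).
  by rewrite /pq /= !(mul1r, mulr1, mulr0, mul0r, mul0rn, addr0); case: c.
by rewrite /Qmx /Vconj -QV -mulmxA VV mulmx1.
Qed.

Local Notation Theta := (cj Rmx).

Lemma ThetaE X a b : Theta X (lft pref a) (lft pref b) = X a b.
Proof.
rewrite cjE mono_conj; last exact/lft_inv/prefK.
by rewrite !mul1r.
Qed.

Lemma hat_Theta X a b : hat V (Theta X) a b = on prh a * on prh b * hat V X a b.
Proof.
rewrite cjE Rmx_hat hatE /Vconj !mulmxA VV mul1mx -!(mulmxA _ V V) VV mulmx1.
set R := mono _ _; have -> : R *m V *m X *m V *m R = R *m (V *m X *m V) *m R by rewrite !mulmxA.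
rewrite -(hatE V X) /R; have idE c : lft id c = c by exact: decK.
by have := @mono_conj C N (lft id) (on prh) (hat V X) a b; rewrite !idE => -> // c; rewrite !idE.
Qed.

Lemma theta_orig X a b : theta X (lft pref a) (lft pref b) = on pqo a * on pqo (lft pref b) * X a b.
Proof. by rewrite cjE Qmx_orig mono_conj //; exact/lft_inv/prefK. Qed.

Lemma Rmx_sq : Rmx *m Rmx = 1%:M.
Proof.
rewrite /Rmx mono_pos -mono_pos1; apply: eq_mono_pos => p /=; first by rewrite prefK.
by rewrite mulr1.
Qed.

Lemma Rmx_form : Rmx^T *m Fmx r m' e *m Rmx = 1 *: Fmx r m' e.
Proof.
rewrite scale1r /Rmx tr_mono_pos; last exact: prefK.
rewrite Fmx_mono !mono_pos; apply: eq_mono_pos => [] [[b x]|[[b c] j]] //=; rewrite ?negbK ?mulr1 ?mul1r //.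
by case: b.
Qed.

Local Notation H := (diag_sub L).
Local Notation T := (eigsub H theta 1).

Lemma diag0 : diagonal_part 1%:M L H.
Proof. by move=> h; rewrite diag_subP hat_one. Qed.

Lemma eps_theta h a : h \in H -> theta h (lft pref a) (lft pref a) = h a a.
Proof.
move=> Hh; rewrite theta_orig; have -> : on pqo a * on pqo (lft pref a) = 1.
  move: a; apply: pos_ind => p; rewrite lft_enc !on_enc.
  by case: p => [[b x]|[[b []] j]]; rewrite /= ?mulrNN mulr1.
by rewrite mul1r.
Qed.

Lemma theta_Theta h : h \in H -> Theta h = theta h.
Proof.
move=> Hh; have [_ hd] := (diag_subP _ _).1 Hh.
apply/matrixP=> a b; rewrite -[a](lft_inv prefK) -[b](lft_inv prefK).
move: (lft pref a) (lft pref b) => {}a {}b.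
have [<-|ab] := eqVneq a b; first by rewrite ThetaE eps_theta.
by rewrite ThetaE theta_orig hd // mulr0.
Qed.

(** A diagonal matrix that vanishes on the plane has the same coefficients in both
    bases. *)
Lemma Vfix (k : M) : (forall a b, a != b -> k a b = 0) -> (forall b, k (enc (zpos b)) (enc (zpos b)) = 0) ->
  hat V k = k.
Proof.
move=> kd kz; have Vk : V *m k = k.
  apply: pos_matrixP => p q; rewrite mxE (bigD1 (enc q)) //= big1 => [|c cq]; last first.
    by rewrite kd ?mulr0.
  rewrite addr0 !mxE !on_enc !lft_enc !enc_eq; case: q => [[b x]|[[b c] j]] /=.
    rewrite (ord1 x) kz mulr0; have [->|pb] := eqVneq p (zpos b); first by rewrite kz.
    by apply/esym/kd; rewrite enc_eq.
  rewrite mul0rn addr0; have [->|pb] := eqVneq p _; first by rewrite mulr1n mul1r.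
  by rewrite mulr0n mul0r; apply/esym/kd; rewrite enc_eq.
have kt : k^T = k.
  apply/matrixP=> a b; rewrite mxE; have [->//|ab] := eqVneq a b.
  by rewrite !kd // eq_sym.
by rewrite hatE Vk -[k in k *m _]kt -[V]trmxK -trmx_mul Vsym Vk kt.
Qed.

Lemma lft_pref_z b : lft pref (enc (zpos b)) = enc (zpos (~~ b)).
Proof. by rewrite lft_enc. Qed.

Lemma T_zero (h : M) b : h \in T -> h (enc (zpos b)) (enc (zpos b)) = 0.
Proof.
move=> /eigsubP[Hh]; rewrite scale1r => th; have [Lh _] := (diag_subP _ _).1 Hh.
have := eps_theta (enc (zpos b)) Hh; rewrite th lft_pref_z => h1.
have := eps_bar frame0 (enc (zpos b)) Lh; rewrite /eps !hat_one lft_enc /= h1 => /eqP.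
by rewrite -addr_eq0 -mulr2n mulrn_eq0 /= => /eqP.
Qed.

Lemma T_hat h : h \in T -> hat V h = h.
Proof.
move=> Th; have /eigsubP[/diag_subP[_ hd] _] := Th.
by apply: Vfix => // b; exact: T_zero.
Qed.

Lemma outer_diag : diagonal_part V L T.
Proof.
move=> h; split=> [Th|[Lh hd]].
  by rewrite T_hat //; have /eigsubP[/diag_subP[]] := Th.
have hz b : hat V h (enc (zpos b)) (enc (zpos b)) = 0.
  have := eps_bar fr (enc (zpos b)) Lh; rewrite /eps lft_enc /= => /eqP.
  by rewrite -addr_eq0 -mulr2n mulrn_eq0 /= => /eqP.
have hh : h = hat V h by rewrite -{1}(hatK fr h) Vfix.
have Hh : h \in H by apply/diag_subP; split=> //; rewrite hh.
apply/eigsubP; split=> //; rewrite scale1r; apply: (hat_inj fr) => a b.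
rewrite hat_theta; have [<-|ab] := eqVneq a b; last by rewrite hd // mulr0.
by rewrite [_ * on pq a]pq2 mul1r.
Qed.

Lemma eps_hat a h : h \in T -> eps V a h = h a a.
Proof. by move=> Th; rewrite /eps T_hat. Qed.

Lemma P_mid k : (0 < k <= n)%N -> P k = enc (ppos r m' k) /\ P0 k = enc (ppos r m' k).
Proof.
move=> kn; have k0 : (k == 0%N) = false by lia.
have k1 : (k == n.+1) = false by lia.
have k2 : (k == n.+2) = false by lia.
by rewrite /= /pchain /pchain0 k0 k1 k2.
Qed.

Lemma pref_mid k : (0 < k <= n)%N ->
  lft pref (P0 k) = P0 k /\ lft pref (lft pbar0 (P0 k)) = lft pbar0 (P0 k).
Proof.
move=> kn; have [_ ->] := P_mid kn; rewrite !lft_enc.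
by rewrite /ppos; case: ifP.
Qed.

Lemma P0_z : P0 n.+1 = enc (zpos false).
Proof. by rewrite /= /pchain0 eqxx. Qed.

Lemma P0_last : P0 n.+2 = lft pbar0 (P0 n).
Proof.
have [_ ->] := @P_mid n (leqnn _); rewrite lft_enc /= /pchain0.
by case: eqP => ?; [lia|case: eqP => ?; [lia|rewrite eqxx]].
Qed.

Local Notation b0 := (fun j : 'I_n.+1 => xv 1%:M P0 j.+1).
(** The last root vector is written with zpos true instead of bar zpos false, so that
    Theta permutes these vectors without signs. *)
Definition rv0 (j : 'I_n.+1) : M :=
  if j == n :> nat then rootv 1%:M (lft pbar0) (on (ps0 e)) (P0 n) (enc (zpos true))
  else rootv 1%:M (lft pbar0) (on (ps0 e)) (P0 j.+1) (P0 j.+2).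
Definition fork : {perm 'I_n.+1} := tperm (inord n.-1) ord_max.

Lemma xv0_T j h : h \in T -> (j < n)%N -> xv 1%:M P0 j.+1 h = xv V P j.+1 h.
Proof.
move=> Th jn; rewrite /xv !eps_hat // /eps !hat_one.
have [-> ->] := @P_mid j.+1 jn; congr (_ - _).
have [jn'|jn'] := ltnP j.+1 n; first by have [-> ->] := @P_mid j.+2 jn'.
have -> : j.+2 = n.+1 by lia.
rewrite P0_z T_zero //.
have -> : P n.+1 = enc (zpos true) by rewrite /= /pchain eqxx.
by rewrite T_zero.
Qed.

Lemma xv0_last h : h \in T -> xv 1%:M P0 n.+1 h = xv V P n h.
Proof.
move=> Th; have /eigsubP[/diag_subP[Lh _] _] := Th.
rewrite /xv P0_z P0_last (eps_bar frame0) // opprK !eps_hat // /eps !hat_one.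
have [-> ->] := @P_mid n (leqnn _).
have -> : P n.+1 = enc (zpos true) by rewrite /= /pchain eqxx.
by rewrite !T_zero // add0r subr0.
Qed.

Lemma Theta_rootv a b : Theta (rootv 1%:M (lft pbar0) (on (ps0 e)) a b) =
  rootv 1%:M (lft pbar0) (on (ps0 e)) (lft pref a) (lft pref b).
Proof.
have fK := lft_inv prefK; apply/matrixP=> i j; rewrite -[ i]fK -[j]fK ThetaE.
move: (lft pref i) (lft pref j) => {}i {}j.
have rE x y : rootv 1%:M (lft pbar0) (on (ps0 e)) x y =
    delta_mx x y - (on (ps0 e) x * on (ps0 e) y) *: delta_mx (lft pbar0 y) (lft pbar0 x).
  by rewrite /rootv hat_one.
rewrite !rE !mxE.
have pb x : lft pbar0 (lft pref x) = lft pref (lft pbar0 x).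
  by move: x; apply: pos_ind => p; rewrite !lft_enc; case: p => [[c x]|[[c c'] j']].
rewrite !pb !(inj_eq (inv_inj fK)).
have s1 x : on (ps0 e) x = 1 by rewrite -[LHS]/(ps0 _ (dec x)); case: (dec x) => [[[] y]|[[[] y] y']].
by rewrite !s1.
Qed.

Lemma rv0_weight j : weight_space L H (b0 j) (rv0 j) /\ rv0 j != 0.
Proof.
have [wb wP winj wz g0] := chain0.
rewrite /rv0; case: eqP => jn; split.
- apply: (rootv_weight frame0 diag0); first exact: rootv_mem frame0 _ _.
  move=> h /diag_subP[Lh _]; rewrite /xv jn P0_z P0_last.
  rewrite (eps_bar frame0) // opprK addrC; congr (_ + _).
  have -> : enc (zpos true) = lft pbar0 (enc (zpos false)) by rewrite lft_enc.
  by rewrite (eps_bar frame0) // opprK.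
- apply/eqP => R0; have := rootv_gam frame0 (P0 n) (enc (zpos true)); rewrite R0 hat0 mxE.
  apply/eqP; rewrite eq_sym; apply: (gam_sign sign0).
  have [_ ->] := @P_mid n (leqnn _); rewrite lft_enc => /enc_inj.
  by rewrite /ppos; case: ifP.
- apply: (rootv_weight frame0 diag0); first exact: rootv_mem frame0 _ _.
  by [].
- have := g0 j.+1 (ltn_ord j); apply: contraNneq => R0.
  by rewrite -(rootv_gam frame0) R0 hat0 mxE.
Qed.

Lemma fork_eq (j : 'I_n.+1) : nat_of_ord (fork j) =
  if j == n :> nat then n.-1 else if j == n.-1 :> nat then n else j.
Proof.
have i1 : nat_of_ord (inord n.-1 : 'I_n.+1) = n.-1 by apply: inordK; lia.
rewrite /fork; case: tpermP => [->|->|/eqP h1 /eqP h2] /=.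
- by rewrite i1 eqxx; case: eqP => //; lia.
- by rewrite eqxx i1.
have e1 : (nat_of_ord j == n) = false by apply: contraNF h2 => /eqP h; apply/eqP/val_inj.
have e2 : (nat_of_ord j == n.-1) = false.
  by apply: contraNF h1 => /eqP h; apply/eqP/val_inj; rewrite /= i1.
by rewrite e1 e2.
Qed.

Lemma Theta_rv0 j : Theta (rv0 j) = rv0 (fork j).
Proof.
have fj : nat_of_ord (fork j) = _ := fork_eq j; have jn := ltn_ord j.
have Pz : lft pref (enc (zpos true)) = P0 n.+1 by rewrite lft_pref_z P0_z.
have np : n.-1.+1 = n by lia.
have [fn _] := @pref_mid n (leqnn _).
rewrite /rv0 fj; case: (nat_of_ord j =P n) => [jE|jE].
  have -> : (n.-1 == n) = false by lia.
  by rewrite Theta_rootv Pz fn np.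
case: (nat_of_ord j =P n.-1) => [jE'|jE'].
  have jS : (nat_of_ord j).+1 = n by rewrite jE' np.
  by rewrite eqxx Theta_rootv !jS P0_z lft_pref_z fn.
have -> : (nat_of_ord j == n) = false by apply/eqP.
have [f1 _] := @pref_mid j.+1 ltac:(lia); have [f2 _] := @pref_mid j.+2 ltac:(lia).
by rewrite Theta_rootv f1 f2.
Qed.

Lemma b0_theta j h : h \in H -> b0 j (theta h) = b0 (fork j) h.
Proof.
move=> Hh; have [Lh hd] := (diag_subP _ _).1 Hh.
have E a : eps 1%:M a (theta h) = eps 1%:M (lft pref a) h.
  by rewrite /eps !hat_one -{1 2}[a](lft_inv prefK) eps_theta.
have jn := ltn_ord j; have np : n.-1.+1 = n by lia.
have [fn fbn] := @pref_mid n (leqnn _).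
have zz : eps 1%:M (lft pref (P0 n.+1)) h = - eps 1%:M (P0 n.+1) h.
  by rewrite -(eps_bar frame0) // P0_z !lft_enc.
rewrite /xv !E fork_eq; case: (nat_of_ord j =P n) => [jE|jE].
  rewrite jE.
  rewrite np zz P0_last fbn.
  by rewrite (eps_bar frame0) // opprK addrC.
case: (nat_of_ord j =P n.-1) => [jE'|jE'].
  rewrite jE'.
  rewrite np zz fn.
  by rewrite P0_last (eps_bar frame0) // !opprK addrC.
have [f1 _] := @pref_mid j.+1 ltac:(lia); have [f2 _] := @pref_mid j.+2 ltac:(lia).
by rewrite f1 f2.
Qed.

Lemma theta_H : (theta @: H)%VS = H.
Proof.
have tt h : theta (theta h) = h by apply: cjK; exact: Q_sq.
have Lt h : h \in L -> theta h \in L.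
  by apply: (mem_cj (Q_sq _ _ _) (d := 1)); rewrite ?mulr1 // scale1r Q_form.
have Ht h : h \in H -> theta h \in H.
  move=> /diag_subP[Lh hd]; apply/diag_subP; split; first exact: Lt.
  move=> a b ab; rewrite -[a](lft_inv prefK) -[b](lft_inv prefK) theta_orig hd ?mulr0 //.
  by rewrite (inj_eq (inv_inj (lft_inv prefK))).
apply/vspaceP=> h; apply/memv_imgP/idP => [[k Hk ->]|Hh]; first exact: Ht.
by exists (theta h); rewrite ?Ht ?tt.
Qed.

Lemma Theta_eigen (X : M) a : X \in eigsub L Theta a ->
  forall i j, hat V X i j != 0 -> on prh i * on prh j = a.
Proof.
move=> /eigsubP[_ TX] i j Xij; apply: (mulIf Xij).
by rewrite -hat_Theta TX hatZ mxE.
Qed.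

(** The (-1)-eigenspace of Theta consists of the matrices whose coefficients join the
    odd vector of the plane to the other positions, so its weights are bounded by the
    height n of the first position; x_0 = - t_1 attains this bound. *)
Lemma outer_lowest :
  lowest_weight (eigsub L Theta 1) T [set: 'I_n.+1]%SET b0 (eigsub L Theta (-1)) (xv V P 0).
Proof.
pose v := rootv V (lft pbar) (on (ps e)) (P n.+1) (P 1).
have Pn : P n.+1 = enc (zpos true) by rewrite /= /pchain eqxx.
have Pz : P 0 = enc (zpos false) by [].
have P1 : P 1 = enc (ppos r m' 1) by case: (@P_mid 1%N _) => //; lia.
have vQ : v \in eigsub L Theta (-1).
  apply/eigsubP; split; first exact: rootv_mem fr _ _.
  apply: (hat_inj fr) => a b; rewrite hat_Theta hatZ mxE (rootvE fr).
  case: (boolP (_ && _)) => [/andP[/eqP -> /eqP ->]|_].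
    by rewrite Pn P1 !on_enc /= /ppos mulr1.
  case: (boolP (_ && _)) => [/andP[/eqP -> /eqP ->]|_]; last by rewrite mulr0 subr0 !mulr0.
  by rewrite Pn P1 !lft_enc !on_enc /= /ppos mul1r.
have wv : weight_space (eigsub L Theta (-1)) T (xv V P 0) v.
  apply: (rootv_weight fr outer_diag vQ) => h Th; rewrite /xv Pz Pn !eps_hat // !T_zero //.
exists v; split=> //.
  apply/eqP => v0; have := rootv_gam fr (P n.+1) (P 1); rewrite -/v v0 hat0 mxE; apply/eqP.
  rewrite eq_sym; apply: (gam_sign (hat_sign tyH)).
  by rewrite Pn P1 lft_enc => /enc_inj.
move=> j Y _ wY; apply: (hat_inj fr) => a b; rewrite hat0 mxE.
apply/eqP; apply: contraT => /(lie_entry_neq0 fr)[c].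
pose rh := rho n.
have [k kn bk] : exists2 k, (0 < k <= n)%N & {in T, forall h, b0 j h = xv V P k h}.
  have [jn|jn] := ltnP j n; first by exists j.+1 => // h Th; rewrite xv0_T.
  have -> : nat_of_ord j = n by have := ltn_ord j; lia.
  by exists n => [|h Th]; [lia|rewrite xv0_last].
have hv a' b' : hat V v a' b' != 0 -> ev rh (on pwt a') - ev rh (on pwt b') = - n%:Z.
  move=> vab; have := weight_entry fr outer_diag wv vab (hT_mem fr outer_diag ch rh).
  rewrite (xv_hT fr ch) // !(eps_hT _ fr) -intrB => /eqP; rewrite eqr_int => /eqP <-.
  by rewrite xz0 /rh /rho; lia.
have hY a' b' : hat V Y a' b' != 0 -> ev rh (on pwt a') - ev rh (on pwt b') = - xz EB n k rh.
  move=> Yab; have := weight_entry fr outer_diag wY Yab (hT_mem fr outer_diag ch rh).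
  rewrite bk ?(hT_mem fr outer_diag ch) // (xv_hT fr ch); last by case/andP: kn.
  rewrite !(eps_hT _ fr) -intrN -intrB => /eqP.
  by rewrite eqr_int => /eqP ->.
have kpos : 0 < xz EB n k rh.
  have [->|kn'] := eqVneq k n; first by rewrite xzn // /rh /rho; lia.
  by rewrite xz_mid /rh /rho; lia.
have Tv := Theta_eigen vQ; have [YK _] := wY; have TY := Theta_eigen YK.
have bound q : - n%:Z <= ev rh (on pwt q) <= n%:Z /\ (on prh q = -1 -> ev rh (on pwt q) = 0).
  move: q; apply: pos_ind => p; rewrite !on_enc; case: p => [[q x]|[[q c'] i]].
    by rewrite /= ev0; split=> //; lia.
  split; last first.
    by move=> /= /eqP; rewrite -subr_eq0 opprK (_ : 1 + 1 = 2%:R) // pnatr_eq0.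
  have := pwt_bound q c' i; case: (pwt _) => [[|z]|z] zn.
  - by move: zn; rewrite ltnn.
  - by rewrite ev_nat // /rh /rho; lia.
  - by move: zn; rewrite NegzE abszN => zn; rewrite evN ev_nat // /rh /rho; lia.
have [ba za] := bound a; have [bb zb] := bound b.
have low : on prh a * on prh b = -1 -> ev rh (on pwt a) - ev rh (on pwt b) < - n%:Z -> False.
  have pr q : on prh q = 1 \/ on prh q = -1.
    by move: q; apply: pos_ind => p; rewrite on_enc; case: p => [[[] x]|q] /=; [right|left|left].
  case: (pr a) => pa; case: (pr b) => pb.
  - by rewrite pa pb mulr1 => /eqP; rewrite -subr_eq0 opprK (_ : 1 + 1 = 2%:R) // pnatr_eq0.
  - by rewrite (zb pb); lia.
  - by rewrite (za pa); lia.
  - by rewrite pa pb mulrNN mulr1 => /eqP; rewrite -subr_eq0 opprK (_ : 1 + 1 = 2%:R) // pnatr_eq0.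
have prc : on prh c * on prh c = 1.
  by move: c; apply: pos_ind => p; rewrite on_enc; case: p => [[[] x]|q] /=; rewrite ?mulrNN mulr1.
have mul x y : on prh a * on prh c = x -> on prh c * on prh b = y -> on prh a * on prh b = x * y.
  by move=> <- <-; rewrite mulrA -(mulrA (on prh a)) prc mulr1.
by move=> [[Yn vn]|[vn Yn]]; case: low;
  rewrite ?(mul _ _ (TY _ _ Yn) (Tv _ _ vn)) ?(mul _ _ (Tv _ _ vn) (TY _ _ Yn)) ?mul1r ?mulr1 //;
  have := hY _ _ Yn; have := hv _ _ vn; lia.
Qed.

Lemma outer_realization (A : 'I_n.+1 -> 'I_n.+1 -> int) (A' : nat -> nat -> int) :
  (forall i j, A i j = A' i j) -> (forall i, A i i = 2) -> chain_cartan EB n A' ->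
  @affine_realization (AffineDiagram 2 A) C N L theta H (fun i => xv V P i).
Proof.
move=> AA A2 AP; exists n.+1, b0, fork, Theta, rv0 => T'.
have n3 : (2 < n.+1)%N by lia.
split.
- split=> //.
  + exact: full_cartan frame0 diag0 chain0 wt0 n3 _.
  + exact: theta_H.
  + exact: full_simple frame0 diag0 chain0 sign0 wt0 n3 _.
  + by move=> i h Hh; exact: b0_theta.
  + apply: nt_prime_order => //; first by rewrite expgS expg1 tperm2.
    apply/eqP => /permP/(_ ord_max)/(congr1 val) /=; rewrite perm1 fork_eq /= eqxx.
    by lia.
- split.
  + by have := cj_aut Rmx_sq Rmx_form (mulr1 (1 : C)).
  + exact: theta_Theta.
  + by move=> i; have [w1 w2] := rv0_weight i; split=> //; exact: Theta_rv0.
- move=> [[|i] //= ni] _; exists (widen_ord (leqnSn n) (Ordinal (ni : (i < n)%N))) => h Th.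
  by rewrite xv0_T.
- move=> j; have [jn|jn] := ltnP j n.
    by exists (Ordinal (jn : (j.+1 < n.+1)%N)) => // h Th; rewrite xv0_T.
  exists ord_max => /= [|h Th]; first lia.
  have -> : nat_of_ord j = n by have := ltn_ord j; lia.
  by rewrite xv0_last.
split; last first.
  apply: (chain_has_cartan fr outer_diag ch n1 AA A2 AP) => i _.
  by split; exact: rootv_mem fr _ _.
by move=> [[|i] //= ni] _; rewrite expr1; exact: outer_lowest.
Qed.

End Outer.

(** * The affine Cartan matrices and their marks *)

Section Diagrams.
Variable n : nat.

Definition cartC (i j : nat) : int :=
  if i == j then 2
  else if (j == i.+1) || (i == j.+1) then
    (if ((i == 1%N) && (j == 0%N)) || ((i == n.-1) && (j == n)) then -2 else -1)
  else 0.

Definition cartD1 (i j : nat) : int :=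
  if i == j then 2 else if edgeD n i j || edgeD n j i then -1 else 0.

Definition cartD2 (i j : nat) : int :=
  if i == j then 2
  else if (j == i.+1) || (i == j.+1) then
    (if (i == 0%N) || (i == n) then -2 else -1)
  else 0.

Lemma cartC_chain : (1 < n)%N -> chain_cartan EC n cartC.
Proof.
move=> n1 i j ni nj; rewrite /cartC.
have [j0|j0] := eqVneq j 0%N.
  by rewrite j0 xz0 /cort; [do ![case: eqP => ?] => /=; lia|lia].
have [jn|jn] := eqVneq j n.
  by rewrite jn xzn // /cort; do ![case: eqP => ?] => /=; lia.
by rewrite xz_mid /cort; [do ![case: eqP => ?] => /=; lia|lia].
Qed.

Lemma cartD2_chain : (1 < n)%N -> chain_cartan EB n cartD2.
Proof.
move=> n1 i j ni nj; rewrite /cartD2.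
have [j0|j0] := eqVneq j 0%N.
  by rewrite j0 xz0 /cort; [do ![case: eqP => ?] => /=; lia|lia].
have [jn|jn] := eqVneq j n.
  by rewrite jn xzn // /cort; do ![case: eqP => ?] => /=; lia.
by rewrite xz_mid /cort; [do ![case: eqP => ?] => /=; lia|lia].
Qed.

Lemma cartD1_chain : (3 < n)%N -> chain_cartan ED n cartD1.
Proof.
move=> n1 i j ni nj; rewrite /cartD1.
have [j0|j0] := eqVneq j 0%N.
  by rewrite j0 xz0 /cort /edgeD; [do ?[case: ifP => ?]; lia|lia].
have [jn|jn] := eqVneq j n.
  by rewrite jn xzn /cort /edgeD; [do ?[case: ifP => ?]; lia|lia].
rewrite xz_mid; last lia.
rewrite /cort; have [i0|i0] := eqVneq i 0%N.
  by rewrite i0 /edgeD; do ?[case: ifP => ?]; lia.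
have [im|im] := eqVneq i n; first by rewrite im /edgeD; do ?[case: ifP => ?]; lia.
have [ij|ij] := eqVneq i j; first by rewrite ij eqxx; lia.
(* away from the ends the diagram is a chain *)
have -> : edgeD n i j || edgeD n j i = (j == i.+1) || (i == j.+1) by rewrite /edgeD; lia.
by case: ifP => ?; lia.
Qed.

(** The marks of C_n^(1), D_n^(1) and D_(n+1)^(2). *)
Definition mark (ty : endtype) (j : nat) : nat := match ty with
  | EC => if (j == 0) || (j == n) then 1 else 2
  | ED => if (j <= 1) || (n.-1 <= j) then 1 else 2
  | EB => 1 end%N.

(** The sum telescopes. *)
Lemma mark_relation ty t : (if ty is ED then 3 < n else 1 < n)%N ->
  \sum_(j < n.+1) (mark ty j)%:Z * xz ty n j t = 0.
Proof.
move=> n3; have n1 : (1 < n)%N by move: n3; case: ty; lia.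
pose G (j : nat) : int := if (j == 0%N) || (j == n.+1) then 0 else match ty with
  | EC => 2 * t j | EB => t j
  | ED => if j == 1%N then t 1%N + t 2%N else if j == n then t n.-1 + t n else 2 * t j end.
have e1 (j : 'I_n.+1) : true -> (mark ty j)%:Z * xz ty n j t = - (G j.+1 - G j).
  move=> _; have := ltn_ord j; move: (nat_of_ord j) => {}j jn.
  have [->|j0] := eqVneq j 0%N.
    rewrite xz0; last lia.
    rewrite /G /mark; move: n3; case: (ty) => n3 /=; do ?[case: eqP => ?] => /=; lia.
  have [->|jn'] := eqVneq j n.
    rewrite xzn // /G /mark; move: n3; case: (ty) => n3 /=; do ?[case: eqP => ?]; do ?[case: ifP => ?] => /=; lia.
  rewrite xz_mid; last lia.
  have [js|js] := eqVneq j.+1 n.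
    have jp : n.-1 = j by lia.
    have h1 : (n == n.+1) = false by lia.
    have h2 : (n == 1%N) = false by lia.
    have h3 : (j == n.+1) = false by lia.
    have h4 : (j == n) = false by lia.
    have h5 : (n == 0%N) = false by lia.
    rewrite /G /mark jp js eqxx h1 h2 h3 h4 h5 (negPf j0) /= -js.
    by move: n3; case: (ty) => n3 /=; do ?[case: ifP => ?]; lia.
  have [j1|j1] := eqVneq j 1%N.
    have h1 : (n == 2%N) = false by lia.
    have h2 : (2%N == n) = false by lia.
    have h3 : (1%N == n) = false by lia.
    have h4 : (1%N == n.+1) = false by lia.
    have h5 : (2%N == n.+1) = false by lia.
    rewrite /G /mark j1 h2 h3 h4 h5 /=; case: (ty) => /=; lia.
  have h1 : (j == n.+1) = false by lia.
  have h2 : (j == n) = false by lia.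
  have h3 : (j.+1 == n) = false by lia.
  have h4 : (j == 1%N) = false by lia.
  have h5 : (j == 0%N) = false by lia.
  have h6 : (j <= 1)%N || (n.-1 <= j)%N = false by lia.
  rewrite /G /mark eqSS h1 h2 h3 h4 h5 h6 /=; case: (ty) => /=; rewrite ?eqSS ?h2 ?h3 ?h5 /=; lia.
rewrite (eq_bigr _ e1) sumrN.
rewrite -(big_mkord xpredT (fun j => G j.+1 - G j)) telescope_sumr // /G eqxx orbT eqxx /=.
by rewrite subrr oppr0.
Qed.

Lemma double_vogan ty tw (A : 'I_n.+1 -> 'I_n.+1 -> int) (A' : nat -> nat -> int)
    (mid c : {set 'I_n.+1}) (k : nat) :
  (if ty is ED then 3 < n else 1 < n)%N ->
  (forall i j, A i j = A' i j) -> chain_cartan ty n A' ->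
  (forall i j, (i <= n)%N -> (j <= n)%N -> A' (n - i)%N (n - j)%N = A' i j) ->
  n = (k + k)%N -> (forall i : 'I_n.+1, (i \in mid) = (val i == k)) -> {subset c <= mid} ->
  (tw * mark ty k)%N = 2%N ->
  @double_vogan_diagram (AffineDiagram tw A) mid c (@rev_ord n.+1).
Proof.
move=> n3 AA AP Arev nk midE cm twk.
have kn : (k < n.+1)%N by lia.
have rv (i : 'I_n.+1) : val (rev_ord i) = (n - i)%N by rewrite /= subSS.
split.
- exists (fun i : 'I_n.+1 => mark ty i).
    split=> [i|| i] /=.
    + by rewrite /mark; case: (ty) => //; case: ifP.
    + rewrite (bigD1 ord0) //=; have -> : mark ty 0 = 1%N by case: (ty).
      by rewrite gcd1n.
    + apply: (chain_marks (m := fun j => (mark ty j)%:Z) AA AP) => t; exact: mark_relation.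
  rewrite /= (bigD1 (Ordinal kn)) ?midE //= big1 ?addn0 // => i /andP[].
  by rewrite midE => /eqP ik /eqP[]; apply: val_inj.
- split=> [|i j|i /cm] /=.
  + exact: rev_ordK.
  + by rewrite !AA !rv Arev // -ltnS.
  + by rewrite midE => /eqP ik; apply: val_inj; rewrite rv; move: ik => /= ->; rewrite nk addnK.
- move=> i; rewrite !midE rv; have := ltn_ord i; rewrite ltnS /=.
  by move: (nat_of_ord i) => {}i ni; apply/eqP/eqP; lia.
Qed.

Lemma rev_adjacent i j : (i <= n)%N -> (j <= n)%N ->
  ((n - i == n - j)%N = (i == j)) * ((n - j == (n - i).+1)%N = (i == j.+1)).
Proof. by move=> ni nj; split; lia. Qed.

Lemma cartC_rev i j : (1 < n)%N -> (i <= n)%N -> (j <= n)%N -> cartC (n - i) (n - j) = cartC i j.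
Proof.
move=> n1 ni nj; rewrite /cartC !rev_adjacent // [in LHS]orbC.
have -> : (n - i == 1)%N = (i == n.-1) by lia.
have -> : (n - j == 0)%N = (j == n) by lia.
have -> : (n - i == n.-1)%N = (i == 1%N) by lia.
have -> : (n - j == n)%N = (j == 0%N) by lia.
by rewrite [in LHS](orbC (_ && _)).
Qed.

Lemma cartD2_rev i j : (1 < n)%N -> (i <= n)%N -> (j <= n)%N -> cartD2 (n - i) (n - j) = cartD2 i j.
Proof.
move=> n1 ni nj; rewrite /cartD2 !rev_adjacent // [in LHS]orbC.
have -> : (n - i == 0)%N = (i == n) by lia.
have -> : (n - i == n)%N = (i == 0%N) by lia.
by rewrite (orbC (i == n)).
Qed.

Lemma cartD1_rev i j : (3 < n)%N -> (i <= n)%N -> (j <= n)%N -> cartD1 (n - i) (n - j) = cartD1 i j.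
Proof.
move=> n1 ni nj; rewrite /cartD1 orbC.
have E k l : (k <= n)%N -> (l <= n)%N -> edgeD n (n - k) (n - l) = edgeD n l k.
  by move=> nk nl; rewrite /edgeD; apply/idP/idP; lia.
by rewrite !E //; have -> : (n - i == n - j)%N = (i == j) by lia.
Qed.

End Diagrams.

(** * The symmetric pairs *)

Lemma cj_anticomm (C : numClosedFieldType) (N : nat) (A B X : 'M[C]_N) :
  A *m B = - (B *m A) -> cj A (cj B X) = cj B (cj A X).
Proof.
move=> AB; have : A *m B *m X *m (B *m A) = B *m A *m X *m (A *m B) by rewrite AB !mulNmx mulmxN.
by rewrite !cjE !mulmxA.
Qed.

Section Pair.
Variables (r m' : nat) (C : numClosedFieldType) (e d : C) (ty : endtype).
Local Notation m := m'.+1.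
Local Notation n := (m + m)%N.
Local Notation N := ((r + n) + (r + n))%N.
Local Notation pos := (pos r m').
Local Notation on := (@on r m' _).
Local Notation enc := (@enc r m').
Local Notation F := (Fmx r m' e).
Local Notation Q := (Qmx r m' C).
Local Notation W := (Wmx r m' d).
Local Notation L := (form_alg F).
Local Notation V := (Vmx r m' C).
Variable (x0 : bool -> pos).
Hypothesis tyH : type_ok e ty x0.
Hypothesis dd : d = 1 \/ d = -1.
Local Notation P := (enc \o pchain ty x0).

Let ee := type_e tyH.
Let er := type_er tyH.
Let fr := hat_frame tyH.
Let ch := hat_chain tyH.
Let e2 : e * e = 1. Proof. by case: ee => ->; rewrite ?mulrNN mulr1. Qed.
Let d2 : d * d = 1. Proof. by case: dd => ->; rewrite ?mulrNN mulr1. Qed.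

Lemma dim_gt : 0 < N%:R - 2 * e.
Proof.
have lt a b : (a < b)%N -> 0 < b%:R - a%:R :> C by move=> ab; rewrite subr_gt0 ltr_nat.
move: tyH; rewrite /type_ok; case: ty => -[r0 h].
- by rewrite h mulrN opprK mulr1 -natrD ltr0n addnS.
- by case: h => -> m1; rewrite mulr1 lt // r0; lia.
- by case: h => -> _; rewrite mulr1 lt // r0; lia.
Qed.

(** theta is -1 on the root vector of the black vertex. *)
Lemma theta_nontrivial : exists2 X, X \in L & cj Q X != X.
Proof.
exists (rootv V (lft pbar) (on (ps e)) (P m) (P m.+1)); first exact: rootv_mem fr _ _.
apply/eqP => h; have := hat_theta (rootv V (lft pbar) (on (ps e)) (P m) (P m.+1)) (P m) (P m.+1).
rewrite h (rootv_gam fr); have -> : on pq (P m) * on pq (P m.+1) = -1 :> C.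
  by rewrite pchain_mid pchain_midS !on_enc /pq /= mul1r.
rewrite mulN1r => /eqP.
have [_ _ _ _ g0] := ch; have := g0 m; rewrite leq_addr => /(_ isT) g.
by rewrite -addr_eq0 -mulr2n mulrn_eq0 /= (negPf g).
Qed.

(** sigma moves the support of a diagonal element. *)
Lemma sigma_nontrivial : exists2 X, X \in L & cj W X != X.
Proof.
pose a := enc (inr (false, false, inord 0)).
exists (rootv V (lft pbar) (on (ps e)) a a); first exact: rootv_mem fr _ _.
apply/eqP => h; have := hat_sigma dd (rootv V (lft pbar) (on (ps e)) a a) a a.
rewrite h !(rootvE fr) /a !lft_enc !enc_eq !on_enc /= divr1.
rewrite !eqE /= !eqE /= !eqxx /=.
by rewrite !mulr0 !subr0 mulr1 => /eqP; rewrite eq_sym oner_eq0.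
Qed.

Variables (H : {vspace 'M[C]_N}) (tw : nat) (A : 'I_n.+1 -> 'I_n.+1 -> int) (A' : nat -> nat -> int).
Hypothesis TP : diagonal_part V L (eigsub H (cj Q) 1).
Hypotheses (AA : forall i j, A i j = A' i j) (AP : chain_cartan ty n A').
Hypothesis Arev : forall i j, (i <= n)%N -> (j <= n)%N -> A' (n - i)%N (n - j)%N = A' i j.
Hypothesis twH : (tw * mark n ty m)%N = 2%N.
Hypothesis real : @affine_realization (AffineDiagram tw A) C N L (cj Q) H (fun i => xv V P i).

Let mid : {set 'I_n.+1} := [set i : 'I_n.+1 | val i == m].

Lemma pair_represented (c : {set 'I_n.+1}) (K0 K1 : nat) (g0 : set 'M[C]_K0) (h0 : set 'M[C]_K1) :
  (forall i, A i i = 2) -> {subset c <= mid} ->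
  (forall i : 'I_n.+1, val i = m -> - d * e = if i \in c then -1 else 1) ->
  real_lie_iso (hform F Q) g0 -> real_lie_iso (real_fixed (hform F Q) (cj W)) h0 ->
  @represents_pair (AffineDiagram tw A) C N L mid c (@rev_ord n.+1) K0 K1 g0 h0.
Proof.
move=> A2 cm hc ig ih; split.
  apply: (double_vogan _ AA AP Arev (erefl n) _ cm twH); last by move=> i; rewrite inE.
  by move: tyH; rewrite /type_ok; case: (ty) => // -[_ []]; lia.
have WQc := WQc (W_sq r m' dd) (W_anti r m' dd).
exists (hform F Q), (cj Q), (cj W); split.
- split=> //; apply: hform_real_form; [exact: F_orth|exact: F_real|exact: Q_adj|exact: Q_sq|exact: Q_form].
- have [X LX QX] := theta_nontrivial.
  exact: (hform_cartan (F_tr r m' ee) (F_orth r m' ee) e2 (F_real r m' ee) (Q_adj _ _ _)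
    (Q_sq _ _ _) (Q_form m' er) dim_gt LX QX).
- have [X LX WX] := sigma_nontrivial.
  apply: (hform_involution (W_sq r m' dd) (W_form m' er dd) d2 (W_adj r m' dd) _ LX WX).
  by right; exact: W_anti.
- by move=> X _; apply: cj_anticomm; rewrite WQc opprK.
- exact: (represents tyH dd TP AA A2 AP real hc).
Qed.

End Pair.

Lemma adj0 (C : numClosedFieldType) k l : adj (0 : 'M[C]_(k, l)) = 0.
Proof. by rewrite /adj trmx0 map_mx0. Qed.

Lemma adj_scalar (C : numClosedFieldType) k (a : C) : adj (a%:M : 'M_k) = (Num.conj a)%:M.
Proof. by rewrite /adj tr_scalar_mx map_scalar_mx. Qed.

(** ** Symmetric forms *)

Section SplitCase.
Variables (r m' : nat) (C : numClosedFieldType).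
Local Notation m := m'.+1.
Local Notation n := (m + m)%N.
Local Notation F := (Fmx r m' (1 : C)).
Local Notation Q := (Qmx r m' C).
Local Notation W := (Wmx r m').
Local Notation c2 := ((sqrtC 2)^-1 : C).

Let e1 : (1 : C) = 1 \/ (1 : C) = -1. Proof. by left. Qed.
Let er : (0 < r)%N -> (1 : C) = 1. Proof. by []. Qed.
Let s2 : c2 * c2 * 2 = 1.
Proof. by rewrite -invfM -expr2 sqrtCK mulVf // pnatr_eq0. Qed.
Let s2r : Num.conj c2 = c2.
Proof. by apply/CrealP/ger0_real; rewrite invr_ge0 sqrtC_ge0 ler0n. Qed.

(** On the (+1)-eigenspace of Q the form F has the matrix F0mx, with a hyperbolic part;
    rot is a unitary change of basis which turns it into the identity. *)
Definition rot2 : 'M[C]_n := c2 *: block_mx 1%:M 'i%:M 1%:M (- 'i)%:M.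
Definition rot : 'M[C]_(r + n) := block_mx 1%:M 0 0 rot2.

Lemma rot_unitary : adj rot *m rot = 1%:M.
Proof.
have scal (a b : C) : a%:M + b%:M = (a + b)%:M :> 'M_m by rewrite [RHS]raddfD.
rewrite /rot adj_block mulmx_block adj1 !adj0 !(mul0mx, mulmx0, mul1mx, addr0, add0r).
suff -> : adj rot2 *m rot2 = 1%:M by rewrite -scalar_mx_block.
rewrite /rot2 adjZ [Num.conj _]s2r -scalemxAl -scalemxAr scalerA adj_block adj1.
rewrite !adj_scalar rmorphN /= conjCi mulmx_block !mul1mx !mulmx1 -!scalar_mxM !scal.
rewrite !opprK !mulNr !mulrN -!expr2 !sqrCi !opprK addrN addNr !raddf0.
by rewrite -scalar_mx_block scale_scalar_mx s2.
Qed.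

Lemma rot_form : rot^T *m F0mx r m' 1 *m rot = 1%:M.
Proof.
have scal (a b : C) : a%:M + b%:M = (a + b)%:M :> 'M_m by rewrite [RHS]raddfD.
rewrite /rot /F0mx tr_block_mx !mulmx_block !trmx0 trmx1 !(mul0mx, mulmx0, mul1mx, mulmx1, addr0, add0r).
set S := block_mx 0 _ _ _.
suff -> : rot2^T *m S *m rot2 = 1%:M by rewrite -scalar_mx_block.
rewrite /rot2 [(_ *: _)^T]linearZ /= -!scalemxAl -scalemxAr scalerA tr_block_mx !mulmx_block !tr_scalar_mx.
rewrite !(mul0mx, mulmx0, mul1mx, mulmx1, addr0, add0r) -!scalar_mxM !scal.
rewrite !mulNr !mulrN -!expr2 !sqrCi !opprK addrN addNr !raddf0.
by rewrite -scalar_mx_block scale_scalar_mx s2.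
Qed.

Definition Jrot := Jmat r m' C *m rot.

Lemma Jrot_iso : adj Jrot *m Jrot = 1%:M.
Proof. by rewrite adjM mulmxA -(mulmxA (adj rot)) J_iso mulmx1 rot_unitary. Qed.

Lemma Jrot_proj : Jrot *m adj Jrot = 2^-1 *: (1%:M + Q).
Proof. by rewrite adjM mulmxA -(mulmxA (Jmat _ _ _)) (mulmx1C rot_unitary) mulmx1 J_proj. Qed.

Lemma Jrot_form : Jrot^T *m F *m Jrot = 1%:M.
Proof. by rewrite trmx_mul -rot_form -(J_form m' er) !mulmxA. Qed.

Let one_real : map_mx Num.conj (1%:M : 'M[C]_(r + n)) = 1%:M.
Proof. by rewrite map_mx1. Qed.

Let dm : (-1 : C) = 1 \/ (-1 : C) = -1. Proof. by right. Qed.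
Let WF d : d = 1 \/ d = -1 -> (W d)^T *m F *m W d = d *: F. Proof. exact: W_form. Qed.

Lemma split_so_pq : real_lie_iso (hform F Q) (so_pq C (r + n) (r + n)).
Proof.
apply: (hform_so_iso (W := W (-1)) (J := Jrot)).
- exact: Q_adj.
- exact: Q_sq.
- exact: Q_form.
- exact: Q_tr.
- exact: W_adj.
- exact: W_sq.
- exact: W_anti.
- by rewrite WF // scaleN1r.
- exact: Jrot_iso.
- exact: Jrot_proj.
- exact: Jrot_form.
Qed.

Let e2 : (1 : C) * 1 = 1. Proof. exact: mulr1. Qed.
Lemma split_soC : real_lie_iso (real_fixed (hform F Q) (cj (W 1))) (soC C (r + n)).
Proof.
apply: (mixed_form_iso (F_tr r m' e1) (F_orth r m' e1) e2 (F_real r m' e1) (Q_adj r m' C) (Q_sq r m' C)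
  (Q_form m' er) (Q_tr r m' C) (W_adj r m' e1) (W_sq r m' e1) (W_anti r m' e1) Jrot_iso Jrot_proj Jrot_form).
by rewrite WF // scale1r.
Qed.

Lemma split_glR : real_lie_iso (real_fixed (hform F Q) (cj (W (-1)))) (glR C (r + n)).
Proof.
have -> : glR C (r + n) = [set Y | Y *m 1%:M = 1%:M *m map_mx Num.conj Y]%classic.
  apply/seteqP; split=> Y; rewrite /glR /= mulmx1 mul1mx.
    by move=> /mxOverP h; apply/matrixP => i j; rewrite mxE; apply/esym/CrealP.
  by move=> h; apply/mxOverP => i j; apply/CrealP; rewrite {2}h mxE.
apply: (mixed_gl_iso (F_tr r m' e1) (F_orth r m' e1) e2 (F_real r m' e1) (Q_adj r m' C) (Q_sq r m' C)
  (Q_form m' er) (Q_tr r m' C) (W_adj r m' dm) (W_sq r m' dm) (W_anti r m' dm) Jrot_iso Jrot_proj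
  Jrot_form one_real).
by rewrite WF // scaleN1r.
Qed.

End SplitCase.

(** ** Alternating forms *)

Section SymplecticCase.
Variables (m' : nat) (C : numClosedFieldType).
Local Notation m := m'.+1.
Local Notation n := (m + m)%N.
Local Notation F := (Fmx 0 m' (-1 : C)).
Local Notation Q := (Qmx 0 m' C).
Local Notation W := (Wmx 0 m').

Let e1 : (-1 : C) = 1 \/ (-1 : C) = -1. Proof. by right. Qed.
Let er : (0 < 0)%N -> (-1 : C) = 1. Proof. by []. Qed.
Let e2 : (-1 : C) * -1 = 1. Proof. by rewrite mulrNN mulr1. Qed.
Let dp : (1 : C) = 1 \/ (1 : C) = -1. Proof. by left. Qed.

Lemma symplectic_F : F = Jmx C n.
Proof. by rewrite /Fmx /Jmx raddfN. Qed.

Lemma symplectic_F0 : F0mx 0 m' (-1) = Jmx C m.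
Proof.
have E (i : 'I_n) : i = rshift 0 i :> 'I_(0 + n) by exact: val_inj.
apply/matrixP=> i j; rewrite (E i) (E j) /F0mx block_mxEdr.
by rewrite /Jmx raddfN -!E.
Qed.

Lemma symplectic_Q : Q = block_mx (Ipq C m m) 0 0 (Ipq C m m).
Proof.
have E (i : 'I_n) : rshift 0 i = i :> 'I_(0 + n) by exact: val_inj.
rewrite /Qmx /Vconj Vmx_inner mul1mx mulmx1 /Qhat.
apply: pos_matrixP => p q; rewrite monoE.
case: p q => [[b []]//|[[b c] j]] [[b' []]//|[[b' c'] j']].
have [<-|bb] := eqVneq b b'; last first.
  have -> : (inr (b, c, j) == id (inr (b', c', j')) :> pos 0 m') = false.
    by apply/eqP => -[] /eqP; rewrite (negPf bb).
  rewrite mulr0n; case: b b' bb => -[] // _;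
  by rewrite /enc /= (block_mxEdl, block_mxEur) mxE.
have -> : (inr (b, c, j) == id (inr (b, c', j')) :> pos 0 m') = (c == c') && (j == j').
  by apply/eqP/andP => [[-> ->]|[/eqP -> /eqP ->]].
rewrite /pq /=; have -> : block_mx (Ipq C m m) 0 0 (Ipq C m m) (@enc 0 m' (inr (b, c, j))) (@enc 0 m' (inr (b, c', j'))) =
   Ipq C m m (if c then rshift m j else lshift m j) (if c' then rshift m j' else lshift m j').
  by case: b; rewrite /enc /= (block_mxEul, block_mxEdr) !E.
case: c; case: c'; rewrite /Ipq (block_mxEul, block_mxEdr, block_mxEdl, block_mxEur) !mxE //.
by rewrite mulNrn.
Qed.

Lemma real_lie_iso_refl N (g : set 'M[C]_N) : real_lie_iso g g.
Proof. by exists id; split=> //; exact: image_id. Qed.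

Lemma symplectic_sp_pq : real_lie_iso (hform F Q) (sp_pq C m m).
Proof.
rewrite symplectic_F symplectic_Q; exact: real_lie_iso_refl.
Qed.

Let F0r : map_mx Num.conj (F0mx 0 m' (-1 : C)) = F0mx 0 m' (-1).
Proof.
by rewrite /F0mx !map_block_mx !map_mx0 !map_mx1 map_scalar_mx /= rmorphN1.
Qed.

Lemma symplectic_spC : real_lie_iso (real_fixed (hform F Q) (cj (W 1))) (spC C m).
Proof.
rewrite /spC -symplectic_F0.
apply: (mixed_form_iso (F_tr 0 m' e1) (F_orth 0 m' e1) e2 (F_real 0 m' e1) (Q_adj 0 m' C) (Q_sq 0 m' C)
  (Q_form m' er) (Q_tr 0 m' C) (W_adj 0 m' dp) (W_sq 0 m' dp) (W_anti 0 m' dp) (J_iso 0 m' C)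
  (J_proj 0 m' C) (J_form m' er)).
by rewrite W_form // scale1r.
Qed.

(** Up to a sign, v |-> J (conj v) is the multiplication of H^m by the quaternion j on
    the side which commutes with matrices. *)
Lemma glHP (Y : 'M[C]_n) : glH C m Y <-> Y *m Jmx C m = Jmx C m *m map_mx Num.conj Y.
Proof.
rewrite -[Y]submxK; set A := ulsubmx Y; set B := ursubmx Y; set D := dlsubmx Y; set E := drsubmx Y.
have eqJ : (block_mx A B D E *m Jmx C m = Jmx C m *m map_mx Num.conj (block_mx A B D E)) <->
    [/\ - B = map_mx Num.conj D, A = map_mx Num.conj E, - E = - map_mx Num.conj A & D = - map_mx Num.conj B].
  rewrite /Jmx map_block_mx !mulmx_block !(mul0mx, mulmx0, mul1mx, mulmx1, mulNmx, mulmxN, addr0, add0r).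
  by split=> [/eq_block_mx|[-> -> -> ->]].
rewrite eqJ; split=> [[A' [B' /eq_block_mx[-> -> -> ->]]]|[h1 h2 h3 h4]].
  split=> //.
  - by apply/matrixP => i j; rewrite !mxE rmorphN /= conjCK.
  - by apply/matrixP => i j; rewrite !mxE conjCK.
by exists A, B; rewrite -h4; congr block_mx; exact: oppr_inj.
Qed.

Lemma symplectic_glH : real_lie_iso (real_fixed (hform F Q) (cj (W (-1)))) (glH C m).
Proof.
have -> : glH C m = [set Y | Y *m F0mx 0 m' (-1) = F0mx 0 m' (-1) *m map_mx Num.conj Y]%classic.
  by rewrite symplectic_F0; apply/seteqP; split=> Y /glHP.
apply: (mixed_gl_iso (F_tr 0 m' e1) (F_orth 0 m' e1) e2 (F_real 0 m' e1) (Q_adj 0 m' C) (Q_sq 0 m' C)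
  (Q_form m' er) (Q_tr 0 m' C) (W_adj 0 m' e1) (W_sq 0 m' e1) (W_anti 0 m' e1) (J_iso 0 m' C)
  (J_proj 0 m' C) (J_form m' er) F0r).
by rewrite W_form // scaleN1r.
Qed.

End SymplecticCase.

(** ** The two markings of the middle vertex *)

Section BothMarkings.
Variables (r m' : nat) (C : numClosedFieldType) (e : C) (ty : endtype).
Local Notation m := m'.+1.
Local Notation n := (m + m)%N.
Local Notation N := ((r + n) + (r + n))%N.
Local Notation F := (Fmx r m' e).
Local Notation Q := (Qmx r m' C).
Local Notation W := (Wmx r m').
Variables (x0 : bool -> pos r m') (H : {vspace 'M[C]_N}) (tw : nat).
Variables (A : 'I_n.+1 -> 'I_n.+1 -> int) (A' : nat -> nat -> int).
Hypotheses (tyH : type_ok e ty x0) (AA : forall i j, A i j = A' i j).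

(** The scalar on the root space of the black vertex being - d e, d = - e leaves it
    uncircled and d = e circles it. *)
Lemma both_represented (K0 K1 K2 : nat) (g0 : set 'M[C]_K0) (h1 : set 'M[C]_K1) (h2 : set 'M[C]_K2) :
  chain_cartan ty n A' -> (forall i, A' i i = 2) ->
  (forall i j, (i <= n)%N -> (j <= n)%N -> A' (n - i)%N (n - j)%N = A' i j) ->
  (tw * mark n ty m)%N = 2%N ->
  diagonal_part (Vmx r m' C) (form_alg F) (eigsub H (cj Q) 1) ->
  @affine_realization (AffineDiagram tw A) C N (form_alg F) (cj Q) H
    (fun i => xv (Vmx r m' C) (@enc r m' \o pchain ty x0) i) ->
  real_lie_iso (hform F Q) g0 ->
  real_lie_iso (real_fixed (hform F Q) (cj (W (- e)))) h1 ->
  real_lie_iso (real_fixed (hform F Q) (cj (W e))) h2 ->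
  let mid := [set i : 'I_n.+1 | val i == m] in
  @represents_pair (AffineDiagram tw A) C N (form_alg F) mid finset.set0 (@rev_ord n.+1) K0 K1 g0 h1 /\
  @represents_pair (AffineDiagram tw A) C N (form_alg F) mid mid (@rev_ord n.+1) K0 K2 g0 h2.
Proof.
move=> AP A2 Arev twk TP re ig ih1 ih2 mid.
have [de dN e2] : [/\ e = 1 \/ e = -1, - e = 1 \/ - e = -1 & e * e = 1].
  by case: (type_e tyH) => ->; rewrite ?opprK ?mulrNN mulr1; split; auto.
have A2' i : A i i = 2 by rewrite AA.
split.
  apply: (pair_represented tyH dN TP AA AP Arev twk re _ _ _ ig ih1) => // i; first by rewrite inE.
  by rewrite inE opprK e2.
apply: (pair_represented tyH de TP AA AP Arev twk re _ _ _ ig ih2) => // i im.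
by rewrite inE im eqxx mulNr e2.
Qed.

End BothMarkings.

(** ** The three series *)

Section Cases.
Variables (m' : nat) (C : numClosedFieldType).
Local Notation m := m'.+1.
Local Notation n := (m + m)%N.

Let n1 : (1 < n)%N. Proof. lia. Qed.

Lemma represented_C :
  let mid := [set i : 'I_(nvert (affC n)) | val i == m] in
  represents_pair (type_C C n) mid finset.set0 (@rev_ord n.+1) (sp_pq C m m) (spC C m) /\
  represents_pair (type_C C n) mid mid (@rev_ord n.+1) (sp_pq C m m) (glH C m).
Proof.
pose x0 (b : bool) : pos 0 m' := inr (b, false, ord0).
have ty : type_ok (-1 : C) EC x0 by [].
have AA (i j : 'I_n.+1) : cartan (a := affC n) i j = cartC n i j by rewrite /= /cartC -val_eqE.
have AP := cartC_chain n1.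
have A2 i : cartC n i i = 2 by rewrite /cartC eqxx.
rewrite /type_C -symplectic_F; apply: (both_represented  ty AA AP A2).
- by move=> i j; exact: cartC_rev.
- by rewrite /mark; case: ifP => //; lia.
- exact: (inner_T_diag ty).
- by apply: (inner_realization ty _ AA _ AP) => // i; rewrite AA.
- exact: symplectic_sp_pq.
- rewrite opprK; exact: symplectic_spC.
- exact: symplectic_glH.
Qed.

Lemma represented_D1 : (0 < m')%N ->
  let mid := [set i : 'I_(nvert (affD1 n)) | val i == m] in
  represents_pair (type_D C n) mid finset.set0 (@rev_ord n.+1) (so_pq C n n) (glR C n) /\
  represents_pair (type_D C n) mid mid (@rev_ord n.+1) (so_pq C n n) (soC C n).
Proof.
move=> m1; pose x0 (b : bool) : pos 0 m' := inr (b, false, ord0).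
have n3 : (3 < n)%N by lia.
have ty : type_ok (1 : C) ED x0 by [].
have AA (i j : 'I_n.+1) : cartan (a := affD1 n) i j = cartD1 n i j by rewrite /= /cartD1 -val_eqE.
have AP := cartD1_chain n3.
have A2 i : cartD1 n i i = 2 by rewrite /cartD1 eqxx.
apply: (both_represented  ty AA AP A2).
- by move=> i j; exact: cartD1_rev.
- by rewrite /mark; case: ifP => //; lia.
- exact: (inner_T_diag ty).
- by apply: (inner_realization ty _ AA _ AP) => // i; rewrite AA.
- exact: split_so_pq.
- exact: split_glR.
- exact: split_soC.
Qed.

Lemma represented_D2 :
  let mid := [set i : 'I_(nvert (affD2 n.+1)) | val i == m] in
  represents_pair (type_D C n.+1) mid finset.set0 (@rev_ord n.+1) (so_pq C n.+1 n.+1) (glR C n.+1) /\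
  represents_pair (type_D C n.+1) mid mid (@rev_ord n.+1) (so_pq C n.+1 n.+1) (soC C n.+1).
Proof.
have ty := outer_type m' C.
have AA (i j : 'I_n.+1) : cartan (a := affD2 n.+1) i j = cartD2 n i j by rewrite /= /cartD2 -val_eqE.
have AP := cartD2_chain n1.
have A2 i : cartD2 n i i = 2 by rewrite /cartD2 eqxx.
apply: (both_represented ty AA AP A2).
- by move=> i j; exact: cartD2_rev.
- by [].
- exact: outer_diag.
- by apply: (outer_realization C AA _ AP) => // i; rewrite AA.
- exact: split_so_pq.
- exact: split_glR.
- exact: split_soC.
Qed.

End Cases.

Theorem theorem1p2 (R : realType) :
  [/\ (* (a) L = C_n with n = 2m *)
      forall m : nat, (0 < m)%N ->
        let D := affC (m + m) in
        let L := type_C R[i] (m + m) in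
        let mid := [set i : 'I_(nvert D) | val i == m] in
        let d : 'I_(nvert D) -> 'I_(nvert D) := @rev_ord (nvert D) in
        represents_pair L mid finset.set0 d (sp_pq R[i] m m) (spC R[i] m) /\
        represents_pair L mid mid d (sp_pq R[i] m m) (glH R[i] m),
      (* (b) L = D_n with n even *)
      forall n : nat, (4 <= n)%N -> ~~ odd n ->
        let D := affD1 n in
        let L := type_D R[i] n in
        let mid := [set i : 'I_(nvert D) | val i == n./2] in
        let d : 'I_(nvert D) -> 'I_(nvert D) := @rev_ord (nvert D) in
        represents_pair L mid finset.set0 d (so_pq R[i] n n) (glR R[i] n) /\
        represents_pair L mid mid d (so_pq R[i] n n) (soC R[i] n)
    & (* (c) L = D_n with n odd *)
      forall n : nat, (3 <= n)%N -> odd n ->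
        let D := affD2 n in
        let L := type_D R[i] n in
        let mid := [set i : 'I_(nvert D) | val i == n.-1./2] in
        let d : 'I_(nvert D) -> 'I_(nvert D) := @rev_ord (nvert D) in
        represents_pair L mid finset.set0 d (so_pq R[i] n n) (glR R[i] n) /\
        represents_pair L mid mid d (so_pq R[i] n n) (soC R[i] n)].
Proof.
split=> [[//|m'] _|n n4 ne|n n3 no].
- exact: represented_C.
- have [m' m1 ->] : exists2 m', (0 < m')%N & n = (m'.+1 + m'.+1)%N.
    by exists n./2.-1; have := even_halfK ne; lia.
  by rewrite addnn doubleK -addnn; exact: represented_D1.
have [m' ->] : exists m', n = (m'.+1 + m'.+1).+1.
  by exists n./2.-1; have := odd_double_half n; rewrite no; lia.
by rewrite -[_.+1.-1]/(m'.+1 + m'.+1)%N addnn doubleK -addnn; exact: represented_D2.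
Qed.
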